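(* In the setting of the smooth family $\mu\in\mathcal{O}\mapsto\psi_\mu\in H^2_{per,e}([0,L_0])$ of $L_0$-periodic solutions of $-\psi''+g(\mu,\psi)=0$ with $\psi_{\mu_0}=\phi_{\mu_0}$ and $\ker(\mathcal{L}_{\mu_0})=\mathrm{span}\{\phi'_{\mu_0}\}$, the family of operators $\mathcal{L}_{\psi_\mu}=-\partial_x^2+g'(\mu,\psi_\mu)$, $\mu\in\mathcal{O}$, is isoinertial, i.e. $in(\mathcal{L}_{\psi_\mu})=in(\mathcal{L}_{\mu_0})$ for all $\mu\in\mathcal{O}$.
   Context: $\mathcal{P}\subset\mathbb{R}^n$ open, $g:\mathcal{P}\times\mathbb{R}\to\mathbb{R}$, $g'$ its derivative in the second argument. The family $\psi_\mu$ is as produced by the following result: given an even $L_0$-periodic solution $\phi_{\mu_0}$ of $-\phi''+g(\mu_0,\phi)=0$ with $\ker(\mathcal{L}_{\mu_0})=\mathrm{span}\{\phi'_{\mu_0}\}$, where $\mathcal{L}_{\mu_0}=-\partial_x^2+g'(\mu_0,\phi_{\mu_0})$, there is an open neighborhood $\mathcal{O}$ of $\mu_0$ and a smooth family of even $L_0$-periodic solutions $\psi_\mu$ with $\psi_{\mu_0}=\phi_{\mu_0}$. For an $L$-periodic function $Q$, the Hill operator $\mathcal{L}=-\partial_x^2+Q$ acts in $L^2_{per}([0,L])$ with domain $H^2_{per}([0,L])$; its inertial index $in(\mathcal{L})$ is the pair $(n,z)$ where $n$ is the dimension of the negative subspace of $\mathcal{L}$ and $z=\dim\ker(\mathcal{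L})$.
   Formalization: The family ψ_μ and a possibly smaller neighborhood O are asserted to exist with constant inertial index on O; for an arbitrary given O the claim fails (g(μ,u)=μu, ψ_μ=0, μ_0=1, O=R). g is assumed jointly smooth. *)

(* Defs.v *)
From Stdlib Require Import Reals Lra Lia.
From Stdlib Require Fin.
Open Scope R_scope.

Definition Rn (n : nat) : Type := Fin.t n -> R.

Definition upd {n : nat} (v : Rn n) (i : Fin.t n) (t : R) : Rn n :=
  fun j => if Fin.eq_dec i j then t else v j.

(** open subsets of R^n (sup-norm balls; equivalent to Euclidean topology) *)
Definition is_open {n : nat} (U : Rn n -> Prop) : Prop :=
  forall x, U x -> exists eps, 0 < eps /\
    forall y, (forall i, Rabs (y i - x i) < eps) -> U y.

Definition continuous_at {n : nat} (F : Rn n -> R) (x : Rn n) : Prop :=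
  forall eps, 0 < eps -> exists delta, 0 < delta /\
    forall y, (forall i, Rabs (y i - x i) < delta) -> Rabs (F y - F x) < eps.

Definition has_partial {n : nat} (F : Rn n -> R) (i : Fin.t n) (x : Rn n) (l : R) : Prop :=
  derivable_pt_lim (fun t => F (upd x i t)) (x i) l.

Fixpoint Ck {n : nat} (k : nat) (U : Rn n -> Prop) (F : Rn n -> R) : Prop :=
  match k with
  | O => forall x, U x -> continuous_at F x
  | S k' => (forall x, U x -> continuous_at F x) /\
      exists DF : Fin.t n -> Rn n -> R,
        (forall i x, U x -> has_partial F i x (DF i x)) /\
        (forall i, Ck k' U (DF i))
  end.

Definition smooth_on {n : nat} (U : Rn n -> Prop) (F : Rn n -> R) : Prop :=
  forall k, Ck k U F.

Definition tailv {n : nat} (v : Rn (S n)) : Rn n := fun i => v (Fin.FS i).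

Definition smooth_on_prod {n : nat} (U : Rn n -> Prop) (F : Rn n -> R -> R) : Prop :=
  smooth_on (fun v : Rn (S n) => U (tailv v)) (fun v => F (tailv v) (v Fin.F1)).

Definition periodic (L : R) (f : R -> R) : Prop := forall x, f (x + L) = f x.
Definition even (f : R -> R) : Prop := forall x, f (- x) = f x.

Fixpoint fsum (k : nat) (h : nat -> R) : R :=
  match k with O => 0 | S k' => fsum k' h + h k' end.

(** f is in the domain H^2_per([0,L]) of the Hill operator -d^2/dx^2 + Q and
    satisfies (-d^2/dx^2 + Q) f = lam f  (f = 0 allowed).  For continuous Q,
    H^2 solutions are classical C^2 solutions, so we state it classically. *)
Definition eigen_eq (Q : R -> R) (L : R) (lam : R) (f : R -> R) : Prop :=
  periodic L f /\
  exists f' f'' : R -> R,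
    (forall x, derivable_pt_lim f x (f' x)) /\
    (forall x, derivable_pt_lim f' x (f'' x)) /\
    (forall x, - f'' x + Q x * f x = lam * f x).

Definition in_ker (Q : R -> R) (L : R) (f : R -> R) : Prop := eigen_eq Q L 0 f.

Definition in_neg (Q : R -> R) (L : R) (f : R -> R) : Prop :=
  exists (k : nat) (c lams : nat -> R) (fs : nat -> R -> R),
    (forall i, (i < k)%nat -> lams i < 0 /\ eigen_eq Q L (lams i) (fs i)) /\
    (forall x, f x = fsum k (fun i => c i * fs i x)).

Definition lin_indep (k : nat) (fs : nat -> R -> R) : Prop :=
  forall c : nat -> R,
    (forall x, fsum k (fun i => c i * fs i x) = 0) ->
    forall i, (i < k)%nat -> c i = 0.

Definition has_dim (V : (R -> R) -> Prop) (d : nat) : Prop :=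
  (exists fs : nat -> R -> R, (forall i, (i < d)%nat -> V (fs i)) /\ lin_indep d fs) /\
  (forall fs : nat -> R -> R, (forall i, (i < S d)%nat -> V (fs i)) -> ~ lin_indep (S d) fs).

Definition inertia (Q : R -> R) (L : R) (n z : nat) : Prop :=
  has_dim (in_neg Q L) n /\ has_dim (in_ker Q L) z.

Definition same_inertia (Q1 Q2 : R -> R) (L : R) : Prop :=
  exists n z, inertia Q1 L n z /\ inertia Q2 L n z.

(* Main.v *)
(** Even [L]-periodic solutions of [u'' = g mu u] are the solutions with [u' 0 = u' (L/2) = 0]. The
    kernel hypothesis says that the even solution [y1] of the linearised equation satisfies
    [y1' (L/2) <> 0]; hence the shooting parameter [u 0] can be adjusted when [mu] moves, and the
    linearised Neumann problem on [[0, L/2]] stays uniformly invertible, which yields first continuity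
    and then, by bootstrapping through linear initial value problems, smoothness of [psi] in [mu].

    The potentials [g' mu (psi mu x)] are even, so the periodic spectrum of the Hill operator is the
    union of the Neumann and the Dirichlet spectrum on [[0, L/2]], i.e. of the zeros in [lam] of
    [Y1' (L/2)] and [Y2 (L/2)], all of which are simple. The number of negative zeros can therefore
    change only through [lam = 0]. The Neumann function does not vanish there, and the Dirichlet
    function either does not vanish at [mu0] (when [phi] is constant) or vanishes for all [mu] near
    [mu0], because [psi mu] is then nonconstant and its derivative is an odd periodic solution. *)

From Stdlib Require Import Reals Lra Lia List Classical ClassicalEpsilon FunctionalExtensionality.
From Coquelicot Require Import Coquelicot.
Require Import Defs.
Open Scope R_scope.

Set Bullet Behavior "Strict Subproofs".

(** * Second order initial value problems *)

(** Everything is read off from initial value problems, so no Sobolev space, implicit function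
    theorem or spectral theorem enters. One Gronwall estimate gives uniqueness and continuous
    dependence. Continuous dependence is stated for an arbitrary filter, so that one lemma yields
    continuity in [mu], convergence of difference quotients in [mu] and in [lam], and joint
    continuity in both. The obstacle is that an initial value problem controls nothing before [u 0]
    is known, whereas the solutions sought are fixed by two boundary conditions. The kernel
    hypothesis repairs this: an even kernel element is a multiple of the odd function [dphi], hence
    vanishes at 0, so [y1] with [y1 0 = 1] cannot meet the second Neumann condition. The resulting
    bound survives small perturbations of the potential, in particular the replacement of [g'] by
    secant slopes of [g mu], and therefore controls differences of nonlinear solutions. Counting
    eigenvalues needs a compact window for [lam]; a uniform bound on the potentials provides its
    lower end. Constancy of the inertia is obtained at the end by shrinking [O] around [mu0]. *)

Notation dpl := derivable_pt_lim.

Lemma dpl_eq f x a b : dpl f x a -> a = b -> dpl f x b.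
Proof. now intros H <-. Qed.

Lemma dpl_plus f g x a b : dpl f x a -> dpl g x b -> dpl (fun t => f t + g t) x (a + b).
Proof. intros; now apply derivable_pt_lim_plus. Qed.

Lemma dpl_minus f g x a b : dpl f x a -> dpl g x b -> dpl (fun t => f t - g t) x (a - b).
Proof. intros; now apply derivable_pt_lim_minus. Qed.

Lemma dpl_opp f x a : dpl f x a -> dpl (fun t => - f t) x (- a).
Proof. intros; now apply derivable_pt_lim_opp. Qed.

Lemma dpl_mult f g x a b : dpl f x a -> dpl g x b ->
  dpl (fun t => f t * g t) x (a * g x + f x * b).
Proof. intros; now apply (derivable_pt_lim_mult f g). Qed.

Lemma dpl_const c x : dpl (fun _ => c) x 0.
Proof. apply (derivable_pt_lim_const c). Qed.

Lemma dpl_id x : dpl (fun t => t) x 1.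
Proof. apply derivable_pt_lim_id. Qed.

Lemma dpl_comp f g x a b : dpl f x a -> dpl g (f x) b -> dpl (fun t => g (f t)) x (b * a).
Proof. intros; now apply (derivable_pt_lim_comp f g). Qed.

Lemma dpl_affine f c d x a : dpl f (c * x + d) a -> dpl (fun t => f (c * t + d)) x (c * a).
Proof.
  intros H. replace (c * a) with (a * c) by ring.
  apply (dpl_comp (fun t => c * t + d) f); [|exact H].
  eapply dpl_eq; [apply dpl_plus; [apply dpl_mult; [apply dpl_const|apply dpl_id]|apply dpl_const]|cbv beta; ring].
Qed.

Lemma dpl_ext f g x a : (forall t, f t = g t) -> dpl f x a -> dpl g x a.
Proof. intros H; apply functional_extensionality in H; now subst. Qed.

Lemma dpl_cont f x a : dpl f x a -> continuity_pt f x.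
Proof. intros H; apply derivable_continuous_pt; now exists a. Qed.

(** The derivative is left as an existential variable, computed from the shape of the function with
    hypotheses at the leaves, and only then compared with the announced value. The trailing [fail]
    rejects hypotheses that leave goals open. *)
Ltac der1 := first
  [ eassumption
  | match goal with H : context[dpl _ _ _] |- _ => apply H; eauto; fail end
  | apply dpl_const | apply dpl_id
  | apply dpl_plus | apply dpl_minus | apply dpl_opp | apply dpl_mult ].
Ltac der := eapply dpl_eq; [ repeat der1 | cbv beta ].

(** * Energy and comparison estimates *)

Lemma incr_of_deriv_ge0 f df a b : a <= b ->
  (forall x, a <= x <= b -> dpl f x (df x)) ->
  (forall x, a <= x <= b -> 0 <= df x) -> f a <= f b.
Proof.
  intros Hab Hd Hp. destruct (Rle_lt_or_eq_dec _ _ Hab) as [h|<-]; [|lra].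
  destruct (MVT_cor2 f df a b h Hd) as [c [Hc1 Hc2]].
  specialize (Hp c ltac:(lra)). nra.
Qed.

(** As [exp k >= 1], it may stand in for its own square root. The loss is harmless, since only the
    existence of some constant matters. *)
Lemma sqrt_le_bound a S k : 0 <= S -> 0 <= k -> a * a <= S * S * exp k -> Rabs a <= S * exp k.
Proof.
  intros HS Hk H. pose proof (exp_ineq1_le k). pose proof (exp_pos k).
  assert (0 <= S * exp k) by nra.
  destruct (Rle_lt_dec (Rabs a) (S * exp k)) as [h|h]; auto.
  exfalso. assert (a * a = Rabs a * Rabs a) by (unfold Rabs; destruct Rcase_abs; ring).
  assert (S * exp k * (S * exp k) < Rabs a * Rabs a) by nra.
  assert (S * S * exp k <= S * exp k * (S * exp k)).
  { replace (S * exp k * (S * exp k)) with (S * S * exp k * exp k) by ring.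
    assert (0 <= S * S * exp k) by (apply Rmult_le_pos; nra). nra. }
  lra.
Qed.

(* Gronwall for the energy [y^2 + y'^2 + eta^2]. *)
Lemma energy_right (y dy ddy : R -> R) (a b M eta : R) : 0 <= M -> 0 <= eta ->
  (forall x, a <= x <= b -> dpl y x (dy x)) -> (forall x, a <= x <= b -> dpl dy x (ddy x)) ->
  (forall x, a <= x <= b -> Rabs (ddy x) <= M * Rabs (y x) + eta) ->
  forall x, a <= x <= b ->
    Rabs (y x) <= (Rabs (y a) + Rabs (dy a) + eta) * exp ((2 + M) * (b - a)) /\
    Rabs (dy x) <= (Rabs (y a) + Rabs (dy a) + eta) * exp ((2 + M) * (b - a)).
Proof.
  intros HM He Hy Hdy Hb x Hx.
  set (E := fun t => (y t * y t + dy t * dy t + eta * eta) * exp (- (2 + M) * t + (2 + M) * a)).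
  assert (HE : E x <= E a).
  { cut (- E a <= - E x); [lra|].
    apply (incr_of_deriv_ge0 (fun t => - E t) (fun t =>
      - ((2 * y t * dy t + 2 * dy t * ddy t - (2 + M) * (y t * y t + dy t * dy t + eta * eta))
       * exp (- (2 + M) * t + (2 + M) * a)))); [lra| |].
    - intros t Ht. specialize (Hy t ltac:(lra)). specialize (Hdy t ltac:(lra)).
      apply dpl_opp. unfold E. eapply dpl_eq.
      + apply dpl_mult.
        * repeat der1.
        * apply (dpl_affine exp). apply derivable_pt_lim_exp.
      + simpl. ring.
    - intros t Ht. specialize (Hb t ltac:(lra)).
      pose proof (exp_pos (- (2 + M) * t + (2 + M) * a)) as Hp.
      (* The rate [2 + M] comes from three Young inequalities, for the products [Y * D], [M * Y * D]
         and [D * eta]; the last one is why [eta * eta] is part of the energy. *)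
      assert (2 * y t * dy t + 2 * dy t * ddy t <= (2 + M) * (y t * y t + dy t * dy t + eta * eta)).
      { set (Y := Rabs (y t)) in *. set (D := Rabs (dy t)).
        assert (y t * y t = Y * Y) as -> by (unfold Y, Rabs; destruct Rcase_abs; ring).
        assert (dy t * dy t = D * D) as -> by (unfold D, Rabs; destruct Rcase_abs; ring).
        assert (0 <= Y) by apply Rabs_pos. assert (0 <= D) by apply Rabs_pos.
        assert (y t * dy t <= Y * D) by (unfold Y, D; rewrite <- Rabs_mult; apply Rle_abs).
        assert (dy t * ddy t <= D * (M * Y + eta)).
        { apply Rle_trans with (D * Rabs (ddy t)).
          - unfold D. rewrite <- Rabs_mult; apply Rle_abs.
          - now apply Rmult_le_compat_l. }
        assert (0 <= M * (Y - D) ^ 2) by (apply Rmult_le_pos; [lra|apply pow2_ge_0]).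
        pose proof (pow2_ge_0 (Y - D)). pose proof (pow2_ge_0 (D - eta)).
        assert (0 <= M * (eta * eta)) by (apply Rmult_le_pos; nra).
        pose proof (pow2_ge_0 Y). pose proof (pow2_ge_0 eta). nra. }
      nra. }
  unfold E in HE.
  replace (- (2 + M) * a + (2 + M) * a) with 0 in HE by ring. rewrite exp_0, Rmult_1_r in HE.
  set (S := Rabs (y a) + Rabs (dy a) + eta).
  assert (HS0 : 0 <= S) by (unfold S; pose proof (Rabs_pos (y a)); pose proof (Rabs_pos (dy a)); lra).
  assert (HS : y a * y a + dy a * dy a + eta * eta <= S * S).
  { assert (y a * y a = Rabs (y a) * Rabs (y a)) as -> by (unfold Rabs; destruct Rcase_abs; ring).
    assert (dy a * dy a = Rabs (dy a) * Rabs (dy a)) as -> by (unfold Rabs; destruct Rcase_abs; ring).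
    unfold S. pose proof (Rabs_pos (y a)); pose proof (Rabs_pos (dy a)). nra. }
  set (k := (2 + M) * (b - a)).
  assert (Hk : 0 <= k) by (unfold k; nra).
  assert (HE2 : y x * y x + dy x * dy x + eta * eta <= S * S * exp k).
  { set (k' := (2 + M) * x - (2 + M) * a).
    assert (exp (- (2 + M) * x + (2 + M) * a) * exp k' = 1).
    { rewrite <- exp_plus. unfold k'. replace (_ + _) with 0 by ring. apply exp_0. }
    assert (exp k' <= exp k).
    { destruct (Rle_lt_or_eq_dec k' k) as [h|h]; [unfold k', k; nra| |].
      - left; now apply exp_increasing.
      - rewrite h; lra. }
    pose proof (exp_pos k').
    apply Rle_trans with (S * S * exp k').
    - set (A := y x * y x + dy x * dy x + eta * eta) in *.
      replace A with (A * exp (- (2 + M) * x + (2 + M) * a) * exp k') by (rewrite Rmult_assoc, H; ring).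
      apply Rmult_le_compat_r; lra.
    - apply Rmult_le_compat_l; nra. }
  split; apply sqrt_le_bound; auto; nra.
Qed.

(** Time reversal of [energy_right]; the argument is written [-1 * t + 0] to fit [dpl_affine]. *)
Lemma energy_left (y dy ddy : R -> R) (a b M eta : R) : 0 <= M -> 0 <= eta ->
  (forall x, a <= x <= b -> dpl y x (dy x)) -> (forall x, a <= x <= b -> dpl dy x (ddy x)) ->
  (forall x, a <= x <= b -> Rabs (ddy x) <= M * Rabs (y x) + eta) ->
  forall x, a <= x <= b ->
    Rabs (y x) <= (Rabs (y b) + Rabs (dy b) + eta) * exp ((2 + M) * (b - a)) /\
    Rabs (dy x) <= (Rabs (y b) + Rabs (dy b) + eta) * exp ((2 + M) * (b - a)).
Proof.
  intros HM He Hy Hdy Hb x Hx.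
  destruct (energy_right (fun t => y (-1 * t + 0)) (fun t => -1 * dy (-1 * t + 0))
    (fun t => -1 * (-1 * ddy (-1 * t + 0))) (- b) (- a) M eta HM He) with (x := - x) as [H1 H2].
  - intros t Ht. apply dpl_affine. apply Hy; lra.
  - intros t Ht. eapply dpl_eq.
    + apply dpl_mult; [apply dpl_const|]. apply dpl_affine. apply Hdy; lra.
    + simpl; ring.
  - intros t Ht. replace (-1 * (-1 * ddy (-1 * t + 0))) with (ddy (-1 * t + 0)) by ring.
    apply Hb; lra.
  - lra.
  - replace (-1 * - x + 0) with x in * by ring. replace (-1 * - b + 0) with b in * by ring.
    replace (- a - - b) with (b - a) in * by ring.
    replace (-1 * dy x) with (- dy x) in * by ring. replace (-1 * dy b) with (- dy b) in * by ring.
    rewrite !Rabs_Ropp in *. auto.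
Qed.

Lemma energy (y dy ddy : R -> R) (x0 r M eta : R) : 0 <= M -> 0 <= eta ->
  (forall x, dpl y x (dy x)) -> (forall x, dpl dy x (ddy x)) ->
  (forall x, Rabs (x - x0) <= r -> Rabs (ddy x) <= M * Rabs (y x) + eta) ->
  forall x, Rabs (x - x0) <= r ->
    Rabs (y x) <= (Rabs (y x0) + Rabs (dy x0) + eta) * exp ((2 + M) * r) /\
    Rabs (dy x) <= (Rabs (y x0) + Rabs (dy x0) + eta) * exp ((2 + M) * r).
Proof.
  intros HM He Hy Hdy Hb x Hx.
  assert (Hx' := Hx). apply Rabs_le_between in Hx.
  assert (0 <= r) by (pose proof (Rabs_pos (x - x0)); lra).
  destruct (Rle_dec x0 x).
  - replace r with (x0 + r - x0) by ring. apply (energy_right y dy ddy x0 (x0 + r)); auto; try lra.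
    intros t Ht. apply Hb. apply Rabs_le_between; lra.
  - replace r with (x0 - (x0 - r)) by ring. apply (energy_left y dy ddy (x0 - r) x0); auto; try lra.
    intros t Ht. apply Hb. apply Rabs_le_between; lra.
Qed.

(** Uniqueness for initial value problems: it is applied to differences of two solutions, with
    [eta = 0] and the radius chosen to reach [x]. *)
Lemma energy_zero (y dy ddy : R -> R) (x0 M : R) : 0 <= M ->
  (forall x, dpl y x (dy x)) -> (forall x, dpl dy x (ddy x)) ->
  (forall x, Rabs (ddy x) <= M * Rabs (y x)) ->
  y x0 = 0 -> dy x0 = 0 -> forall x, y x = 0 /\ dy x = 0.
Proof.
  intros HM Hy Hdy Hb H0 H1 x.
  destruct (energy y dy ddy x0 (Rabs (x - x0)) M 0) with (x := x) as [A B]; auto; try lra.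
  - intros t _. specialize (Hb t). lra.
  - rewrite H0, H1, Rabs_R0 in *. 
    pose proof (Rabs_pos (y x)). pose proof (Rabs_pos (dy x)).
    split; apply Rabs_eq_0; lra.
Qed.

Lemma convex_nonneg (k dk ddk : R -> R) :
  (forall x, dpl k x (dk x)) -> (forall x, dpl dk x (ddk x)) -> (forall x, 0 <= ddk x) ->
  k 0 = 0 -> dk 0 = 0 -> forall x, 0 <= k x.
Proof.
  intros Hk Hdk Hp H0 H1 x.
  destruct (Rle_dec 0 x).
  - rewrite <- H0. apply (incr_of_deriv_ge0 k dk); auto. intros t Ht.
    rewrite <- H1. apply (incr_of_deriv_ge0 dk ddk); auto. lra.
  - rewrite <- H0. cut (- k x <= - k 0); [lra|].
    apply (incr_of_deriv_ge0 (fun t => - k t) (fun t => - dk t)); auto; try lra.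
    + intros t _. now apply dpl_opp.
    + intros t Ht. cut (dk t <= dk 0); [lra|].
      apply (incr_of_deriv_ge0 dk ddk); auto. lra.
Qed.

(** Both [H + h] and [H - h] are convex with zero data at 0, hence nonnegative on either side of 0.
    Picard iterates are thus estimated without manipulating integrals. *)
Lemma second_order_comparison (h dh ddh H dH ddH : R -> R) :
  (forall x, dpl h x (dh x)) -> (forall x, dpl dh x (ddh x)) ->
  (forall x, dpl H x (dH x)) -> (forall x, dpl dH x (ddH x)) ->
  (forall x, Rabs (ddh x) <= ddH x) ->
  h 0 = 0 -> dh 0 = 0 -> H 0 = 0 -> dH 0 = 0 -> forall x, Rabs (h x) <= H x.
Proof.
  intros A1 A2 A3 A4 Hb B1 B2 B3 B4 x.
  apply Rabs_le_between. split.
  - cut (0 <= H x + h x); [lra|].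
    apply (convex_nonneg (fun x => H x + h x) (fun x => dH x + dh x) (fun x => ddH x + ddh x));
      try lra; intros t; try (now apply dpl_plus).
    specialize (Hb t). apply Rabs_le_between in Hb. lra.
  - cut (0 <= H x - h x); [lra|].
    apply (convex_nonneg (fun x => H x - h x) (fun x => dH x - dh x) (fun x => ddH x - ddh x));
      try lra; intros t; try (now apply dpl_minus).
    specialize (Hb t). apply Rabs_le_between in Hb. lra.
Qed.

(** * Global existence by Picard iteration *)

Lemma dpl_RInt f : (forall x, continuity_pt f x) -> forall x, dpl (fun t => RInt f 0 t) x (f x).
Proof.
  intros Hf x. apply is_derive_Reals. apply (is_derive_RInt f (RInt f 0) 0 x).
  - apply filter_forall. intros t. apply (@RInt_correct R_CompleteNormedModule).
    apply (@ex_RInt_continuous R_CompleteNormedModule). intros z _. now apply continuity_pt_filterlim.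
  - now apply continuity_pt_filterlim.
Qed.

Lemma RInt_0_0 (f : R -> R) : RInt f 0 0 = 0.
Proof. apply (@RInt_point R_CompleteNormedModule). Qed.

Lemma antiderivative2 f : (forall x, continuity_pt f x) ->
  exists h dh, (forall x, dpl h x (dh x)) /\ (forall x, dpl dh x (f x)) /\ h 0 = 0 /\ dh 0 = 0.
Proof.
  intros Hf. pose proof (dpl_RInt f Hf) as H1.
  exists (fun t => RInt (fun s => RInt f 0 s) 0 t), (fun s => RInt f 0 s).
  repeat split; auto using RInt_0_0.
  apply dpl_RInt. intros x. eapply dpl_cont, H1.
Qed.

Lemma geometric_limit (a : nat -> R) (c : R) :
  (forall k, Rabs (a (S k) - a k) <= c * (/ 2) ^ k) ->
  exists l, forall k, Rabs (l - a k) <= 2 * c * (/ 2) ^ k.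
Proof.
  intros H.
  assert (Hp : forall k, 0 < (/ 2) ^ k) by (intros; apply pow_lt; lra).
  (* The subtracted term lets the induction on [m] close: passing to [m + 1] frees exactly
     [c * (/ 2) ^ (k + m)]. *)
  assert (Hd : forall k m, Rabs (a (k + m)%nat - a k) <= 2 * c * (/ 2) ^ k - 2 * c * (/ 2) ^ (k + m)).
  { intros k m. induction m.
    - rewrite Nat.add_0_r, Rminus_diag, Rabs_R0. lra.
    - rewrite Nat.add_succ_r. specialize (H (k + m)%nat). simpl.
      replace (a (S (k + m)) - a k) with ((a (S (k + m)) - a (k + m)%nat) + (a (k + m)%nat - a k)) by ring.
      eapply Rle_trans; [apply Rabs_triang|]. lra. }
  assert (Hc : 0 <= c) by (specialize (H O); simpl in H; pose proof (Rabs_pos (a 1%nat - a 0%nat)); lra).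
  assert (Hd' : forall k m, Rabs (a (k + m)%nat - a k) <= 2 * c * (/ 2) ^ k).
  { intros k m. specialize (Hd k m). specialize (Hp (k + m)%nat). nra. }
  assert (HC : Cauchy_crit a).
  { intros eps Heps.
    destruct (pow_lt_1_zero (/ 2)) with (y := eps / (4 * c + 1)) as [N HN].
    { rewrite Rabs_right; lra. } { apply Rdiv_lt_0_compat; lra. }
    specialize (HN N (le_n _)). rewrite Rabs_right in HN by (left; apply Hp).
    assert ((/ 2) ^ N * (4 * c + 1) < eps).
    { apply (Rmult_lt_compat_r (4 * c + 1)) in HN; [|lra].
      unfold Rdiv in HN. rewrite Rmult_assoc, Rinv_l in HN; lra. }
    exists N. intros p q Hpn Hqn. unfold Rdist.
    replace p with (N + (p - N))%nat by lia. replace q with (N + (q - N))%nat by lia.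
    pose proof (Hd' N (p - N)%nat) as P1. pose proof (Hd' N (q - N)%nat) as P2.
    apply Rabs_le_between in P1. apply Rabs_le_between in P2. specialize (Hp N).
    apply Rabs_def1; nra. }
  destruct (Rcomplete.R_complete a HC) as [l Hl]. exists l. intros k.
  apply Rnot_lt_le. intros Hlt.
  destruct (Hl (Rabs (l - a k) - 2 * c * (/ 2) ^ k)) as [N HN]; [lra|].
  specialize (HN (k + N)%nat ltac:(lia)). unfold Rdist in HN.
  specialize (Hd' k N).
  assert (Rabs (l - a k) <= Rabs (a (k + N)%nat - l) + Rabs (a (k + N)%nat - a k)).
  { rewrite (Rabs_minus_sym _ l).
    replace (l - a k) with ((l - a (k + N)%nat) + (a (k + N)%nat - a k)) by ring. apply Rabs_triang. }
  lra.
Qed.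

Lemma cosh_derive K x : dpl (fun t => cosh (K * t)) x (K * sinh (K * x)).
Proof.
  apply dpl_ext with (fun t => cosh (K * t + 0)); [intros; now rewrite Rplus_0_r|].
  rewrite <- (Rplus_0_r (K * x)). apply dpl_affine. apply derivable_pt_lim_cosh.
Qed.

Lemma sinh_derive K x : dpl (fun t => sinh (K * t)) x (K * cosh (K * x)).
Proof.
  apply dpl_ext with (fun t => sinh (K * t + 0)); [intros; now rewrite Rplus_0_r|].
  rewrite <- (Rplus_0_r (K * x)). apply dpl_affine. apply derivable_pt_lim_sinh.
Qed.

Lemma cosh_ge_1 x : 1 <= cosh x.
Proof.
  unfold cosh. rewrite exp_Ropp. pose proof (exp_pos x). set (e := exp x) in *.
  assert (e + / e - 2 = (e - 1) ^ 2 / e) by (field; lra).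
  assert (0 <= (e - 1) ^ 2 / e).
  { unfold Rdiv. apply Rmult_le_pos; [apply pow2_ge_0|left; now apply Rinv_0_lt_compat]. }
  lra.
Qed.

(** The first Picard iterate grows quadratically and has to be dominated by the weight. For [1 <= K]
    the difference of the two sides is convex with zero data at 0. *)
Lemma cosh_ge_quadratic K x : 1 <= K -> 1 + x * x / 2 <= cosh (K * x).
Proof.
  intros HK. cut (0 <= cosh (K * x) - 1 - x * x / 2); [lra|].
  apply (convex_nonneg (fun x => cosh (K * x) - 1 - x * x / 2) (fun x => K * sinh (K * x) - x)
           (fun x => K * (K * cosh (K * x)) - 1)).
  - intros t. pose proof (cosh_derive K t). der. field.
  - intros t. pose proof (sinh_derive K t). der. ring.
  - intros t. pose proof (cosh_ge_1 (K * t)). nra.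
  - rewrite Rmult_0_r, cosh_0. lra.
  - rewrite Rmult_0_r, sinh_0. lra.
Qed.

(* Picard iteration, contracting for the weight [cosh (K x)] once [2 M <= K^2]. *)
Lemma picard (N : R -> R -> R) (M B al be : R) : 0 <= M -> 0 <= B ->
  (forall u : R -> R, (forall x, continuity_pt u x) -> forall x, continuity_pt (fun t => N t (u t)) x) ->
  (forall x u v, Rabs (N x u - N x v) <= M * Rabs (u - v)) ->
  (forall x, Rabs (N x 0) <= B) ->
  exists y dy, (forall x, dpl y x (dy x)) /\ (forall x, dpl dy x (N x (y x))) /\ y 0 = al /\ dy 0 = be.
Proof.
  intros HM HB Hc HL H0.
  (* This value gives both [2 * M <= K * K], for the contraction, and [1 <= K], for
     [cosh_ge_quadratic]. *)
  set (K := 2 * M + 1).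
  assert (HK : 1 <= K) by (unfold K; lra).
  assert (HT : forall u : R -> R, (forall x, continuity_pt u x) -> exists y : R -> R, exists dy : R -> R,
     (forall x, dpl y x (dy x)) /\ (forall x, dpl dy x (N x (u x))) /\ y 0 = al /\ dy 0 = be).
  { intros u Hu. destruct (antiderivative2 (fun t => N t (u t)) (Hc u Hu)) as [h [dh [A1 [A2 [A3 A4]]]]].
    exists (fun x => al + be * x + h x), (fun x => be + dh x). repeat split.
    - intros x. specialize (A1 x). der. ring.
    - intros x. specialize (A2 x). der. ring.
    - lra.
    - lra. }
  assert (HTc : forall y : R -> R, forall u : R -> R, (exists dy : R -> R,
     (forall x, dpl y x (dy x)) /\ (forall x, dpl dy x (N x (u x))) /\ y 0 = al /\ dy 0 = be) ->
     forall x, continuity_pt y x).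
  { intros y u [dy [Hdy _]] x. eapply dpl_cont, Hdy. }
  (* The iteration runs in the type of continuous functions, because the next iterate is a double
     antiderivative and [HT] provides it only for continuous arguments; [HTc] restores continuity.
     It starts at the zero function. *)
  pose (it := nat_rect (fun _ => {u : R -> R | forall x, continuity_pt u x})
     (exist (fun u : R -> R => forall x, continuity_pt u x) (fun _ => 0) (fun x => dpl_cont _ _ _ (dpl_const 0 x)))
     (fun _ u => let s := constructive_indefinite_description _ (HT (proj1_sig u) (proj2_sig u)) in
        exist (fun u : R -> R => forall x, continuity_pt u x) (proj1_sig s) (HTc _ _ (proj2_sig s)))).
  set (u := fun k => proj1_sig (it k)).
  assert (Hu0 : forall x, u O x = 0) by reflexivity.
  assert (Huc : forall k x, continuity_pt (u k) x) by (intros k; exact (proj2_sig (it k))).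
  assert (HuS : forall k, exists dy : R -> R, (forall x, dpl (u (S k)) x (dy x)) /\
     (forall x, dpl dy x (N x (u k x))) /\ u (S k) 0 = al /\ dy 0 = be).
  { intros k. unfold u; simpl. destruct (constructive_indefinite_description _ _) as [y Hy]; simpl. exact Hy. }
  clearbody u. clear it.
  (* Images of [v] and [w] share their initial data, so their difference is compared with the double
     antiderivative of [M * c * cosh (K * x)], which carries the factor [M / (K * K) <= / 2]. *)
  assert (Hstep : forall (v w v1 dv1 w1 dw1 : R -> R) c, 0 <= c ->
    (forall x, dpl v1 x (dv1 x)) -> (forall x, dpl dv1 x (N x (v x))) -> v1 0 = al -> dv1 0 = be ->
    (forall x, dpl w1 x (dw1 x)) -> (forall x, dpl dw1 x (N x (w x))) -> w1 0 = al -> dw1 0 = be ->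
    (forall x, Rabs (v x - w x) <= c * cosh (K * x)) ->
    forall x, Rabs (v1 x - w1 x) <= c * / 2 * cosh (K * x)).
  { intros v w v1 dv1 w1 dw1 c Hc0 V1 V2 V3 V4 W1 W2 W3 W4 Hvw x.
    apply Rle_trans with (M * c / (K * K) * (cosh (K * x) - 1)).
    - apply (second_order_comparison (fun x => v1 x - w1 x) (fun x => dv1 x - dw1 x)
        (fun x => N x (v x) - N x (w x))
        (fun x => M * c / (K * K) * (cosh (K * x) - 1)) (fun x => M * c / (K * K) * (K * sinh (K * x)))
        (fun x => M * c * cosh (K * x))).
      + intros t; now apply dpl_minus.
      + intros t; now apply dpl_minus.
      + intros t. pose proof (cosh_derive K t). der. ring.
      + intros t. pose proof (sinh_derive K t). der. field. lra.
      + intros t. eapply Rle_trans; [apply HL|]. rewrite Rmult_assoc. apply Rmult_le_compat_l; auto.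
      + lra.
      + lra.
      + rewrite Rmult_0_r, cosh_0. ring.
      + rewrite Rmult_0_r, sinh_0. ring.
    - assert (M / (K * K) <= / 2).
      { apply Rmult_le_reg_r with (K * K); [nra|]. unfold Rdiv. rewrite Rmult_assoc, Rinv_l by nra.
        unfold K. nra. }
      replace (M * c / (K * K)) with (c * (M / (K * K))) by (field; lra).
      assert (0 <= M / (K * K)).
      { unfold Rdiv. apply Rmult_le_pos; auto. left. apply Rinv_0_lt_compat. nra. }
      pose proof (cosh_ge_1 (K * x)).
      apply Rle_trans with (c * (M / (K * K)) * cosh (K * x)).
      + apply Rmult_le_compat_l; [nra|lra].
      + apply Rmult_le_compat_r; [lra|]. apply Rmult_le_compat_l; lra. }
  set (C := Rabs al + Rabs be + B).
  assert (HC : 0 <= C) by (unfold C; pose proof (Rabs_pos al); pose proof (Rabs_pos be); lra).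
  (* The first iterate is [al + be * x] plus a term bounded by [B * (x * x / 2)]; the weight
     dominates each of the three. *)
  assert (Hd0 : forall x, Rabs (u 1%nat x - u 0%nat x) <= C * cosh (K * x)).
  { intros x. rewrite Hu0, Rminus_0_r. destruct (HuS O) as [dy [D1 [D2 [D3 D4]]]].
    assert (Rabs (u 1%nat x - al - be * x) <= B * (x * x / 2)).
    { apply (second_order_comparison (fun x => u 1%nat x - al - be * x) (fun x => dy x - be) (fun x => N x (u O x))
         (fun x => B * (x * x / 2)) (fun x => B * x) (fun x => B)).
      - intros t. specialize (D1 t). der. ring.
      - intros t. specialize (D2 t). der. ring.
      - intros t. der. field.
      - intros t. der. ring.
      - intros t. rewrite Hu0. apply H0.
      - lra. - lra. - lra. - lra. }
    pose proof (cosh_ge_quadratic K x HK).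
    assert (Rabs x <= 1 + x * x / 2).
    { assert (x * x = Rabs x * Rabs x) as -> by (unfold Rabs; destruct Rcase_abs; ring).
      pose proof (pow2_ge_0 (Rabs x - 1)). nra. }
    replace (u 1%nat x) with ((u 1%nat x - al - be * x) + al + be * x) by ring.
    eapply Rle_trans; [eapply Rle_trans; [apply Rabs_triang|apply Rplus_le_compat_r, Rabs_triang]|].
    rewrite Rabs_mult. unfold C. pose proof (Rabs_pos al). pose proof (Rabs_pos be).
    pose proof (Rle_0_sqr x) as Hs. unfold Rsqr in Hs.
    set (ch := cosh (K * x)) in *. set (ax := Rabs x) in *.
    assert (B * (x * x / 2) <= B * ch) by (apply Rmult_le_compat_l; lra).
    assert (Rabs be * ax <= Rabs be * ch) by (apply Rmult_le_compat_l; lra).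
    assert (Rabs al <= Rabs al * ch) by nra. lra. }
  assert (Hd : forall k x, Rabs (u (S k) x - u k x) <= C * (/ 2) ^ k * cosh (K * x)).
  { induction k; intros x.
    - simpl. rewrite Rmult_1_r. apply Hd0.
    - destruct (HuS (S k)) as [d1 [A1 [A2 [A3 A4]]]]. destruct (HuS k) as [d2 [B1 [B2 [B3 B4]]]].
      eapply Rle_trans.
      + apply (Hstep (u (S k)) (u k) (u (S (S k))) d1 (u (S k)) d2 (C * (/ 2) ^ k)); auto.
        apply Rmult_le_pos; auto. apply pow_le; lra.
      + simpl. right; ring. }
  assert (Hlim : forall x, exists l, forall k, Rabs (l - u k x) <= 2 * C * (/ 2) ^ k * cosh (K * x)).
  { intros x. destruct (geometric_limit (fun k => u k x) (C * cosh (K * x))) as [l Hl].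
    - intros k. eapply Rle_trans; [apply Hd|right; ring].
    - exists l. intros k. eapply Rle_trans; [apply Hl|right; ring]. }
  set (y := fun x => proj1_sig (constructive_indefinite_description _ (Hlim x))).
  assert (Hy : forall k x, Rabs (y x - u k x) <= 2 * C * (/ 2) ^ k * cosh (K * x)).
  { intros k x. unfold y. destruct (constructive_indefinite_description _ _); simpl; auto. }
  clearbody y.
  assert (Hsmall : forall c eps, 0 <= c -> 0 < eps -> exists k : nat, c * (/ 2) ^ k < eps).
  { intros c eps Hc1 He. destruct (pow_lt_1_zero (/ 2)) with (y := eps / (c + 1)) as [n Hn].
    - rewrite Rabs_right; lra.
    - apply Rdiv_lt_0_compat; lra.
    - exists n. specialize (Hn n (le_n _)).
      assert (0 < (/ 2) ^ n) by (apply pow_lt; lra). rewrite Rabs_right in Hn by lra.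
      apply (Rmult_lt_compat_r (c + 1)) in Hn; [|lra].
      unfold Rdiv in Hn. rewrite Rmult_assoc, Rinv_l in Hn; lra. }
  (* Near [x] the weight stays below [cosh (K * x) + 1], so the weighted convergence is uniform
     there and an argument with three thirds of [eps] applies. *)
  assert (Hyc : forall x, continuity_pt y x).
  { intros x eps He.
    pose proof (dpl_cont _ _ _ (cosh_derive K x)) as Hch.
    destruct (Hch 1 Rlt_0_1) as [d1 [Hd1 Hd1']].
    destruct (Hsmall (2 * C * (cosh (K * x) + 1)) (eps / 3)) as [k Hk].
    { pose proof (cosh_ge_1 (K * x)). apply Rmult_le_pos; lra. } { lra. }
    destruct (Huc k x (eps / 3)) as [d2 [Hd2 Hd2']]; [lra|].
    exists (Rmin d1 d2). split; [now apply Rmin_Rgt_r|].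
    intros t [Ht1 Ht2]. simpl in *. unfold Rdist in *.
    specialize (Hd1' t). specialize (Hd2' t).
    assert (Rabs (t - x) < d1) by (eapply Rlt_le_trans; [apply Ht2|apply Rmin_l]).
    assert (Rabs (t - x) < d2) by (eapply Rlt_le_trans; [apply Ht2|apply Rmin_r]).
    specialize (Hd1' (conj Ht1 H)). specialize (Hd2' (conj Ht1 H1)).
    assert (forall s, cosh (K * s) <= cosh (K * x) + 1 -> Rabs (y s - u k s) < eps / 3).
    { intros s Hs. eapply Rle_lt_trans; [apply Hy|]. eapply Rle_lt_trans; [|apply Hk].
      rewrite Rmult_assoc, (Rmult_comm _ (cosh _)), <- Rmult_assoc.
      apply Rmult_le_compat_r; [apply pow_le; lra|]. apply Rmult_le_compat_l; lra. }
    assert (B1 := H2 t). assert (B2 := H2 x).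
    apply Rabs_def2 in Hd1'. specialize (B1 ltac:(lra)). specialize (B2 ltac:(lra)).
    apply Rabs_def2 in B1. apply Rabs_def2 in B2. apply Rabs_def2 in Hd2'. apply Rabs_def1; lra. }
  (* The iteration map is applied once more to the limit: [v] has the right derivatives by
     construction, and [Hvy] identifies it with [y], both being limits of the same iterates. *)
  destruct (HT y Hyc) as [v [dv [V1 [V2 [V3 V4]]]]].
  assert (Hvy : forall x, v x = y x).
  { intros x. apply cond_eq. intros eps He.
    destruct (Hsmall (4 * C * cosh (K * x)) eps) as [k Hk]; auto.
    { pose proof (cosh_ge_1 (K * x)). apply Rmult_le_pos; lra. }
    destruct (HuS k) as [d2 [B1 [B2 [B3 B4]]]].
    assert (Rabs (v x - u (S k) x) <= 2 * C * (/ 2) ^ k * / 2 * cosh (K * x)).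
    { apply (Hstep y (u k) v dv (u (S k)) d2); auto.
      apply Rmult_le_pos; [lra|apply pow_le; lra]. }
    pose proof (Hy (S k) x) as Hyk. simpl in Hyk.
    replace (v x - y x) with ((v x - u (S k) x) - (y x - u (S k) x)) by ring.
    eapply Rle_lt_trans; [apply Rabs_triang|]. rewrite Rabs_Ropp.
    assert (0 <= C * (/ 2) ^ k * cosh (K * x)).
    { pose proof (cosh_ge_1 (K * x)). apply Rmult_le_pos; [|lra]. apply Rmult_le_pos; auto. apply pow_le; lra. }
    lra. }
  exists v, dv. repeat split; auto. intros x. rewrite Hvy. apply V2.
Qed.

Lemma linear_homogeneous_exists (q : R -> R) (M al be : R) :
  (forall x, continuity_pt q x) -> (forall x, Rabs (q x) <= M) ->
  exists y dy, (forall x, dpl y x (dy x)) /\ (forall x, dpl dy x (q x * y x)) /\ y 0 = al /\ dy 0 = be.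
Proof.
  intros Hq HM.
  assert (0 <= M) by (specialize (HM 0); pose proof (Rabs_pos (q 0)); lra).
  apply (picard (fun x u => q x * u) M 0); auto; try lra.
  - intros u Hu x. apply (continuity_pt_mult q u); auto.
  - intros x u v. rewrite <- Rmult_minus_distr_l, Rabs_mult. apply Rmult_le_compat_r; auto using Rabs_pos.
  - intros x. rewrite Rmult_0_r, Rabs_R0. lra.
Qed.

(* Variation of constants: only [q] has to be bounded. *)
Lemma linear_exists (q r : R -> R) (M al be : R) :
  (forall x, continuity_pt q x) -> (forall x, Rabs (q x) <= M) -> (forall x, continuity_pt r x) ->
  exists y dy, (forall x, dpl y x (dy x)) /\ (forall x, dpl dy x (q x * y x + r x)) /\ y 0 = al /\ dy 0 = be.
Proof.
  intros Hq HM Hr.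
  destruct (linear_homogeneous_exists q M 1 0 Hq HM) as [y1 [d1 [A1 [A2 [A3 A4]]]]].
  destruct (linear_homogeneous_exists q M 0 1 Hq HM) as [y2 [d2 [B1 [B2 [B3 B4]]]]].
  (* The Wronskian is constant because the equation has no first-order term. Its value 1 is later
     inserted as a factor of [r x], so that the formula can be checked by [ring]. *)
  assert (W : forall x, y1 x * d2 x - d1 x * y2 x = 1).
  { assert (HW : forall x, dpl (fun x => y1 x * d2 x - d1 x * y2 x) x 0).
    { intros x. der. ring. }
    intros x. replace 1 with (y1 0 * d2 0 - d1 0 * y2 0) by (rewrite A3, A4, B4; ring).
    set (w := fun x => y1 x * d2 x - d1 x * y2 x) in *. change (w x = w 0).
    destruct (Rtotal_order x 0) as [h|[->|h]]; auto.
    - destruct (MVT_cor2 w (fun _ => 0) x 0 h) as [c [Hc _]]; auto. lra.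
    - destruct (MVT_cor2 w (fun _ => 0) 0 x h) as [c [Hc _]]; auto. lra. }
  assert (C1 : forall x, continuity_pt (fun t => y1 t * r t) x).
  { intros x. apply (continuity_pt_mult y1 r); auto. eapply dpl_cont, A1. }
  assert (C2 : forall x, continuity_pt (fun t => y2 t * r t) x).
  { intros x. apply (continuity_pt_mult y2 r); auto. eapply dpl_cont, B1. }
  pose proof (dpl_RInt _ C1) as I1. pose proof (dpl_RInt _ C2) as I2. cbv beta in I1, I2.
  exists (fun x => al * y1 x + be * y2 x + y2 x * RInt (fun t => y1 t * r t) 0 x - y1 x * RInt (fun t => y2 t * r t) 0 x),
    (fun x => al * d1 x + be * d2 x + d2 x * RInt (fun t => y1 t * r t) 0 x - d1 x * RInt (fun t => y2 t * r t) 0 x).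
  repeat split.
  - intros x. specialize (I1 x). specialize (I2 x). der. ring.
  - intros x. specialize (I1 x). specialize (I2 x). specialize (W x). der.
    replace (r x) with (r x * (y1 x * d2 x - d1 x * y2 x)) at 3 by (rewrite W; ring). ring.
  - rewrite !RInt_0_0, A3, B3. ring.
  - rewrite !RInt_0_0, A4, B4. ring.
Qed.

(** * Neighbourhood filters and locally uniform convergence *)

Definition near {n : nat} (mu : Rn n) (d : R) (nu : Rn n) : Prop :=
  forall i, Rabs (nu i - mu i) < d.

Definition nbhd {n : nat} (mu : Rn n) (A : Rn n -> Prop) : Prop :=
  exists d, 0 < d /\ forall nu, near mu d nu -> A nu.

(** The filter along which difference quotients converge; [h = 0] is excluded so that division by
    [h] is meaningful. *)
Definition punct0 (A : R -> Prop) : Prop :=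
  exists d, 0 < d /\ forall h, h <> 0 -> Rabs h < d -> A h.

Lemma near_mono {n} (mu : Rn n) d e nu : d <= e -> near mu d nu -> near mu e nu.
Proof. intros H H1 i. specialize (H1 i). lra. Qed.

Lemma near_min_l {n} (mu : Rn n) d e nu : near mu (Rmin d e) nu -> near mu d nu.
Proof. apply near_mono, Rmin_l. Qed.

Lemma near_min_r {n} (mu : Rn n) d e nu : near mu (Rmin d e) nu -> near mu e nu.
Proof. apply near_mono, Rmin_r. Qed.

Lemma near_refl {n} (mu : Rn n) d : 0 < d -> near mu d mu.
Proof. intros H i. rewrite Rminus_diag, Rabs_R0. lra. Qed.

Global Instance nbhd_filter {n} (mu : Rn n) : Filter (nbhd mu).
Proof.
  constructor.
  - exists 1. split; [lra|auto].
  - intros A B [d [Hd HA]] [e [He HB]]. exists (Rmin d e). split; [now apply Rmin_pos|].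
    intros nu Hnu. split.
    + apply HA. eapply near_min_l; eauto.
    + apply HB. eapply near_min_r; eauto.
  - intros A B HAB [d [Hd HA]]. exists d; auto.
Qed.

Global Instance punct0_filter : Filter punct0.
Proof.
  constructor.
  - exists 1. split; [lra|auto].
  - intros A B [d [Hd HA]] [e [He HB]]. exists (Rmin d e). split; [now apply Rmin_pos|].
    intros h H0 Hh. split.
    + apply HA; auto. eapply Rlt_le_trans; [apply Hh|apply Rmin_l].
    + apply HB; auto. eapply Rlt_le_trans; [apply Hh|apply Rmin_r].
  - intros A B HAB [d [Hd HA]]. exists d; auto.
Qed.

(** The filter is kept abstract because three are used: [nbhd] for continuity in the parameter,
    [punct0] for derivatives, and [nbhd2] for the parameter together with the spectral variable. *)
Definition tends {T : Type} (F : (T -> Prop) -> Prop) (a : T -> R) (l : R) : Prop :=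
  forall eps, 0 < eps -> F (fun t => Rabs (a t - l) < eps).

(* [luc] = locally uniform convergence *)
Definition luc {T : Type} (F : (T -> Prop) -> Prop) (f : T -> R -> R) (f0 : R -> R) : Prop :=
  forall r eps, 0 < eps -> F (fun t => forall x, Rabs x <= r -> Rabs (f t x - f0 x) < eps).

Lemma luc_tends {T} (F : (T -> Prop) -> Prop) {FF : Filter F} f f0 x :
  luc F f f0 -> tends F (fun t => f t x) (f0 x).
Proof.
  intros H eps He. eapply filter_imp; [|apply (H (Rabs x) eps He)].
  intros t Ht. apply Ht. lra.
Qed.

Lemma luc_const {T} (F : (T -> Prop) -> Prop) {FF : Filter F} f : luc F (fun _ => f) f.
Proof.
  intros r eps He. apply filter_forall. intros _ x _. rewrite Rminus_diag, Rabs_R0. lra.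
Qed.

Lemma luc_plus {T} (F : (T -> Prop) -> Prop) {FF : Filter F} f g f0 g0 :
  luc F f f0 -> luc F g g0 -> luc F (fun t x => f t x + g t x) (fun x => f0 x + g0 x).
Proof.
  intros Hf Hg r eps He. assert (He2 : 0 < eps / 2) by lra.
  eapply filter_imp; [|apply (filter_and _ _ (Hf r (eps / 2) He2) (Hg r (eps / 2) He2))].
  intros t [A B] x Hx. specialize (A x Hx). specialize (B x Hx).
  apply Rabs_def2 in A. apply Rabs_def2 in B. apply Rabs_def1; lra.
Qed.

Lemma locally_bounded f r : (forall x, continuity_pt f x) ->
  exists B, 0 <= B /\ forall x, Rabs x <= r -> Rabs (f x) <= B.
Proof.
  intros Hf. destruct (Rle_dec 0 r) as [Hr|Hr].
  - destruct (continuity_ab_maj (fun x => Rabs (f x)) (- r) r) as [m [Hm _]]; [lra| |].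
    + intros c _. apply (continuity_pt_comp f Rabs); auto. apply Rcontinuity_abs.
    + exists (Rabs (f m)). split; [apply Rabs_pos|]. intros x Hx. apply Hm. now apply Rabs_le_between.
  - exists 0. split; [lra|]. intros x Hx. pose proof (Rabs_pos x). lra.
Qed.

Lemma luc_mult {T} (F : (T -> Prop) -> Prop) {FF : Filter F} f g f0 g0 :
  (forall x, continuity_pt f0 x) -> (forall x, continuity_pt g0 x) ->
  luc F f f0 -> luc F g g0 -> luc F (fun t x => f t x * g t x) (fun x => f0 x * g0 x).
Proof.
  intros Cf Cg Hf Hg r eps He.
  destruct (locally_bounded f0 r Cf) as [B1 [B1p HB1]].
  destruct (locally_bounded g0 r Cg) as [B2 [B2p HB2]].
  set (e := Rmin 1 (eps / (B1 + B2 + 2))).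
  assert (Hp : 0 < eps / (B1 + B2 + 2)) by (apply Rdiv_lt_0_compat; lra).
  assert (e_pos : 0 < e) by (apply Rmin_pos; lra).
  assert (He1 : e <= 1) by apply Rmin_l.
  assert (He2 : e * (B1 + B2 + 2) <= eps).
  { apply Rle_trans with (eps / (B1 + B2 + 2) * (B1 + B2 + 2)).
    - apply Rmult_le_compat_r; [lra|apply Rmin_r].
    - right; field; lra. }
  eapply filter_imp; [|apply (filter_and _ _ (Hf r e e_pos) (Hg r e e_pos))].
  intros t [A B] x Hx. specialize (A x Hx). specialize (B x Hx).
  specialize (HB1 x Hx). specialize (HB2 x Hx).
  replace (f t x * g t x - f0 x * g0 x) with
    ((f t x - f0 x) * (g t x - g0 x) + (f t x - f0 x) * g0 x + f0 x * (g t x - g0 x)) by ring.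
  eapply Rle_lt_trans; [eapply Rle_trans; [apply Rabs_triang|apply Rplus_le_compat_r, Rabs_triang]|].
  rewrite !Rabs_mult.
  set (a := Rabs (f t x - f0 x)) in *. set (b := Rabs (g t x - g0 x)) in *.
  assert (0 <= a) by apply Rabs_pos. assert (0 <= b) by apply Rabs_pos.
  assert (a * b <= e * 1) by (apply Rmult_le_compat; lra).
  assert (a * Rabs (g0 x) <= e * B2) by (apply Rmult_le_compat; try lra; apply Rabs_pos).
  assert (Rabs (f0 x) * b <= B1 * e) by (apply Rmult_le_compat; try lra; apply Rabs_pos).
  lra.
Qed.

(** The difference [d] of the two solutions satisfies [d'' = q d + ((q - q0) y0 + (r - r0))], with
    bounded coefficient, small source and small data, so [energy] applies on each bounded
    interval. *)
Lemma linear_ivp_luc {T} (F : (T -> Prop) -> Prop) {FF : Filter F}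
  (y dy q r : T -> R -> R) (y0 dy0 q0 r0 : R -> R) :
  F (fun t => (forall x, dpl (y t) x (dy t x)) /\ (forall x, dpl (dy t) x (q t x * y t x + r t x))) ->
  (forall x, dpl y0 x (dy0 x)) -> (forall x, dpl dy0 x (q0 x * y0 x + r0 x)) ->
  (forall x, continuity_pt q0 x) ->
  luc F q q0 -> luc F r r0 ->
  tends F (fun t => y t 0) (y0 0) -> tends F (fun t => dy t 0) (dy0 0) ->
  luc F y y0 /\ luc F dy dy0.
Proof.
  intros Hy Y0 DY0 Cq Hq Hr H1 H2.
  assert (HH : forall r eps, 0 < eps -> F (fun t => forall x, Rabs x <= r ->
     Rabs (y t x - y0 x) < eps /\ Rabs (dy t x - dy0 x) < eps)).
  { intros R0 eps He.
    destruct (locally_bounded q0 R0 Cq) as [M [HM HM']].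
    destruct (locally_bounded y0 R0) as [B [HB HB']]. { intros x. eapply dpl_cont, Y0. }
    set (X := exp ((2 + (M + 1)) * R0)). assert (HX : 0 < X) by apply exp_pos.
    (* The two initial errors and the source each cost at most [eta], which keeps the energy bound
       below [4 * eta * X]. The number [e] is the accuracy of the coefficients that makes the source
       at most [eta]. *)
    set (eta := eps / (4 * X)). assert (Heta : 0 < eta) by (apply Rdiv_lt_0_compat; lra).
    assert (HetaX : 4 * eta * X = eps) by (unfold eta; field; lra).
    set (e := Rmin 1 (eta / (B + 1))).
    assert (Hp : 0 < eta / (B + 1)) by (apply Rdiv_lt_0_compat; lra).
    assert (e_pos : 0 < e) by (apply Rmin_pos; lra).
    assert (He1 : e <= 1) by apply Rmin_l.
    assert (He2 : e * (B + 1) <= eta).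
    { apply Rle_trans with (eta / (B + 1) * (B + 1)).
      - apply Rmult_le_compat_r; [lra|apply Rmin_r].
      - right; field; lra. }
    eapply filter_imp; [|apply (filter_and _ _ Hy (filter_and _ _
      (filter_and _ _ (Hq R0 e e_pos) (Hr R0 e e_pos))
      (filter_and _ _ (H1 eta Heta) (H2 eta Heta))))].
    intros t [[D1 D2] [[Q1 Q2] [I1 I2]]] x Hx.
    destruct (energy (fun x => y t x - y0 x) (fun x => dy t x - dy0 x)
      (fun x => q t x * y t x + r t x - (q0 x * y0 x + r0 x)) 0 R0 (M + 1) eta) with (x := x) as [E1 E2].
    - lra.
    - lra.
    - intros s. now apply dpl_minus.
    - intros s. now apply dpl_minus.
    - intros s Hs. rewrite Rminus_0_r in Hs.
      specialize (Q1 s Hs). specialize (Q2 s Hs). specialize (HM' s Hs). specialize (HB' s Hs).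
      replace (q t s * y t s + r t s - (q0 s * y0 s + r0 s)) with
        (q t s * (y t s - y0 s) + ((q t s - q0 s) * y0 s + (r t s - r0 s))) by ring.
      eapply Rle_trans; [apply Rabs_triang|]. apply Rplus_le_compat.
      + rewrite Rabs_mult. apply Rmult_le_compat_r; [apply Rabs_pos|].
        replace (q t s) with (q t s - q0 s + q0 s) by ring.
        eapply Rle_trans; [apply Rabs_triang|]. lra.
      + eapply Rle_trans; [apply Rabs_triang|]. rewrite Rabs_mult.
        assert (Rabs (q t s - q0 s) * Rabs (y0 s) <= e * B) by (apply Rmult_le_compat; try lra; apply Rabs_pos).
        lra.
    - rewrite Rminus_0_r; auto.
    - assert ((Rabs (y t 0 - y0 0) + Rabs (dy t 0 - dy0 0) + eta) * exp ((2 + (M + 1)) * R0) < eps).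
      { fold X. rewrite <- HetaX. apply Rmult_lt_compat_r; lra. }
      split; lra. }
  split; intros r1 eps He; (eapply filter_imp; [|apply (HH r1 eps He)]); intros t Ht x Hx; apply Ht; auto.
Qed.

(** * Joint continuity in the parameter and the real variable *)

Definition jcont_at {n} (F : Rn n -> R -> R) (mu : Rn n) (x : R) : Prop :=
  forall eps, 0 < eps -> exists d, 0 < d /\
    forall nu y, near mu d nu -> Rabs (y - x) < d -> Rabs (F nu y - F mu x) < eps.

Lemma jcont_at_cont {n} (F : Rn n -> R -> R) mu x : jcont_at F mu x -> continuity_pt (F mu) x.
Proof.
  intros H eps He. destruct (H eps He) as [d [Hd H1]]. exists d. split; auto.
  intros t [_ Ht]. apply H1; auto. now apply near_refl.
Qed.

(** Compactness of [[-K, K]] with the parameter centred at [mu]: one Lebesgue number serves as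
    radius for the parameter and for the argument. *)
Lemma jcont_unif {n} (F : Rn n -> R -> R) mu : (forall u, jcont_at F mu u) ->
  forall K eps, 0 < eps -> exists d, 0 < d /\
   forall nu u v, near mu d nu -> Rabs u <= K -> Rabs (v - u) < d -> Rabs (F nu v - F mu u) < eps.
Proof.
  intros HF K eps He.
  (* The doubled radius leaves room for two displacements, from [v] to [u] and from [u] to a centre
     [t] of the cover. *)
  assert (HF' : forall u, exists d : posreal, forall nu y, near mu d nu -> Rabs (y - u) < d + d ->
     Rabs (F nu y - F mu u) < eps / 2).
  { intros u. destruct (HF u (eps / 2) ltac:(lra)) as [d [Hd H]].
    assert (Hd2 : 0 < d / 2) by lra. exists (mkposreal _ Hd2). simpl. intros nu y H1 H2.
    apply H; [|lra]. eapply near_mono; [|eauto]. lra. }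
  set (dl := fun u => proj1_sig (constructive_indefinite_description _ (HF' u))).
  assert (Hdl : forall u nu y, near mu (dl u) nu -> Rabs (y - u) < dl u + dl u ->
     Rabs (F nu y - F mu u) < eps / 2).
  { intros u. unfold dl. destruct (constructive_indefinite_description _ _); auto. }
  destruct (compactness_value_1d (- K) K dl) as [d Hd].
  exists d. split; [apply cond_pos|].
  (* [compactness_value_1d] delivers only the double negation of the existence of a centre, hence
     the proof by contradiction. *)
  intros nu u v Hnu Hu Hv. apply NNPP. intros Hcon.
  apply (Hd u); [now apply Rabs_le_between|]. intros [t [Ht [Htu Hdt]]]. apply Hcon.
  assert (A : Rabs (F nu v - F mu t) < eps / 2).
  { apply Hdl; [eapply near_mono; eauto|].
    replace (v - t) with ((v - u) + (u - t)) by ring.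
    eapply Rle_lt_trans; [apply Rabs_triang|]. lra. }
  assert (B : Rabs (F mu u - F mu t) < eps / 2).
  { apply Hdl; [apply near_refl, cond_pos|]. pose proof (cond_pos (dl t)). lra. }
  apply Rabs_def2 in A. apply Rabs_def2 in B. apply Rabs_def1; lra.
Qed.

(** Parameter and argument move simultaneously. This is needed for secant slopes, where [xi] is a
    mean value point of which only the limit is known. *)
Lemma luc_comp {n} {T} (F : (T -> Prop) -> Prop) {FF : Filter F}
  (h : Rn n -> R -> R) mu (m : T -> Rn n) (xi : T -> R -> R) (psi : R -> R) :
  (forall u, jcont_at h mu u) -> (forall x, continuity_pt psi x) ->
  (forall d, 0 < d -> F (fun t => near mu d (m t))) -> luc F xi psi ->
  luc F (fun t x => h (m t) (xi t x)) (fun x => h mu (psi x)).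
Proof.
  intros Hh Cpsi Hm Hxi r eps He.
  destruct (locally_bounded psi r Cpsi) as [B [HB HB']].
  destruct (jcont_unif h mu Hh B eps He) as [d [Hd H]].
  eapply filter_imp; [|apply (filter_and _ _ (Hm d Hd) (Hxi r d Hd))].
  intros t [A1 A2] x Hx. apply H; auto.
Qed.

Lemma nbhd_near {n} (mu : Rn n) d : 0 < d -> nbhd mu (near mu d).
Proof. intros; now exists d. Qed.

Lemma cont_id x : continuity_pt (fun t => t) x.
Proof. apply (dpl_cont _ _ _ (dpl_id x)). Qed.

Lemma jcont_luc {n} (F : Rn n -> R -> R) mu : (forall x, jcont_at F mu x) -> luc (nbhd mu) F (F mu).
Proof.
  intros H. apply (luc_comp (nbhd mu) F mu (fun nu => nu) (fun _ x => x) (fun x => x)); auto.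
  - apply cont_id.
  - intros d Hd. now apply nbhd_near.
  - apply (luc_const (nbhd mu)).
Qed.

Lemma luc_jcont {n} (F : Rn n -> R -> R) mu : (forall x, continuity_pt (F mu) x) ->
  luc (nbhd mu) F (F mu) -> forall x, jcont_at F mu x.
Proof.
  intros Hc Hl x eps He.
  destruct (Hl (Rabs x + 1) (eps / 2) ltac:(lra)) as [d [Hd H1]].
  destruct (Hc x (eps / 2) ltac:(lra)) as [e [He' H2]].
  exists (Rmin (Rmin d e) 1). split; [repeat apply Rmin_pos; auto; lra|].
  intros nu y Hnu Hy.
  assert (Rabs (y - x) < 1) by (eapply Rlt_le_trans; [apply Hy|apply Rmin_r]).
  assert (Hye : Rabs (y - x) < e).
  { eapply Rlt_le_trans; [apply Hy|]. eapply Rle_trans; [apply Rmin_l|apply Rmin_r]. }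
  assert (A : Rabs (F nu y - F mu y) < eps / 2).
  { apply H1.
    - eapply near_mono; [|apply Hnu]. eapply Rle_trans; [apply Rmin_l|apply Rmin_l].
    - replace y with ((y - x) + x) by ring. eapply Rle_trans; [apply Rabs_triang|]. lra. }
  assert (B : Rabs (F mu y - F mu x) < eps / 2).
  { destruct (Req_dec y x) as [->|hne].
    - rewrite Rminus_diag, Rabs_R0. lra.
    - apply H2. split; [split; [exact I|auto]|exact Hye]. }
  apply Rabs_def2 in A. apply Rabs_def2 in B. apply Rabs_def1; lra.
Qed.

Lemma mvt_any f df a b : (forall u, Rmin a b <= u <= Rmax a b -> dpl f u (df u)) ->
  exists c, f b - f a = df c * (b - a) /\ Rmin a b <= c <= Rmax a b.
Proof.
  intros H. destruct (Rtotal_order a b) as [h|[->|h]].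
  - rewrite Rmin_left, Rmax_right in * by lra.
    destruct (MVT_cor2 f df a b h H) as [c [H1 H2]]. exists c. split; auto; lra.
  - exists b. rewrite Rmin_left, Rmax_left by lra. split; [ring|lra].
  - rewrite Rmin_right, Rmax_left in * by lra.
    destruct (MVT_cor2 f df b a h H) as [c [H1 H2]]. exists c. split; lra.
Qed.

Lemma between_dist a b c p r : Rmin a b <= c <= Rmax a b ->
  Rabs (a - p) <= r -> Rabs (b - p) <= r -> Rabs (c - p) <= r.
Proof.
  intros Hc Ha Hb. apply Rabs_le_between in Ha. apply Rabs_le_between in Hb.
  apply Rabs_le_between. unfold Rmin, Rmax in Hc. destruct (Rle_dec a b); lra.
Qed.

(** * The class C^k for functions of a parameter and a real variable *)

(** The curried form of [Ck] on the product of [U] with the line, adapted to equations in the real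
    variable that depend on a parameter: [DF] are the parameter derivatives and [DX] the derivative
    in the real variable. All conditions concern parameters in [U] only, so [DF] and [DX] may be
    arbitrary elsewhere. *)
Fixpoint Cj {n : nat} (k : nat) (U : Rn n -> Prop) (F : Rn n -> R -> R) : Prop :=
  (forall mu x, U mu -> jcont_at F mu x) /\
  match k with
  | O => True
  | S k' => exists (DF : Fin.t n -> Rn n -> R -> R) (DX : Rn n -> R -> R),
      (forall i mu x, U mu -> dpl (fun t => F (upd mu i t) x) (mu i) (DF i mu x)) /\
      (forall mu x, U mu -> dpl (F mu) x (DX mu x)) /\
      (forall i, Cj k' U (DF i)) /\ Cj k' U DX
  end.

Lemma Cj_jcont {n} k (U : Rn n -> Prop) F : Cj k U F -> forall mu x, U mu -> jcont_at F mu x.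
Proof. destruct k; intros [H _]; exact H. Qed.

Lemma Cj_cont {n} k (U : Rn n -> Prop) F mu : Cj k U F -> U mu -> forall x, continuity_pt (F mu) x.
Proof. intros H HU x. apply jcont_at_cont. eapply Cj_jcont; eauto. Qed.

Lemma upd_same {n} (v : Rn n) i : upd v i (v i) = v.
Proof. apply functional_extensionality. intros j. unfold upd. destruct (Fin.eq_dec i j) as [->|]; auto. Qed.

Lemma upd_eq {n} (v : Rn n) i t : upd v i t i = t.
Proof. unfold upd. destruct (Fin.eq_dec i i); congruence. Qed.

Lemma upd_upd {n} (v : Rn n) i s t : upd (upd v i s) i t = upd v i t.
Proof. apply functional_extensionality. intros j. unfold upd. now destruct (Fin.eq_dec i j). Qed.

Lemma upd_near {n} (v : Rn n) i t d : 0 < d -> Rabs (t - v i) < d -> near v d (upd v i t).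
Proof.
  intros Hd H j. unfold upd. destruct (Fin.eq_dec i j) as [<-|]; auto.
  rewrite Rminus_diag, Rabs_R0; lra.
Qed.

Lemma near_upd_plus {n} (mu : Rn n) i d : 0 < d -> punct0 (fun h => near mu d (upd mu i (mu i + h))).
Proof.
  intros Hd. exists d. split; auto. intros h _ Hh. apply upd_near; auto.
  now replace (mu i + h - mu i) with h by ring.
Qed.

Lemma open_nbhd {n} (U : Rn n -> Prop) mu : is_open U -> U mu -> nbhd mu U.
Proof. intros H HU. destruct (H mu HU) as [d [Hd H1]]. exists d; auto. Qed.

Lemma open_punct {n} (U : Rn n -> Prop) mu i : is_open U -> U mu ->
  punct0 (fun h => U (upd mu i (mu i + h))).
Proof.
  intros H HU. destruct (H mu HU) as [d [Hd H1]].
  eapply filter_imp; [|apply (near_upd_plus mu i d Hd)]. intros h Hh; auto.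
Qed.

(** The mean value theorem in the parameter turns the quotient into a value of [D] at a nearby
    parameter. That parameter depends on [x], but its distance to [mu] is bounded uniformly in
    [x]. *)
Lemma diff_quot_luc {n} (U : Rn n -> Prop) (F D : Rn n -> R -> R) i mu : is_open U -> U mu ->
  (forall nu x, U nu -> dpl (fun t => F (upd nu i t) x) (nu i) (D nu x)) ->
  (forall x, jcont_at D mu x) ->
  luc punct0 (fun h x => (F (upd mu i (mu i + h)) x - F mu x) / h) (D mu).
Proof.
  intros HO HU HD HC r eps He.
  destruct (jcont_luc D mu HC r eps He) as [d [Hd H1]].
  destruct (open_nbhd U mu HO HU) as [d' [Hd' H2]].
  exists (Rmin d d'). split; [now apply Rmin_pos|]. intros h Hh0 Hh x Hx.
  assert (Hn : forall t, Rmin (mu i) (mu i + h) <= t <= Rmax (mu i) (mu i + h) ->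
     near mu (Rmin d d') (upd mu i t)).
  { intros t Ht. apply upd_near; [now apply Rmin_pos|].
    eapply Rle_lt_trans; [|apply Hh]. eapply between_dist; [apply Ht| |].
    - rewrite Rminus_diag, Rabs_R0. apply Rabs_pos.
    - replace (mu i + h - mu i) with h by ring. lra. }
  destruct (mvt_any (fun t => F (upd mu i t) x) (fun t => D (upd mu i t) x) (mu i) (mu i + h)) as [c [Hc1 Hc2]].
  - intros t Ht. specialize (HD (upd mu i t) x).
    rewrite upd_eq in HD. apply dpl_ext with (fun s => F (upd (upd mu i t) i s) x).
    + intros s. now rewrite upd_upd.
    + apply HD. apply H2. eapply near_min_r; eauto; auto.
  - rewrite upd_same in Hc1. rewrite Hc1.
    replace (D (upd mu i c) x * (mu i + h - mu i) / h) with (D (upd mu i c) x) by (field; auto).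
    apply H1; auto. eapply near_min_l; eauto; auto.
Qed.

Lemma dpl_of_tends f x l : tends punct0 (fun h => (f (x + h) - f x) / h) l -> dpl f x l.
Proof.
  intros H eps He. destruct (H eps He) as [d [Hd H1]]. exists (mkposreal d Hd). intros h Hh Hhd. auto.
Qed.

Lemma tends_of_dpl f x l : dpl f x l -> tends punct0 (fun h => (f (x + h) - f x) / h) l.
Proof.
  intros H eps He. destruct (H eps He) as [d H1]. exists d. split; [apply cond_pos|]. auto.
Qed.

(** Openness of [U] enters because a parameter derivative looks at neighbouring parameters, where
    the two functions must also agree. *)
Lemma Cj_ext {n} k (U : Rn n -> Prop) F G : is_open U ->
  (forall mu x, U mu -> F mu x = G mu x) -> Cj k U F -> Cj k U G.
Proof.
  intros HO HE H.
  assert (HC : forall mu x, U mu -> jcont_at G mu x).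
  { intros mu x HU eps He. destruct (Cj_jcont _ _ _ H mu x HU eps He) as [d [Hd H1]].
    destruct (HO mu HU) as [e [He' H2]]. exists (Rmin d e). split; [now apply Rmin_pos|].
    intros nu y Hnu Hy. rewrite <- !HE; auto.
    - apply H1; [eapply near_min_l; eauto|]. eapply Rlt_le_trans; [apply Hy|apply Rmin_l].
    - apply H2. eapply near_min_r; eauto. }
  destruct k; split; auto. destruct H as [_ [DF [DX [A [B [C D]]]]]].
  exists DF, DX. repeat split; auto.
  - intros i mu x HU. apply dpl_of_tends. intros eps He.
    eapply filter_imp; [|apply (filter_and _ _ (tends_of_dpl _ _ _ (A i mu x HU) eps He) (open_punct U mu i HO HU))].
    cbv beta. intros h [H1 H2]. rewrite upd_same in *. rewrite <- !HE; auto.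
  - intros mu x HU. apply dpl_ext with (F mu); auto.
Qed.

Lemma Cj_pred {n} k (U : Rn n -> Prop) F : Cj (S k) U F -> Cj k U F.
Proof.
  revert F. induction k; intros F [H1 H2].
  - split; auto.
  - split; auto. destruct H2 as [DF [DX [A [B [C D]]]]]. exists DF, DX. repeat split; auto.
Qed.

Lemma jcont_at_const {n} c (mu : Rn n) x : jcont_at (fun _ _ => c) mu x.
Proof. intros eps He. exists 1. split; [lra|]. intros. rewrite Rminus_diag, Rabs_R0. lra. Qed.

Lemma Cj_const {n} k (U : Rn n -> Prop) c : Cj k U (fun _ _ => c).
Proof.
  revert c. induction k; intros c; split; auto using jcont_at_const.
  exists (fun _ _ _ => 0), (fun _ _ => 0). repeat split; auto using dpl_const.
Qed.

Lemma jcont_at_eval {n} (F : Rn n -> R -> R) mu x0 x : jcont_at F mu x0 -> jcont_at (fun m _ => F m x0) mu x.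
Proof.
  intros H eps He. destruct (H eps He) as [d [Hd H1]]. exists d. split; auto.
  intros nu y Hnu _. apply H1; auto. rewrite Rminus_diag, Rabs_R0. lra.
Qed.

(** Functions of [mu] alone, such as boundary values, are treated as constant in the real variable
    so that they stay inside [Cj]. *)
Lemma Cj_eval {n} k (U : Rn n -> Prop) F x0 : Cj k U F -> Cj k U (fun mu _ => F mu x0).
Proof.
  revert F. induction k; intros F H; (split; [intros mu x HU; apply jcont_at_eval; eapply Cj_jcont; eauto|auto]).
  destruct H as [_ [DF [DX [A [B [C D]]]]]].
  exists (fun i mu _ => DF i mu x0), (fun _ _ => 0). repeat split; auto using dpl_const, Cj_const.
Qed.

Lemma jcont_at_plus {n} (F G : Rn n -> R -> R) mu x :
  jcont_at F mu x -> jcont_at G mu x -> jcont_at (fun m y => F m y + G m y) mu x.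
Proof.
  intros HF HG eps He. destruct (HF (eps / 2) ltac:(lra)) as [d [Hd H1]].
  destruct (HG (eps / 2) ltac:(lra)) as [e [He' H2]].
  exists (Rmin d e). split; [now apply Rmin_pos|]. intros nu y Hnu Hy.
  assert (A : Rabs (F nu y - F mu x) < eps / 2).
  { apply H1; [eapply near_min_l; eauto|]. eapply Rlt_le_trans; [apply Hy|apply Rmin_l]. }
  assert (B : Rabs (G nu y - G mu x) < eps / 2).
  { apply H2; [eapply near_min_r; eauto|]. eapply Rlt_le_trans; [apply Hy|apply Rmin_r]. }
  apply Rabs_def2 in A. apply Rabs_def2 in B. apply Rabs_def1; lra.
Qed.

Lemma jcont_at_comp1 {n} (F : Rn n -> R -> R) (f : R -> R) mu x :
  jcont_at F mu x -> continuity_pt f (F mu x) -> jcont_at (fun m y => f (F m y)) mu x.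
Proof.
  intros HF Hf eps He. destruct (Hf eps He) as [e [He' H2]].
  destruct (HF e He') as [d [Hd H1]]. exists d. split; auto. intros nu y Hnu Hy.
  destruct (Req_dec (F nu y) (F mu x)) as [->|hne].
  - rewrite Rminus_diag, Rabs_R0. lra.
  - apply H2. split; [split; [exact I|auto]|]. apply H1; auto.
Qed.

(* polarisation reduces products to squares *)
Lemma jcont_at_mult {n} (F G : Rn n -> R -> R) mu x :
  jcont_at F mu x -> jcont_at G mu x -> jcont_at (fun m y => F m y * G m y) mu x.
Proof.
  intros HF HG.
  assert (Hs : forall u, continuity_pt (fun t => t * t * / 4) u).
  { intros u. eapply dpl_cont. der. reflexivity. }
  assert (Hn : forall u, continuity_pt (fun t => - t) u).
  { intros u. eapply dpl_cont. der. reflexivity. }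
  replace (fun m y => F m y * G m y) with
    (fun m y => (F m y + G m y) * (F m y + G m y) * / 4 + - ((F m y + - G m y) * (F m y + - G m y) * / 4)).
  - apply (jcont_at_plus (fun m y => (F m y + G m y) * (F m y + G m y) * / 4)
      (fun m y => - ((F m y + - G m y) * (F m y + - G m y) * / 4))).
    + apply (jcont_at_comp1 (fun m y => F m y + G m y) (fun t => t * t * / 4)); auto. now apply jcont_at_plus.
    + apply (jcont_at_comp1 (fun m y => (F m y + - G m y) * (F m y + - G m y) * / 4) Ropp); [|apply Hn].
      apply (jcont_at_comp1 (fun m y => F m y + - G m y) (fun t => t * t * / 4)); auto.
      apply jcont_at_plus; auto. apply (jcont_at_comp1 G Ropp); [auto|apply Hn].
  - apply functional_extensionality; intros m. apply functional_extensionality; intros y. field.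
Qed.

Lemma Cj_plus {n} k (U : Rn n -> Prop) F G : Cj k U F -> Cj k U G -> Cj k U (fun mu x => F mu x + G mu x).
Proof.
  revert F G. induction k; intros F G HF HG;
    (split; [intros mu x HU; apply jcont_at_plus; eapply Cj_jcont; eauto|auto]).
  destruct HF as [_ [DF [DX [A [B [C D]]]]]]. destruct HG as [_ [EF [EX [A' [B' [C' D']]]]]].
  exists (fun i mu x => DF i mu x + EF i mu x), (fun mu x => DX mu x + EX mu x).
  repeat split; auto; intros; apply dpl_plus; auto.
Qed.

Lemma Cj_mult {n} k (U : Rn n -> Prop) F G : Cj k U F -> Cj k U G -> Cj k U (fun mu x => F mu x * G mu x).
Proof.
  revert F G. induction k; intros F G HF HG;
    (split; [intros mu x HU; apply jcont_at_mult; eapply Cj_jcont; eauto|auto]).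
  assert (HF' := Cj_pred _ _ _ HF). assert (HG' := Cj_pred _ _ _ HG).
  destruct HF as [_ [DF [DX [A [B [C D]]]]]]. destruct HG as [_ [EF [EX [A' [B' [C' D']]]]]].
  exists (fun i mu x => DF i mu x * G mu x + F mu x * EF i mu x),
    (fun mu x => DX mu x * G mu x + F mu x * EX mu x).
  repeat split.
  - intros i mu x HU. eapply dpl_eq; [apply (dpl_mult (fun t => F (upd mu i t) x)); auto|].
    cbv beta. now rewrite upd_same.
  - intros; apply dpl_mult; auto.
  - intros i. apply Cj_plus; apply IHk; auto.
  - apply Cj_plus; apply IHk; auto.
Qed.

Lemma Cj_opp {n} k (U : Rn n -> Prop) F : is_open U -> Cj k U F -> Cj k U (fun mu x => - F mu x).
Proof.
  intros HO H. apply (Cj_ext k U (fun mu x => -1 * F mu x)); auto.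
  - intros; ring.
  - apply Cj_mult; auto using Cj_const.
Qed.

Lemma Cj_inv {n} k (U : Rn n -> Prop) F : is_open U -> (forall mu x, U mu -> F mu x <> 0) ->
  Cj k U F -> Cj k U (fun mu x => / F mu x).
Proof.
  intros HO HN. revert F HN. induction k; intros F HN HF.
  - split; auto. intros mu x HU. apply jcont_at_comp1; [eapply Cj_jcont; eauto|].
    apply (continuity_pt_inv id); [apply cont_id|]. apply HN; auto.
  - split.
    { intros mu x HU. apply jcont_at_comp1; [eapply Cj_jcont; eauto|].
      apply (continuity_pt_inv id); [apply cont_id|]. apply HN; auto. }
    assert (HF' := Cj_pred _ _ _ HF). specialize (IHk F HN HF').
    destruct HF as [_ [DF [DX [A [B [C D]]]]]].
    assert (Hd : forall f t a, dpl f t a -> f t <> 0 -> dpl (fun s => / f s) t (- (a * (/ f t * / f t)))).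
    { intros f t a Hf Hn. apply dpl_ext with (fun s => 1 / f s); [intros; unfold Rdiv; ring|].
      eapply dpl_eq; [apply (derivable_pt_lim_div (fun _ => 1) f); eauto; apply dpl_const|].
      unfold Rsqr. field; auto. }
    exists (fun i mu x => - (DF i mu x * (/ F mu x * / F mu x))), (fun mu x => - (DX mu x * (/ F mu x * / F mu x))).
    repeat split.
    + intros i mu x HU. pose proof (Hd (fun t => F (upd mu i t) x) (mu i) (DF i mu x)) as H.
      cbv beta in H. rewrite upd_same in H. auto.
    + intros mu x HU. apply Hd; auto.
    + intros i. apply Cj_opp; auto. apply Cj_mult; auto. apply Cj_mult; auto.
    + apply Cj_opp; auto. apply Cj_mult; auto. apply Cj_mult; auto.
Qed.

Lemma tends_luc {T} (F : (T -> Prop) -> Prop) {FF : Filter F} a l :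
  tends F a l -> luc F (fun t _ => a t) (fun _ => l).
Proof. intros H r eps He. eapply filter_imp; [|apply (H eps He)]. auto. Qed.

Lemma tends_plus {T} (F : (T -> Prop) -> Prop) {FF : Filter F} a b l m :
  tends F a l -> tends F b m -> tends F (fun t => a t + b t) (l + m).
Proof.
  intros Ha Hb. apply (luc_tends F (fun t _ => a t + b t) (fun _ => l + m) 0).
  apply (luc_plus F (fun t _ => a t) (fun t _ => b t) (fun _ => l) (fun _ => m)); now apply tends_luc.
Qed.

Lemma cont_const c x : continuity_pt (fun _ => c) x.
Proof. apply (dpl_cont _ _ _ (dpl_const c x)). Qed.

Lemma tends_mult {T} (F : (T -> Prop) -> Prop) {FF : Filter F} a b l m :
  tends F a l -> tends F b m -> tends F (fun t => a t * b t) (l * m).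
Proof.
  intros Ha Hb. apply (luc_tends F (fun t _ => a t * b t) (fun _ => l * m) 0).
  apply (luc_mult F (fun t _ => a t) (fun t _ => b t) (fun _ => l) (fun _ => m));
    auto using cont_const; now apply tends_luc.
Qed.

Lemma tends_ext {T} (F : (T -> Prop) -> Prop) {FF : Filter F} a b l :
  F (fun t => a t = b t) -> tends F a l -> tends F b l.
Proof.
  intros H H1 eps He. eapply filter_imp; [|apply (filter_and _ _ H (H1 eps He))].
  cbv beta. intros t [A B]. now rewrite <- A.
Qed.

(** The increment is split at [G (t0 + h) (p t0)]. Only the second piece needs a mean value, so
    joint continuity is required of [Gu] but not of the derivative in [t]. *)
Lemma dpl_chain2 (G Gu : R -> R -> R) (p : R -> R) t0 a b :
  dpl (fun t => G t (p t0)) t0 a ->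
  punct0 (fun h => forall u, dpl (G (t0 + h)) u (Gu (t0 + h) u)) ->
  (forall eps, 0 < eps -> exists d, 0 < d /\ forall t u, Rabs (t - t0) < d -> Rabs (u - p t0) < d ->
     Rabs (Gu t u - Gu t0 (p t0)) < eps) ->
  dpl p t0 b -> dpl (fun t => G t (p t)) t0 (a + Gu t0 (p t0) * b).
Proof.
  intros Ha Hu Hc Hp.
  set (C := Gu t0 (p t0)) in *.
  (* Where [p] does not move the quotient is undefined; the value [C] keeps the limit, and the
     product with the increment of [p] is 0 anyway. *)
  set (c := fun h => if Req_EM_T (p (t0 + h)) (p t0) then C
    else (G (t0 + h) (p (t0 + h)) - G (t0 + h) (p t0)) / (p (t0 + h) - p t0)).
  assert (Hct : tends punct0 c C).
  { intros eps He. destruct (Hc eps He) as [d [Hd Hc']].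
    destruct Hu as [d1 [Hd1 Hu']].
    pose proof (dpl_cont _ _ _ Hp) as Hpc. destruct (Hpc d Hd) as [d2 [Hd2 Hpc']].
    exists (Rmin d (Rmin d1 d2)). split; [repeat apply Rmin_pos; auto|]. intros h Hh0 Hh.
    assert (A0 : Rabs h < d) by (eapply Rlt_le_trans; [apply Hh|apply Rmin_l]).
    assert (A1 : Rabs h < d1).
    { eapply Rlt_le_trans; [apply Hh|]. eapply Rle_trans; [apply Rmin_r|apply Rmin_l]. }
    assert (A2 : Rabs h < d2).
    { eapply Rlt_le_trans; [apply Hh|]. eapply Rle_trans; [apply Rmin_r|apply Rmin_r]. }
    unfold c. destruct (Req_EM_T _ _) as [e|hne]; [rewrite Rminus_diag, Rabs_R0; auto|].
    destruct (mvt_any (G (t0 + h)) (Gu (t0 + h)) (p t0) (p (t0 + h))) as [z [Hz1 Hz2]].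
    { intros u _. apply Hu'; auto. }
    rewrite Hz1.
    replace (Gu (t0 + h) z * (p (t0 + h) - p t0) / (p (t0 + h) - p t0)) with (Gu (t0 + h) z)
      by (field; lra).
    apply Hc'; [now replace (t0 + h - t0) with h by ring|].
    assert (Rabs (p (t0 + h) - p t0) < d).
    { apply Hpc'. split; [split; [exact I|lra]|]. simpl. unfold Rdist. now replace (t0 + h - t0) with h by ring. }
    eapply Rle_lt_trans; [|exact H]. eapply between_dist; [exact Hz2| |lra].
    rewrite Rminus_diag, Rabs_R0. apply Rabs_pos. }
  apply dpl_of_tends.
  eapply (tends_ext punct0); [|apply (tends_plus punct0 _ _ _ _ (tends_of_dpl _ _ _ Ha)
    (tends_mult punct0 _ _ _ _ Hct (tends_of_dpl _ _ _ Hp)))].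
  exists 1. split; [lra|]. intros h Hh0 _. unfold c.
  destruct (Req_EM_T _ _) as [e|hne]; [rewrite e; field; auto|field; split; lra].
Qed.

Lemma jcont_at_comp {n} (h psi : Rn n -> R -> R) mu x :
  jcont_at h mu (psi mu x) -> jcont_at psi mu x -> jcont_at (fun m y => h m (psi m y)) mu x.
Proof.
  intros Hh Hp eps He. destruct (Hh eps He) as [d [Hd H1]]. destruct (Hp d Hd) as [e [He' H2]].
  exists (Rmin d e). split; [now apply Rmin_pos|]. intros nu y Hnu Hy.
  apply H1; [eapply near_min_l; eauto|]. apply H2; [eapply near_min_r; eauto|].
  eapply Rlt_le_trans; [apply Hy|apply Rmin_r].
Qed.

(** By the chain rule all first derivatives of the composite are sums and products of compositions
    [DF], [DX] with [psi] and derivatives of [psi], all one class lower, so the induction goes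
    through. *)
Lemma Cj_comp {n} k (P U : Rn n -> Prop) h psi : is_open U -> (forall mu, U mu -> P mu) ->
  Cj k P h -> Cj k U psi -> Cj k U (fun mu x => h mu (psi mu x)).
Proof.
  intros HO HUP. revert h psi. induction k; intros h psi Hh Hp;
    (split; [intros mu x HU; apply jcont_at_comp; eapply Cj_jcont; eauto|auto]).
  assert (Hh' := Hh). assert (Hp' := Cj_pred _ _ _ Hp).
  destruct Hh as [_ [DF [DX [A [B [C D]]]]]]. destruct Hp as [_ [EF [EX [A' [B' [C' D']]]]]].
  exists (fun i mu x => DF i mu (psi mu x) + DX mu (psi mu x) * EF i mu x), (fun mu x => DX mu (psi mu x) * EX mu x).
  repeat split.
  - intros i mu x HU.
    pose proof (dpl_chain2 (fun t u => h (upd mu i t) u) (fun t u => DX (upd mu i t) u)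
      (fun t => psi (upd mu i t) x) (mu i) (DF i mu (psi mu x)) (EF i mu x)) as H.
    cbv beta in H. rewrite upd_same in H. apply H; auto.
    + destruct (open_punct U mu i HO HU) as [d [Hd Hd']]. exists d. split; auto.
    + intros eps He. destruct (Cj_jcont _ _ _ D mu (psi mu x) (HUP _ HU) eps He) as [d [Hd Hd']].
      exists d. split; auto. intros t u Ht Hu. apply Hd'; auto. now apply upd_near.
  - intros mu x HU. eapply (dpl_comp (psi mu) (h mu)); auto.
  - intros i. apply Cj_plus; [|apply Cj_mult]; auto.
  - apply Cj_mult; auto.
Qed.

(** * Agreement of the curried classes with [Ck] *)

Definition consv {n} (x : R) (mu : Rn n) : Rn (S n) := fun j => Fin.caseS' j (fun _ => R) x mu.

Lemma consv_eta {n} (v : Rn (S n)) : consv (v Fin.F1) (tailv v) = v.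
Proof. apply functional_extensionality. intros j. now apply (Fin.caseS' j). Qed.

Lemma tailv_upd_FS {n} (v : Rn (S n)) i t : tailv (upd v (Fin.FS i) t) = upd (tailv v) i t.
Proof.
  apply functional_extensionality. intros j. unfold tailv, upd.
  destruct (Fin.eq_dec (Fin.FS i) (Fin.FS j)) as [e|hne]; destruct (Fin.eq_dec i j) as [e'|hne']; auto.
  - now apply Fin.FS_inj in e.
  - now subst.
Qed.

Lemma upd_FS_F1 {n} (v : Rn (S n)) i t : upd v (Fin.FS i) t Fin.F1 = v Fin.F1.
Proof. unfold upd. destruct (Fin.eq_dec (Fin.FS i) Fin.F1) as [e|]; auto. discriminate. Qed.

Lemma tailv_upd_F1 {n} (v : Rn (S n)) t : tailv (upd v Fin.F1 t) = tailv v.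
Proof.
  apply functional_extensionality. intros j. unfold tailv, upd.
  destruct (Fin.eq_dec Fin.F1 (Fin.FS j)) as [e|]; auto. discriminate.
Qed.

Lemma Cj_Ck {n} k (U : Rn n -> Prop) F : Cj k U F ->
  Ck k (fun v : Rn (S n) => U (tailv v)) (fun v => F (tailv v) (v Fin.F1)).
Proof.
  revert F. induction k; intros F H.
  - intros v Hv eps He. destruct (Cj_jcont _ _ _ H (tailv v) (v Fin.F1) Hv eps He) as [d [Hd H1]].
    exists d. split; auto. intros w Hw. apply H1; [intros i|]; apply Hw.
  - split.
    + intros v Hv eps He. destruct (Cj_jcont _ _ _ H (tailv v) (v Fin.F1) Hv eps He) as [d [Hd H1]].
      exists d. split; auto. intros w Hw. apply H1; [intros i|]; apply Hw.
    + destruct H as [_ [DF [DX [A [B [C D]]]]]].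
      exists (fun j => Fin.caseS' j (fun _ => Rn (S n) -> R) (fun v => DX (tailv v) (v Fin.F1))
         (fun i v => DF i (tailv v) (v Fin.F1))).
      split; intros j; apply (Fin.caseS' j); simpl.
      * intros v Hv. unfold has_partial.
        apply dpl_ext with (F (tailv v)); [|auto].
        intros t. now rewrite tailv_upd_F1, upd_eq.
      * intros i v Hv. unfold has_partial.
        apply dpl_ext with (fun t => F (upd (tailv v) i t) (v Fin.F1)); [|now apply A].
        intros t. now rewrite tailv_upd_FS, upd_FS_F1.
      * now apply IHk.
      * intros i. now apply IHk.
Qed.

Lemma Ck_Cj {n} k (U : Rn n -> Prop) F :
  Ck k (fun v : Rn (S n) => U (tailv v)) (fun v => F (tailv v) (v Fin.F1)) -> Cj k U F.
Proof.
  revert F. induction k; intros F H.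
  - split; auto. intros mu x HU eps He. destruct (H (consv x mu)) with (eps := eps) as [d [Hd H1]]; auto.
    exists d. split; auto. intros nu y Hnu Hy.
    apply (H1 (consv y nu)). intros j; now apply (Fin.caseS' j).
  - destruct H as [H [DF [A B]]]. split.
    + intros mu x HU eps He. destruct (H (consv x mu)) with (eps := eps) as [d [Hd H1]]; auto.
      exists d. split; auto. intros nu y Hnu Hy.
      apply (H1 (consv y nu)). intros j; now apply (Fin.caseS' j).
    + exists (fun i mu x => DF (Fin.FS i) (consv x mu)), (fun mu x => DF Fin.F1 (consv x mu)).
      (* The curried derivatives sample [DF j] at [consv x mu]; since every vector has this form,
         uncurrying returns [DF j] itself and the induction hypothesis applies. *)
      assert (E : forall j, (fun v => DF j (consv (v Fin.F1) (tailv v))) = DF j).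
      { intros j. apply functional_extensionality. intros v. now rewrite consv_eta. }
      repeat split.
      * intros i mu x HU. pose proof (A (Fin.FS i) (consv x mu) HU) as H1. unfold has_partial in H1.
        eapply dpl_ext; [|exact H1]. intros t. cbv beta. now rewrite tailv_upd_FS, upd_FS_F1.
      * intros mu x HU. pose proof (A Fin.F1 (consv x mu) HU) as H1. unfold has_partial in H1.
        eapply dpl_ext; [|exact H1]. intros t. cbv beta. now rewrite tailv_upd_F1, upd_eq.
      * intros i. apply IHk. rewrite E. auto.
      * apply IHk. rewrite E. auto.
Qed.

(** The difference quotient of [y] again solves a linear problem, with coefficient [q] at the moved
    parameter and source built from the quotients of [q] and [r]. These converge locally uniformly,
    so [linear_ivp_luc] gives the limit [z]. *)
Lemma linear_ivp_diff_quot {n} (U : Rn n -> Prop) (q r y dy Dq Dr : Rn n -> R -> R) i mu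
  (z dz : R -> R) : is_open U -> U mu ->
  (forall nu, U nu -> (forall x, dpl (y nu) x (dy nu x)) /\
     (forall x, dpl (dy nu) x (q nu x * y nu x + r nu x))) ->
  (forall x, jcont_at q mu x) ->
  (forall nu x, U nu -> dpl (fun t => q (upd nu i t) x) (nu i) (Dq nu x)) -> (forall x, jcont_at Dq mu x) ->
  (forall nu x, U nu -> dpl (fun t => r (upd nu i t) x) (nu i) (Dr nu x)) -> (forall x, jcont_at Dr mu x) ->
  (forall x, dpl z x (dz x)) -> (forall x, dpl dz x (q mu x * z x + (Dq mu x * y mu x + Dr mu x))) ->
  dpl (fun t => y (upd mu i t) 0) (mu i) (z 0) -> dpl (fun t => dy (upd mu i t) 0) (mu i) (dz 0) ->
  forall x, dpl (fun t => y (upd mu i t) x) (mu i) (z x) /\ dpl (fun t => dy (upd mu i t) x) (mu i) (dz x).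
Proof.
  intros HO HU Hy Cq HDq CDq HDr CDr Hz Hdz I1 I2.
  assert (Hl : luc punct0 (fun h x => (y (upd mu i (mu i + h)) x - y mu x) / h) z /\
    luc punct0 (fun h x => (dy (upd mu i (mu i + h)) x - dy mu x) / h) dz).
  { apply (linear_ivp_luc punct0 _ _ (fun h x => q (upd mu i (mu i + h)) x)
      (fun h x => (q (upd mu i (mu i + h)) x - q mu x) / h * y mu x + (r (upd mu i (mu i + h)) x - r mu x) / h)
      z dz (q mu) (fun x => Dq mu x * y mu x + Dr mu x)); auto.
    - destruct (open_punct U mu i HO HU) as [d [Hd HU']]. exists d. split; auto.
      intros h Hh0 Hhd. specialize (HU' h Hh0 Hhd).
      destruct (Hy _ HU') as [A1 A2]. destruct (Hy _ HU) as [B1 B2]. split; intros x.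
      + specialize (A1 x). specialize (B1 x). unfold Rdiv. der. field; auto.
      + specialize (A2 x). specialize (B2 x). unfold Rdiv. der. field; auto.
    - intros x. now apply jcont_at_cont.
    - apply (luc_comp punct0 q mu (fun h => upd mu i (mu i + h)) (fun _ x => x) (fun x => x));
        auto using cont_id, near_upd_plus. apply (luc_const punct0).
    - apply (luc_plus punct0).
      + apply (luc_mult punct0).
        * intros x. now apply jcont_at_cont.
        * intros x. eapply dpl_cont. apply (proj1 (Hy _ HU)).
        * now apply (diff_quot_luc U).
        * apply (luc_const punct0).
      + now apply (diff_quot_luc U).
    - pose proof (tends_of_dpl _ _ _ I1) as H. cbv beta in H. now rewrite upd_same in H.
    - pose proof (tends_of_dpl _ _ _ I2) as H. cbv beta in H. now rewrite upd_same in H. }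
  intros x. destruct Hl as [L1 L2].
  split; apply dpl_of_tends; rewrite upd_same; [exact (luc_tends punct0 _ _ x L1)|exact (luc_tends punct0 _ _ x L2)].
Qed.

(* The parameter derivatives solve linear problems of the same kind, so no integral formula is differentiated. *)
Lemma linear_ivp_Cj {n} k (U : Rn n -> Prop) : is_open U ->
  forall (q r y dy : Rn n -> R -> R) (al be : Rn n -> R),
  Cj k U q -> Cj k U r -> Cj k U (fun mu _ => al mu) -> Cj k U (fun mu _ => be mu) ->
  (forall mu, U mu -> exists M, forall x, Rabs (q mu x) <= M) ->
  (forall mu, U mu -> (forall x, dpl (y mu) x (dy mu x)) /\
     (forall x, dpl (dy mu) x (q mu x * y mu x + r mu x)) /\ y mu 0 = al mu /\ dy mu 0 = be mu) ->
  Cj k U y /\ Cj k U dy.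
Proof.
  intros HO. induction k; intros q r y dy al be Hq Hr Hal Hbe Hb Hy.
  - assert (HC : forall mu x, U mu -> jcont_at y mu x /\ jcont_at dy mu x).
    { intros mu x HU. destruct (Hy mu HU) as [Y1 [Y2 [Y3 Y4]]].
      assert (HL : forall f, Cj 0 U f -> luc (nbhd mu) f (f mu)).
      { intros f Hf. apply jcont_luc. intros t. eapply Cj_jcont; eauto. }
      destruct (linear_ivp_luc (nbhd mu) y dy q r (y mu) (dy mu) (q mu) (r mu)) as [L1 L2]; auto.
      - eapply filter_imp; [|apply (open_nbhd U mu HO HU)]. intros nu Hnu.
        destruct (Hy nu Hnu) as [? [? _]]; auto.
      - intros t. eapply Cj_cont; eauto.
      - rewrite Y3. eapply (tends_ext (nbhd mu)); [|apply (luc_tends (nbhd mu) _ _ 0 (HL _ Hal))].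
        eapply filter_imp; [|apply (open_nbhd U mu HO HU)]. intros nu Hnu.
        destruct (Hy nu Hnu) as [_ [_ [-> _]]]; auto.
      - rewrite Y4. eapply (tends_ext (nbhd mu)); [|apply (luc_tends (nbhd mu) _ _ 0 (HL _ Hbe))].
        eapply filter_imp; [|apply (open_nbhd U mu HO HU)]. intros nu Hnu.
        destruct (Hy nu Hnu) as [_ [_ [_ ->]]]; auto.
      - split; apply luc_jcont; auto; intros t; eapply dpl_cont; eauto. }
    split; split; auto; intros mu x HU; now apply HC.
  - destruct (IHk q r y dy al be) as [Cy Cdy]; auto using Cj_pred.
    assert (Hq' := Cj_pred _ _ _ Hq). assert (Hr' := Cj_pred _ _ _ Hr).
    destruct Hq as [Jq [Dq [Dqx [Q1 [Q2 [Q3 Q4]]]]]].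
    destruct Hr as [Jr [Dr [Drx [R1 [R2 [R3 R4]]]]]].
    destruct Hal as [Ja [Da [_ [Al1 [_ [Al3 _]]]]]].
    destruct Hbe as [Jb [Db [_ [Be1 [_ [Be3 _]]]]]].
    (* The formally differentiated problem in direction [i]; parameters outside [U] receive a dummy
       pair so that a choice function is total. *)
    assert (Hz : forall i mu, exists zz : (R -> R) * (R -> R), U mu ->
       (forall x, dpl (fst zz) x (snd zz x)) /\
       (forall x, dpl (snd zz) x (q mu x * fst zz x + (Dq i mu x * y mu x + Dr i mu x))) /\
       fst zz 0 = Da i mu 0 /\ snd zz 0 = Db i mu 0).
    { intros i mu. destruct (classic (U mu)) as [HU|HU].
      - destruct (Hb mu HU) as [M HM].
        destruct (linear_exists (q mu) (fun x => Dq i mu x * y mu x + Dr i mu x) M (Da i mu 0) (Db i mu 0))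
          as [z [dz Hz]]; auto.
        + intros x; eapply Cj_cont; eauto.
        + intros x. apply (Cj_cont k U (fun mu x => Dq i mu x * y mu x + Dr i mu x)); auto.
          apply Cj_plus; auto. apply Cj_mult; auto.
        + now exists (z, dz).
      - exists (fun _ => 0, fun _ => 0). tauto. }
    set (zz := fun i mu => proj1_sig (constructive_indefinite_description _ (Hz i mu))).
    assert (Hzz : forall i mu, U mu ->
       (forall x, dpl (fst (zz i mu)) x (snd (zz i mu) x)) /\
       (forall x, dpl (snd (zz i mu)) x (q mu x * fst (zz i mu) x + (Dq i mu x * y mu x + Dr i mu x))) /\
       fst (zz i mu) 0 = Da i mu 0 /\ snd (zz i mu) 0 = Db i mu 0).
    { intros i mu. unfold zz. destruct (constructive_indefinite_description _ _); auto. }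
    clearbody zz.
    assert (HD : forall i mu x, U mu -> dpl (fun t => y (upd mu i t) x) (mu i) (fst (zz i mu) x) /\
      dpl (fun t => dy (upd mu i t) x) (mu i) (snd (zz i mu) x)).
    { intros i mu x HU. destruct (Hzz i mu HU) as [Z1 [Z2 [Z3 Z4]]].
      apply (linear_ivp_diff_quot U q r y dy (Dq i) (Dr i) i mu (fst (zz i mu)) (snd (zz i mu))); auto.
      - intros nu HU'. destruct (Hy nu HU') as [? [? _]]; auto.
      - intros t; eapply Cj_jcont; eauto.
      - intros t; eapply Cj_jcont; eauto.
      - rewrite Z3. apply dpl_of_tends. pose proof (tends_of_dpl _ _ _ (Al1 i mu 0 HU)) as H.
        eapply (tends_ext punct0); [|exact H].
        eapply filter_imp; [|apply (open_punct U mu i HO HU)]. cbv beta. intros h Hh.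
        rewrite upd_same. destruct (Hy _ Hh) as [_ [_ [-> _]]]. destruct (Hy _ HU) as [_ [_ [-> _]]]. auto.
      - rewrite Z4. apply dpl_of_tends. pose proof (tends_of_dpl _ _ _ (Be1 i mu 0 HU)) as H.
        eapply (tends_ext punct0); [|exact H].
        eapply filter_imp; [|apply (open_punct U mu i HO HU)]. cbv beta. intros h Hh.
        rewrite upd_same. destruct (Hy _ Hh) as [_ [_ [_ ->]]]. destruct (Hy _ HU) as [_ [_ [_ ->]]]. auto. }
    (* The source for [zz i] contains [y], of which only class [k] is known so far; that is exactly
       what the induction hypothesis asks for. *)
    assert (HZC : forall i, Cj k U (fun mu x => fst (zz i mu) x) /\ Cj k U (fun mu x => snd (zz i mu) x)).
    { intros i. apply (IHk q (fun mu x => Dq i mu x * y mu x + Dr i mu x) _ _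
        (fun mu => Da i mu 0) (fun mu => Db i mu 0)); auto.
      - apply Cj_plus; auto. apply Cj_mult; auto.
      - apply Cj_eval; auto.
      - apply Cj_eval; auto. }
    split; (split; [intros; eapply Cj_jcont; eauto|]).
    + exists (fun i mu x => fst (zz i mu) x), dy. repeat split; auto.
      * intros i mu x HU. apply HD; auto.
      * intros mu x HU. apply Hy; auto.
      * intros i. apply HZC.
    + exists (fun i mu x => snd (zz i mu) x), (fun mu x => q mu x * y mu x + r mu x). repeat split; auto.
      * intros i mu x HU. apply HD; auto.
      * intros mu x HU. apply Hy; auto.
      * intros i. apply HZC.
      * apply Cj_plus; [apply Cj_mult|]; auto.
Qed.

(** * Even periodic solutions near a nondegenerate one *)

(** The point [x'] is independent of [f], so several functions can be folded at once. The induction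
    counts half periods, removing one period from [Rabs y] at each step. *)
Lemma fold_even_periodic L x : 0 < L ->
  exists x', 0 <= x' <= L / 2 /\ forall f, periodic L f -> even f -> f x = f x'.
Proof.
  intros HL.
  assert (H : forall n x, Rabs x <= L / 2 + INR n * (L / 2) ->
    exists x', 0 <= x' <= L / 2 /\ forall f, periodic L f -> even f -> f x = f x').
  { induction n; intros y Hy.
    - simpl in Hy. exists (Rabs y). split; [split; [apply Rabs_pos|lra]|].
      intros f _ Hf. unfold Rabs. destruct (Rcase_abs y); auto.
    - destruct (Rle_dec (Rabs y) (L / 2)) as [h|h].
      + exists (Rabs y). split; [split; [apply Rabs_pos|lra]|].
        intros f _ Hf. unfold Rabs. destruct (Rcase_abs y); auto.
      + destruct (IHn (Rabs y - L)) as [x' [H1 H2]].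
        * rewrite S_INR in Hy. pose proof (pos_INR n).
          assert (0 <= INR n * (L / 2)) by (apply Rmult_le_pos; lra).
          apply Rabs_le_between. lra.
        * exists x'. split; auto. intros f Hp He. rewrite <- (H2 f Hp He), <- (Hp (Rabs y - L)).
          replace (Rabs y - L + L) with (Rabs y) by ring.
          unfold Rabs. destruct (Rcase_abs y); auto. }
  destruct (INR_unbounded (Rabs x / (L / 2))) as [n Hn].
  apply (H n). apply Rlt_le. apply (Rmult_lt_compat_r (L / 2)) in Hn; [|lra].
  unfold Rdiv at 1 in Hn. rewrite Rmult_assoc, Rinv_l in Hn; lra.
Qed.

Lemma dpl_reflect f c x a : dpl f (c - x) a -> dpl (fun t => f (c - t)) x (- a).
Proof.
  intros H. apply dpl_ext with (fun t => f (-1 * t + c)); [intros; f_equal; ring|].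
  eapply dpl_eq; [apply dpl_affine; replace (-1 * x + c) with (c - x) by ring; exact H|ring].
Qed.

Lemma dpl_shift f c x a : dpl f (x + c) a -> dpl (fun t => f (t + c)) x a.
Proof.
  intros H. apply dpl_ext with (fun t => f (1 * t + c)); [intros; f_equal; ring|].
  eapply dpl_eq; [apply dpl_affine; replace (1 * x + c) with (x + c) by ring; exact H|ring].
Qed.

Lemma even_deriv f df : (forall x, dpl f x (df x)) -> even f -> forall x, df (- x) = - df x.
Proof.
  intros Hd He x. assert (H : dpl f x (- df (0 - x))).
  { apply dpl_ext with (fun t => f (0 - t)).
    - intros t. rewrite Rminus_0_l. apply He.
    - apply dpl_reflect, Hd. }
  pose proof (uniqueness_limite _ _ _ _ H (Hd x)). rewrite Rminus_0_l in *. lra.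
Qed.

Lemma periodic_deriv L f df : (forall x, dpl f x (df x)) -> periodic L f -> periodic L df.
Proof.
  intros Hd Hp x. assert (H : dpl f x (df (x + L))).
  { apply dpl_ext with (fun t => f (t + L)); [apply Hp|]. apply dpl_shift, Hd. }
  exact (uniqueness_limite _ _ _ _ H (Hd x)).
Qed.

(** The points [- (L / 2)] and [L / 2] differ by a period, so their values are both equal and
    opposite. *)
Lemma odd_periodic_half L f : periodic L f -> (forall x, f (- x) = - f x) -> f (L / 2) = 0.
Proof.
  intros Hp Ho. pose proof (Hp (- (L / 2))) as H. replace (- (L / 2) + L) with (L / 2) in H by field.
  rewrite Ho in H. lra.
Qed.

Lemma even_deriv_half L f df : (forall x, dpl f x (df x)) -> periodic L f -> even f ->
  df 0 = 0 /\ df (L / 2) = 0.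
Proof.
  intros Hd Hp He. pose proof (even_deriv f df Hd He) as Ho. split.
  - specialize (Ho 0). rewrite Ropp_0 in Ho. lra.
  - apply odd_periodic_half; auto. now apply (periodic_deriv L f).
Qed.

(* [d - d 0 * y1] has zero initial data, so the energy estimate and [dd l = 0] bound [d 0 * dy1 l]. *)
Lemma neumann_stable (Q0 y1 dy1 : R -> R) l M : 0 < l ->
  (forall x, dpl y1 x (dy1 x)) -> (forall x, dpl dy1 x (Q0 x * y1 x)) ->
  (forall x, Rabs (Q0 x) <= M) -> y1 0 = 1 -> dy1 0 = 0 -> dy1 l <> 0 ->
  exists e0 C, 0 < e0 /\ 0 < C /\ forall (q f d dd : R -> R) eta, 0 <= eta ->
    (forall x, 0 <= x <= l -> Rabs (q x - Q0 x) <= e0) -> (forall x, 0 <= x <= l -> Rabs (f x) <= eta) ->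
    (forall x, 0 <= x <= l -> dpl d x (dd x)) -> (forall x, 0 <= x <= l -> dpl dd x (q x * d x + f x)) ->
    dd 0 = 0 -> dd l = 0 -> forall x, 0 <= x <= l -> Rabs (d x) <= C * eta /\ Rabs (dd x) <= C * eta.
Proof.
  intros Hl Y1 Y2 HM Y3 Y4 Y5.
  assert (HM0 : 0 <= M) by (specialize (HM 0); pose proof (Rabs_pos (Q0 0)); lra).
  destruct (locally_bounded y1 l) as [B [HB HB']]. { intros x; eapply dpl_cont, Y1. }
  assert (HB1 : forall x, 0 <= x <= l -> Rabs (y1 x) <= B).
  { intros x Hx. apply HB'. rewrite Rabs_right; lra. }
  set (X := exp ((2 + (M + 1)) * (l - 0))). assert (HX : 0 < X) by apply exp_pos.
  set (A := Rabs (dy1 l)). assert (HA : 0 < A) by now apply Rabs_pos_lt.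
  (* Chosen so that the error [Rabs (d 0) * e0 * B * X] is at most half of [Rabs (d 0) * A] and can
     be absorbed on the left. *)
  set (e0 := Rmin 1 (A / (2 * (B + 1) * X))).
  assert (HBX : 0 < 2 * (B + 1) * X) by (apply Rmult_lt_0_compat; lra).
  assert (He0 : 0 < e0) by (apply Rmin_pos; [lra|now apply Rdiv_lt_0_compat]).
  assert (He1 : e0 <= 1) by apply Rmin_l.
  assert (He2 : e0 * B * X <= A / 2).
  { apply Rle_trans with (A / (2 * (B + 1) * X) * (B + 1) * X).
    - apply Rmult_le_compat_r; [lra|]. apply Rmult_le_compat; try lra. apply Rmin_r.
    - right. field. lra. }
  (* The factor [2 * X / A] bounds [d 0] in units of [eta]; a second energy estimate, started from
     [d 0] with source [eta], gives the rest. *)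
  exists e0, ((2 * X / A + 1) * X).
  assert (HC : 0 < 2 * X / A) by (apply Rdiv_lt_0_compat; lra).
  split; [exact He0|]. split; [apply Rmult_lt_0_compat; lra|].
  intros q f d dd eta Heta Hq Hf D1 D2 D3 D4 x Hx.
  assert (Hq' : forall x, 0 <= x <= l -> Rabs (q x) <= M + 1).
  { intros t Ht; specialize (Hq t Ht); specialize (HM t).
    replace (q t) with ((q t - Q0 t) + Q0 t) by ring. eapply Rle_trans; [apply Rabs_triang|lra]. }
  assert (Hd0 : Rabs (d 0) <= 2 * X / A * eta).
  { destruct (energy_right (fun x => d x - d 0 * y1 x) (fun x => dd x - d 0 * dy1 x)
      (fun x => q x * d x + f x - d 0 * (Q0 x * y1 x)) 0 l (M + 1) (Rabs (d 0) * e0 * B + eta)) with (x := l)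
      as [_ E].
    - lra.
    - assert (0 <= Rabs (d 0) * e0 * B); [|lra].
      apply Rmult_le_pos; auto. apply Rmult_le_pos; [apply Rabs_pos|lra].
    - intros t Ht. specialize (D1 t Ht). specialize (Y1 t). der. ring.
    - intros t Ht. specialize (D2 t Ht). specialize (Y2 t). der. ring.
    - intros t Ht. specialize (Hq t Ht). specialize (Hq' t Ht). specialize (Hf t Ht). specialize (HB1 t Ht).
      replace (q t * d t + f t - d 0 * (Q0 t * y1 t)) with
        (q t * (d t - d 0 * y1 t) + (d 0 * ((q t - Q0 t) * y1 t) + f t)) by ring.
      eapply Rle_trans; [apply Rabs_triang|]. apply Rplus_le_compat.
      + rewrite Rabs_mult. apply Rmult_le_compat_r; [apply Rabs_pos|lra].
      + eapply Rle_trans; [apply Rabs_triang|]. apply Rplus_le_compat; [|lra]. rewrite !Rabs_mult, Rmult_assoc.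
        apply Rmult_le_compat_l; [apply Rabs_pos|]. apply Rmult_le_compat; auto using Rabs_pos.
    - lra.
    - rewrite D4, D3, Y3, Y4 in E. fold X in E.
      replace (d 0 - d 0 * 1) with 0 in E by ring. replace (0 - d 0 * 0) with 0 in E by ring.
      replace (0 - d 0 * dy1 l) with (- (d 0 * dy1 l)) in E by ring.
      rewrite Rabs_Ropp, Rabs_mult, Rabs_R0 in E. fold A in E.
      assert (Rabs (d 0) * (e0 * B * X) <= Rabs (d 0) * (A / 2)).
      { apply Rmult_le_compat_l; [apply Rabs_pos|auto]. }
      apply Rmult_le_reg_r with (A / 2); [lra|].
      replace (2 * X / A * eta * (A / 2)) with (eta * X) by (field; lra). nra. }
  destruct (energy_right d dd (fun x => q x * d x + f x) 0 l (M + 1) eta) with (x := x) as [E1 E2]; auto; try lra.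
  - intros t Ht. specialize (Hq' t Ht). specialize (Hf t Ht).
    eapply Rle_trans; [apply Rabs_triang|]. apply Rplus_le_compat; auto.
    rewrite Rabs_mult. apply Rmult_le_compat_r; auto using Rabs_pos.
  - fold X in E1, E2. rewrite D3, Rabs_R0 in E1, E2.
    assert ((Rabs (d 0) + 0 + eta) * X <= (2 * X / A + 1) * X * eta); [|lra].
    replace ((2 * X / A + 1) * X * eta) with ((2 * X / A * eta + eta) * X) by ring.
    apply Rmult_le_compat_r; lra.
Qed.

Definition even_per_sol (G : R -> R) (L : R) (u du : R -> R) : Prop :=
  (forall x, dpl u x (du x)) /\ (forall x, dpl du x (G (u x))) /\ periodic L u /\ even u.

(** An autonomous equation without first-order term is invariant under reflection, and at a critical
    point [c] the reflected solution has the same Cauchy data. *)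
Lemma autonomous_reflect (N u du : R -> R) M c : 0 <= M ->
  (forall a b, Rabs (N a - N b) <= M * Rabs (a - b)) ->
  (forall x, dpl u x (du x)) -> (forall x, dpl du x (N (u x))) -> du c = 0 ->
  forall x, u (2 * c - x) = u x.
Proof.
  intros HM HL Hu Hdu Hc x.
  destruct (energy_zero (fun x => u x - u (2 * c - x)) (fun x => du x - - du (2 * c - x))
    (fun x => N (u x) - - - N (u (2 * c - x))) c M) with (x := x) as [E _]; auto.
  - intros t. apply dpl_minus; auto. now apply dpl_reflect.
  - intros t. apply dpl_minus; auto. apply dpl_opp. now apply dpl_reflect.
  - intros t. rewrite Ropp_involutive. auto.
  - replace (2 * c - c) with c by ring. ring.
  - replace (2 * c - c) with c by ring. rewrite Hc. ring.
  - lra.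
Qed.

(** Clamping makes the nonlinearity globally Lipschitz, as [picard] requires. By [clamp_id] it has
    no effect on solutions that remain in the band. *)
Lemma clamp_lipschitz K a b :
  Rabs (Rmax (- K) (Rmin K a) - Rmax (- K) (Rmin K b)) <= Rabs (a - b).
Proof.
  unfold Rmax, Rmin. repeat destruct (Rle_dec _ _); unfold Rabs; repeat destruct (Rcase_abs _); lra.
Qed.

Lemma clamp_bound K a : 0 <= K -> Rabs (Rmax (- K) (Rmin K a)) <= K.
Proof. intros. unfold Rmax, Rmin. repeat destruct (Rle_dec _ _); unfold Rabs; destruct (Rcase_abs _); lra. Qed.

Lemma clamp_id K a : Rabs a <= K -> Rmax (- K) (Rmin K a) = a.
Proof. intros H. apply Rabs_le_between in H. unfold Rmax, Rmin. repeat destruct (Rle_dec _ _); lra. Qed.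

Lemma lipschitz_continuity f M : 0 <= M -> (forall a b, Rabs (f a - f b) <= M * Rabs (a - b)) ->
  forall x, continuity_pt f x.
Proof.
  intros HM H x eps He. exists (eps / (M + 1)). split; [apply Rdiv_lt_0_compat; lra|].
  intros t [_ Ht]. simpl in *. unfold Rdist in *. eapply Rle_lt_trans; [apply H|].
  assert (Rabs (t - x) * (M + 1) < eps).
  { apply (Rmult_lt_compat_r (M + 1)) in Ht; [|lra]. unfold Rdiv in Ht.
    rewrite Rmult_assoc, Rinv_l in Ht; lra. }
  pose proof (Rabs_pos (t - x)). lra.
Qed.

Lemma even_periodic_bounded L f : 0 < L -> (forall x, continuity_pt f x) -> periodic L f -> even f ->
  exists K, 0 <= K /\ forall x, Rabs (f x) <= K.
Proof.
  intros HL Hc Hp He. destruct (locally_bounded f (L / 2) Hc) as [K [HK H]].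
  exists K. split; auto. intros x. destruct (fold_even_periodic L x HL) as [x' [Hx' E]].
  rewrite (E f Hp He). apply H. rewrite Rabs_right; lra.
Qed.

(* Shooting: solve [u'' = g mu (clamp u)], [u 0 = a], [u' 0 = 0] and adjust [a] near [phi 0] by the
   intermediate value theorem so that [u' (L/2) = 0]; reflection then makes [u] even and periodic. *)
Lemma even_per_sol_exists {n} (P : Rn n -> Prop) (g g' : Rn n -> R -> R) (mu0 : Rn n) (L : R)
  (phi dphi y1 dy1 : R -> R) :
  is_open P -> P mu0 -> 0 < L ->
  (forall mu u, P mu -> jcont_at g mu u) -> (forall mu u, P mu -> jcont_at g' mu u) ->
  (forall mu u, P mu -> dpl (g mu) u (g' mu u)) ->
  even_per_sol (g mu0) L phi dphi ->
  (forall x, dpl y1 x (dy1 x)) -> (forall x, dpl dy1 x (g' mu0 (phi x) * y1 x)) ->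
  y1 0 = 1 -> dy1 0 = 0 -> dy1 (L / 2) <> 0 ->
  forall rho, 0 < rho -> exists sigma, 0 < sigma /\ forall mu, near mu0 sigma mu ->
    P mu /\ exists u du, even_per_sol (g mu) L u du /\ forall x, Rabs (u x - phi x) <= rho.
Proof.
  intros HPo HP0 HL Cg Cg' Dg [F1 [F2 [F3 F4]]] Y1 Y2 Y3 Y4 Y5 rho Hrho.
  set (l := L / 2) in *. assert (Hl : 0 < l) by (unfold l; lra).
  destruct (even_periodic_bounded L phi HL) as [K [HK HphiK]]; auto.
  { intros x; eapply dpl_cont, F1. }
  set (c := fun u => Rmax (- (K + 1)) (Rmin (K + 1) u)).
  destruct (locally_bounded (g' mu0) (K + 1)) as [B0 [HB0 HB0']].
  { intros x. apply jcont_at_cont; auto. }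
  destruct (jcont_unif g' mu0 (fun u => Cg' mu0 u HP0) (K + 1) 1 Rlt_0_1) as [s1 [Hs1 Hs1']].
  set (M := B0 + 1). assert (HM : 0 <= M) by (unfold M; lra).
  assert (HMb : forall mu u, near mu0 s1 mu -> Rabs u <= K + 1 -> Rabs (g' mu u) <= M).
  { intros mu u Hmu Hu. specialize (Hs1' mu u u Hmu Hu). rewrite Rminus_diag, Rabs_R0 in Hs1'.
    specialize (Hs1' Hs1). specialize (HB0' u Hu).
    replace (g' mu u) with ((g' mu u - g' mu0 u) + g' mu0 u) by ring.
    eapply Rle_trans; [apply Rabs_triang|]. unfold M. lra. }
  destruct (locally_bounded y1 l) as [B1 [HB1 HB1']]. { intros x; eapply dpl_cont, Y1. }
  set (X := exp ((2 + M) * (l - 0))). assert (HX : 0 < X) by apply exp_pos.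
  set (A := Rabs (dy1 l)). assert (HA : 0 < A) by now apply Rabs_pos_lt.
  assert (HBX : 0 < 4 * (B1 + 1) * X) by (apply Rmult_lt_0_compat; lra).
  (* Admissible oscillation of [g'] between the perturbed and the original solution: it limits the
     linearisation error to a quarter of [s * A]. *)
  set (kap := A / (4 * (B1 + 1) * X)).
  assert (Hkap : 0 < kap) by (apply Rdiv_lt_0_compat; lra).
  assert (HkapX : kap * B1 * X <= A / 4).
  { apply Rle_trans with (kap * (B1 + 1) * X).
    - apply Rmult_le_compat_r; [lra|]. apply Rmult_le_compat_l; lra.
    - right. unfold kap. field. lra. }
  destruct (jcont_unif g' mu0 (fun u => Cg' mu0 u HP0) K kap Hkap) as [d1 [Hd1 Hd1']].
  set (m := Rmin 1 (Rmin d1 rho)).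
  assert (Hm : 0 < m) by (repeat apply Rmin_pos; lra).
  assert (Hm1 : m <= 1) by apply Rmin_l.
  assert (Hm2 : m <= d1) by (eapply Rle_trans; [apply Rmin_r|apply Rmin_l]).
  assert (Hm3 : m <= rho) by (eapply Rle_trans; [apply Rmin_r|apply Rmin_r]).
  (* Half-width of the shooting interval. With [eta <= s], the energy bound [(s + eta) * X] is at
     most [m / 2]. *)
  set (s := m / (4 * X)). assert (Hs : 0 < s) by (apply Rdiv_lt_0_compat; lra).
  assert (HsX : 2 * s * X = m / 2) by (unfold s; field; lra).
  (* Admissible change of [g] when [mu] moves; its contribution to the error at [l] is the other
     quarter of [s * A]. *)
  set (eta := s * Rmin 1 (A / (4 * X))).
  assert (HAX : 0 < A / (4 * X)) by (apply Rdiv_lt_0_compat; lra).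
  assert (Heta : 0 < eta) by (apply Rmult_lt_0_compat; auto; apply Rmin_pos; lra).
  assert (Heta1 : eta <= s).
  { unfold eta. pose proof (Rmin_l 1 (A / (4 * X))). nra. }
  assert (HetaX : eta * X <= s * A / 4).
  { apply Rle_trans with (s * (A / (4 * X)) * X).
    - apply Rmult_le_compat_r; [lra|]. apply Rmult_le_compat_l; [lra|apply Rmin_r].
    - right. field. lra. }
  destruct (jcont_unif g mu0 (fun u => Cg mu0 u HP0) K eta Heta) as [s2 [Hs2 Hs2']].
  destruct (HPo mu0 HP0) as [s3 [Hs3 Hs3']].
  exists (Rmin (Rmin s1 d1) (Rmin s2 s3)). split; [repeat apply Rmin_pos; auto|].
  intros mu Hmu.
  assert (N1 : near mu0 s1 mu) by (apply near_min_l, near_min_l in Hmu; auto).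
  assert (N2 : near mu0 d1 mu) by (apply near_min_l, near_min_r in Hmu; auto).
  assert (N3 : near mu0 s2 mu) by (apply near_min_r, near_min_l in Hmu; auto).
  assert (HP : P mu) by (apply Hs3'; apply near_min_r, near_min_r in Hmu; auto).
  split; auto.
  set (N := fun u => g mu (c u)).
  assert (HgM : forall a b, Rabs a <= K + 1 -> Rabs b <= K + 1 -> Rabs (g mu a - g mu b) <= M * Rabs (a - b)).
  { intros a b Ha Hb. destruct (mvt_any (g mu) (g' mu) b a) as [z [Hz1 Hz2]]; auto.
    rewrite Hz1, Rabs_mult. apply Rmult_le_compat_r; [apply Rabs_pos|]. apply HMb; auto.
    rewrite <- (Rminus_0_r z). eapply between_dist; [exact Hz2| |]; now rewrite Rminus_0_r. }
  assert (HN : forall a b, Rabs (N a - N b) <= M * Rabs (a - b)).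
  { intros a b. eapply Rle_trans; [apply HgM; apply clamp_bound; lra|].
    apply Rmult_le_compat_l; auto. apply clamp_lipschitz. }
  assert (HNc : forall u, continuity_pt N u) by (apply (lipschitz_continuity N M); auto).
  assert (Hsol : forall a, exists uu : (R -> R) * (R -> R), (forall x, dpl (fst uu) x (snd uu x)) /\
     (forall x, dpl (snd uu) x (N (fst uu x))) /\ fst uu 0 = a /\ snd uu 0 = 0).
  { intros a. destruct (picard (fun _ u => N u) M (Rabs (N 0)) a 0) as [y [dy Hy]]; auto.
    - apply Rabs_pos.
    - intros u Hu x. apply (continuity_pt_comp u N); auto.
    - intros _. lra.
    - now exists (y, dy). }
  set (uu := fun a => proj1_sig (constructive_indefinite_description _ (Hsol a))).
  assert (Huu : forall a, (forall x, dpl (fst (uu a)) x (snd (uu a) x)) /\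
     (forall x, dpl (snd (uu a)) x (N (fst (uu a) x))) /\ fst (uu a) 0 = a /\ snd (uu a) 0 = 0).
  { intros a. unfold uu. destruct (constructive_indefinite_description _ _); auto. }
  clearbody uu. clear Hsol.
  destruct (even_deriv_half L phi dphi F1 F3 F4) as [P0 Pl]. fold l in Pl.
  assert (Hclose : forall a, Rabs (a - phi 0) <= s -> forall x, 0 <= x <= l ->
    Rabs (fst (uu a) x - phi x) < m).
  { intros a Ha x Hx. destruct (Huu a) as [U1 [U2 [U3 U4]]].
    destruct (energy_right (fun x => fst (uu a) x - phi x) (fun x => snd (uu a) x - dphi x)
      (fun x => N (fst (uu a) x) - g mu0 (phi x)) 0 l M eta) with (x := x) as [E _]; auto; try lra.
    - intros t _. now apply dpl_minus.
    - intros t _. now apply dpl_minus.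
    - intros t _.
      replace (N (fst (uu a) t) - g mu0 (phi t)) with
        ((N (fst (uu a) t) - N (phi t)) + (g mu (phi t) - g mu0 (phi t))).
      + eapply Rle_trans; [apply Rabs_triang|]. apply Rplus_le_compat; auto.
        left. apply Hs2'; auto. rewrite Rminus_diag, Rabs_R0. auto.
      + unfold N, c at 2. rewrite (clamp_id _ (phi t)); [ring|]. specialize (HphiK t). lra.
    - fold X in E. rewrite U3, U4, P0, Rminus_diag, Rabs_R0 in E.
      eapply Rle_lt_trans; [exact E|]. apply Rle_lt_trans with (2 * s * X); [|lra].
      apply Rmult_le_compat_r; lra. }
  (* At the two ends of the shooting interval the linear term [(a - phi 0) * dy1 l] has size [s * A]
     and opposite signs, so an error of half that size leaves opposite signs of the derivative at
     [l]. *)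
  assert (Hsign : forall a, Rabs (a - phi 0) = s -> Rabs (snd (uu a) l - (a - phi 0) * dy1 l) <= s * A / 2).
  { intros a Ha. destruct (Huu a) as [U1 [U2 [U3 U4]]].
    assert (Hcl := Hclose a ltac:(lra)).
    destruct (energy_right (fun x => fst (uu a) x - phi x - (a - phi 0) * y1 x)
      (fun x => snd (uu a) x - dphi x - (a - phi 0) * dy1 x)
      (fun x => N (fst (uu a) x) - g mu0 (phi x) - (a - phi 0) * (g' mu0 (phi x) * y1 x))
      0 l M (kap * s * B1 + eta)) with (x := l) as [_ E]; auto; try lra.
    - assert (0 <= kap * s * B1); [|lra]. apply Rmult_le_pos; auto. apply Rmult_le_pos; lra.
    - intros t _. specialize (U1 t). specialize (F1 t). specialize (Y1 t). der. ring.
    - intros t _. specialize (U2 t). specialize (F2 t). specialize (Y2 t). der. ring.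
    - intros t Ht. specialize (Hcl t Ht). specialize (HphiK t).
      set (u := fst (uu a) t) in *. set (p := phi t) in *.
      assert (Hu : Rabs u <= K + 1).
      { replace u with ((u - p) + p) by ring. eapply Rle_trans; [apply Rabs_triang|]. lra. }
      unfold N, c. rewrite (clamp_id _ u Hu).
      destruct (mvt_any (g mu) (g' mu) p u) as [z [Hz1 Hz2]]; auto.
      assert (Hzp : Rabs (z - p) < m).
      { eapply Rle_lt_trans; [|exact Hcl]. eapply between_dist; [exact Hz2| |lra].
        rewrite Rminus_diag, Rabs_R0. apply Rabs_pos. }
      assert (Hz : Rabs z <= K + 1).
      { replace z with ((z - p) + p) by ring. eapply Rle_trans; [apply Rabs_triang|]. lra. }
      replace (g mu u) with (g mu p + g' mu z * (u - p)) by lra.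
      replace (g mu p + g' mu z * (u - p) - g mu0 p - (a - phi 0) * (g' mu0 p * y1 t)) with
        (g' mu z * (u - p - (a - phi 0) * y1 t) +
          ((g' mu z - g' mu0 p) * (a - phi 0) * y1 t + (g mu p - g mu0 p))) by ring.
      eapply Rle_trans; [apply Rabs_triang|]. apply Rplus_le_compat.
      + rewrite Rabs_mult. apply Rmult_le_compat_r; [apply Rabs_pos|]. auto.
      + eapply Rle_trans; [apply Rabs_triang|]. apply Rplus_le_compat.
        * rewrite !Rabs_mult, Ha. apply Rmult_le_compat; [|apply Rabs_pos| |].
          -- apply Rmult_le_pos; [apply Rabs_pos|lra].
          -- apply Rmult_le_compat_r; [lra|]. left. apply Hd1'; auto. lra.
          -- apply HB1'. rewrite Rabs_right; lra.
        * left. apply Hs2'; auto. rewrite Rminus_diag, Rabs_R0. auto.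
    - fold X in E. rewrite U3, U4, P0, Pl, Y3, Y4 in E.
      replace (a - phi 0 - (a - phi 0) * 1) with 0 in E by ring.
      replace (0 - 0 - (a - phi 0) * 0) with 0 in E by ring. rewrite Rabs_R0 in E.
      replace (snd (uu a) l - (a - phi 0) * dy1 l) with (snd (uu a) l - 0 - (a - phi 0) * dy1 l) by ring.
      eapply Rle_trans; [exact E|].
      assert (s * (kap * B1 * X) <= s * (A / 4)) by (apply Rmult_le_compat_l; lra). lra. }
  assert (HFc : continuity (fun a => snd (uu a) l)).
  { intros a0. apply (lipschitz_continuity (fun a => snd (uu a) l) X); [lra|]. clear a0. intros a b.
    destruct (Huu a) as [U1 [U2 [U3 U4]]]. destruct (Huu b) as [V1 [V2 [V3 V4]]].
    destruct (energy_right (fun x => fst (uu a) x - fst (uu b) x) (fun x => snd (uu a) x - snd (uu b) x)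
      (fun x => N (fst (uu a) x) - N (fst (uu b) x)) 0 l M 0) with (x := l) as [_ E]; auto; try lra.
    - intros t _. now apply dpl_minus.
    - intros t _. now apply dpl_minus.
    - intros t _. rewrite Rplus_0_r. auto.
    - fold X in E. rewrite U3, U4, V3, V4, Rminus_diag, Rabs_R0, !Rplus_0_r in E. lra. }
  destruct (IVT_cor (fun a => snd (uu a) l) (phi 0 - s) (phi 0 + s) HFc) as [a [Ha Ha0]].
  - lra.
  - pose proof (Hsign (phi 0 - s)) as S1. pose proof (Hsign (phi 0 + s)) as S2.
    replace (phi 0 - s - phi 0) with (- s) in S1 by ring. replace (phi 0 + s - phi 0) with s in S2 by ring.
    rewrite Rabs_Ropp in S1. specialize (S1 (Rabs_right s ltac:(lra))). specialize (S2 (Rabs_right s ltac:(lra))).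
    apply Rabs_le_between in S1. apply Rabs_le_between in S2.
    unfold A, Rabs in S1, S2, HA. destruct (Rcase_abs (dy1 l)) as [hh|hh].
    + assert (0 < s * - dy1 l) by (apply Rmult_lt_0_compat; lra).
      assert (0 < snd (uu (phi 0 - s)) l) by lra. assert (snd (uu (phi 0 + s)) l < 0) by lra. nra.
    + assert (0 < s * dy1 l) by (apply Rmult_lt_0_compat; lra).
      assert (snd (uu (phi 0 - s)) l < 0) by lra. assert (0 < snd (uu (phi 0 + s)) l) by lra. nra.
  - destruct (Huu a) as [U1 [U2 [U3 U4]]].
    set (u := fst (uu a)) in *. set (du := snd (uu a)) in *.
    (* The derivative vanishes at 0 and at [l]; the two reflections compose to the translation by
       [L]. *)
    assert (Hev : even u).
    { intros x. rewrite <- (autonomous_reflect N u du M 0 HM HN U1 U2 U4 x). f_equal; ring. }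
    assert (Hper : periodic L u).
    { intros x. rewrite <- (autonomous_reflect N u du M l HM HN U1 U2 Ha0 (x + L)), <- (Hev x).
      f_equal. unfold l; field. }
    assert (Hall : forall x, Rabs (u x - phi x) < m).
    { intros x. destruct (fold_even_periodic L x HL) as [x' [Hx' E]].
      rewrite (E u Hper Hev), (E phi F3 F4). apply Hclose; auto. apply Rabs_le_between. lra. }
    exists u, du. split; [repeat split; auto|].
    + intros x. eapply dpl_eq; [apply U2|]. unfold N, c. rewrite clamp_id; auto.
      specialize (Hall x). specialize (HphiK x). replace (u x) with ((u x - phi x) + phi x) by ring.
      eapply Rle_trans; [apply Rabs_triang|]. lra.
    + intros x. specialize (Hall x). lra.
Qed.

(** * Smooth dependence of the branch on the parameter *)

Lemma Cj_deriv {n} (P : Rn n -> Prop) g g' : is_open P -> (forall k, Cj k P g) ->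
  (forall mu u, P mu -> dpl (g mu) u (g' mu u)) -> forall k, Cj k P g'.
Proof.
  intros HO Hg Dg k. destruct (Hg (S k)) as [_ [DF [DX [_ [B [_ D]]]]]].
  apply (Cj_ext k P DX); auto. intros mu x HP.
  exact (uniqueness_limite _ _ _ _ (B mu x HP) (Dg mu x HP)).
Qed.

Lemma luc_precomp {T} (F : (T -> Prop) -> Prop) {FF : Filter F} f f0 psi :
  (forall x, continuity_pt psi x) -> luc F f f0 -> luc F (fun t x => f t (psi x)) (fun x => f0 (psi x)).
Proof.
  intros Hp Hf r eps He. destruct (locally_bounded psi r Hp) as [B [_ HB]].
  eapply filter_imp; [|apply (Hf B eps He)]. cbv beta. auto.
Qed.

Lemma luc_between {T} (F : (T -> Prop) -> Prop) {FF : Filter F} u xi u0 :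
  luc F u u0 -> F (fun t => forall x, Rmin (u0 x) (u t x) <= xi t x <= Rmax (u0 x) (u t x)) -> luc F xi u0.
Proof.
  intros Hu Hx r eps He. eapply filter_imp; [|apply (filter_and _ _ Hx (Hu r eps He))].
  cbv beta. intros t [A B] x Hxr. specialize (A x). specialize (B x Hxr).
  eapply Rle_lt_trans; [|exact B]. eapply between_dist; [exact A| |lra].
  rewrite Rminus_diag, Rabs_R0. apply Rabs_pos.
Qed.

Lemma punct0_nonzero : punct0 (fun h => h <> 0).
Proof. exists 1. split; [lra|auto]. Qed.

(** The common bound [r < s] supplies a margin valid for all coordinates, so no maximum over the
    index type has to be formed. *)
Lemma open_ball_open {n} (mu0 : Rn n) s : is_open (fun mu => exists r, r < s /\ forall i, Rabs (mu i - mu0 i) <= r).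
Proof.
  intros mu [r [Hr H]]. exists ((s - r) / 2). split; [lra|]. intros nu Hnu.
  exists ((s + r) / 2). split; [lra|]. intros i. specialize (H i). specialize (Hnu i).
  replace (nu i - mu0 i) with ((nu i - mu i) + (mu i - mu0 i)) by ring.
  eapply Rle_trans; [apply Rabs_triang|]. lra.
Qed.

(* One bootstrap step: the parameter derivative of [psi] is the solution [w] of the linearised
   Neumann problem, built from the two initial value problems [Y] and [Z]. *)
Lemma smooth_step {n} k (P O : Rn n -> Prop) (g g' psi dpsi : Rn n -> R -> R) l :
  is_open O -> (forall mu, O mu -> P mu) -> (forall k, Cj k P g) -> (forall k, Cj k P g') ->
  (forall mu, O mu -> exists M, forall x, Rabs (g' mu (psi mu x)) <= M) ->
  (forall mu, O mu -> (forall x, dpl (psi mu) x (dpsi mu x)) /\ (forall x, dpl (dpsi mu) x (g mu (psi mu x)))) ->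
  (forall mu, O mu -> forall y dy, (forall x, dpl y x (dy x)) ->
     (forall x, dpl dy x (g' mu (psi mu x) * y x)) -> y 0 = 1 -> dy 0 = 0 -> dy l <> 0) ->
  (forall mu i Dg w dw, O mu -> (forall nu u, P nu -> dpl (fun t => g (upd nu i t) u) (nu i) (Dg nu u)) ->
     (forall u, jcont_at Dg mu u) ->
     (forall x, dpl w x (dw x)) -> (forall x, dpl dw x (g' mu (psi mu x) * w x + Dg mu (psi mu x))) ->
     dw 0 = 0 -> dw l = 0 -> forall x,
     dpl (fun t => psi (upd mu i t) x) (mu i) (w x) /\ dpl (fun t => dpsi (upd mu i t) x) (mu i) (dw x)) ->
  Cj k O psi -> Cj k O dpsi -> Cj (S k) O psi /\ Cj (S k) O dpsi.
Proof.
  intros HO HOP Hg Hg' Hb Hode Hnd Hder C1 C2.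
  pose proof (Hg (S k)) as Hgk. destruct Hgk as [_ [Dg [_ [G1 [_ [G3 _]]]]]].
  set (q := fun mu x => g' mu (psi mu x)).
  assert (Hq : Cj k O q) by (apply (Cj_comp k P O g' psi); auto).
  assert (Hr : forall i, Cj k O (fun mu x => Dg i mu (psi mu x))) by (intros i; apply (Cj_comp k P O (Dg i) psi); auto).
  assert (HS : forall (r : Rn n -> R -> R) (al : R), Cj k O r -> exists y dy : Rn n -> R -> R, forall mu, O mu ->
     (forall x, dpl (y mu) x (dy mu x)) /\ (forall x, dpl (dy mu) x (q mu x * y mu x + r mu x)) /\
     y mu 0 = al /\ dy mu 0 = 0).
  { intros r al Cr.
    assert (H : forall mu, exists zz : (R -> R) * (R -> R), O mu -> (forall x, dpl (fst zz) x (snd zz x)) /\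
      (forall x, dpl (snd zz) x (q mu x * fst zz x + r mu x)) /\ fst zz 0 = al /\ snd zz 0 = 0).
    { intros mu. destruct (classic (O mu)) as [HU|HU].
      - destruct (Hb mu HU) as [M HM].
        destruct (linear_exists (q mu) (r mu) M al 0) as [z [dz Hz]]; auto.
        + intros x; eapply Cj_cont; eauto.
        + intros x; eapply Cj_cont; eauto.
        + now exists (z, dz).
      - exists (fun _ => 0, fun _ => 0). tauto. }
    exists (fun mu => fst (proj1_sig (constructive_indefinite_description _ (H mu)))),
      (fun mu => snd (proj1_sig (constructive_indefinite_description _ (H mu)))).
    intros mu. destruct (constructive_indefinite_description _ _); auto. }
  destruct (HS (fun _ _ => 0) 1 (Cj_const _ _ _)) as [Y [dY HY]].
  assert (HYC : Cj k O Y /\ Cj k O dY).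
  { apply (linear_ivp_Cj k O HO q (fun _ _ => 0) Y dY (fun _ => 1) (fun _ => 0)); auto using Cj_const. }
  assert (HYl : forall mu, O mu -> dY mu l <> 0).
  { intros mu HU. destruct (HY mu HU) as [A1 [A2 [A3 A4]]]. apply (Hnd mu HU (Y mu) (dY mu)); auto.
    intros x. eapply dpl_eq; [apply A2|]. unfold q; ring. }
  assert (HW : forall i, exists w dw : Rn n -> R -> R, Cj k O w /\ Cj k O dw /\ forall mu, O mu ->
     forall x, dpl (fun t => psi (upd mu i t) x) (mu i) (w mu x) /\
               dpl (fun t => dpsi (upd mu i t) x) (mu i) (dw mu x)).
  { intros i. destruct (HS (fun mu x => Dg i mu (psi mu x)) 0 (Hr i)) as [Z [dZ HZ]].
    assert (HZC : Cj k O Z /\ Cj k O dZ).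
    { apply (linear_ivp_Cj k O HO q (fun mu x => Dg i mu (psi mu x)) Z dZ (fun _ => 0) (fun _ => 0));
        auto using Cj_const. }
    (* The multiple of [Y] that cancels the derivative of [Z] at [l]; the division is legitimate by
       nondegeneracy, and smoothness of [c] follows from [Cj_inv]. *)
    set (c := fun mu => - (dZ mu l * / dY mu l)).
    assert (Hc : Cj k O (fun mu _ => c mu)).
    { unfold c. apply Cj_opp; auto. apply Cj_mult.
      - apply Cj_eval, HZC.
      - apply Cj_inv; auto. apply Cj_eval, HYC. }
    exists (fun mu x => c mu * Y mu x + Z mu x), (fun mu x => c mu * dY mu x + dZ mu x).
    split; [apply Cj_plus; [apply Cj_mult|]; auto; tauto|].
    split; [apply Cj_plus; [apply Cj_mult|]; auto; tauto|].
    intros mu HU. destruct (HY mu HU) as [A1 [A2 [A3 A4]]]. destruct (HZ mu HU) as [B1 [B2 [B3 B4]]].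
    apply (Hder mu i (Dg i) (fun x => c mu * Y mu x + Z mu x)); auto.
    - intros u. eapply Cj_jcont; eauto.
    - intros x. specialize (A1 x). specialize (B1 x). der. ring.
    - intros x. specialize (A2 x). specialize (B2 x). der. unfold q. ring.
    - rewrite A4, B4. ring.
    - unfold c. field. auto. }
  assert (HW' : exists W dW : Fin.t n -> Rn n -> R -> R, forall i, Cj k O (W i) /\ Cj k O (dW i) /\
     forall mu, O mu -> forall x, dpl (fun t => psi (upd mu i t) x) (mu i) (W i mu x) /\
               dpl (fun t => dpsi (upd mu i t) x) (mu i) (dW i mu x)).
  { exists (fun i => proj1_sig (constructive_indefinite_description _ (HW i))),
      (fun i => proj1_sig (constructive_indefinite_description _
          (proj2_sig (constructive_indefinite_description _ (HW i))))).
    intros i. destruct (constructive_indefinite_description _ (HW i)) as [w Hw]; simpl.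
    destruct (constructive_indefinite_description _ Hw) as [dw Hdw]; simpl. exact Hdw. }
  destruct HW' as [W [dW HWW]].
  split; (split; [intros; eapply Cj_jcont; eauto|]).
  (* In the real variable the derivatives are [dpsi] and [g mu (psi mu x)], already of class [k];
     only the parameter directions need [W] and [dW]. *)
  - exists W, dpsi. repeat split; auto.
    + intros i mu x HU. apply (HWW i); auto.
    + intros mu x HU. apply Hode; auto.
    + intros i. apply HWW.
  - exists dW, (fun mu x => g mu (psi mu x)). repeat split; auto.
    + intros i mu x HU. apply (HWW i); auto.
    + intros mu x HU. apply Hode; auto.
    + intros i. apply HWW.
    + apply (Cj_comp k P O g psi); auto.
Qed.

(** The constants of [neumann_stable] are fixed once, at [mu0], and serve three purposes: comparison
    of two solutions near [phi], nondegeneracy at every [mu] of [O], and convergence of the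
    difference quotients at 0. *)
Lemma smooth_family {n} (P : Rn n -> Prop) (g g' : Rn n -> R -> R) (mu0 : Rn n) (L : R)
  (phi dphi y1 dy1 : R -> R) :
  is_open P -> P mu0 -> 0 < L -> (forall k, Cj k P g) ->
  (forall mu u, P mu -> dpl (g mu) u (g' mu u)) ->
  even_per_sol (g mu0) L phi dphi ->
  (forall x, dpl y1 x (dy1 x)) -> (forall x, dpl dy1 x (g' mu0 (phi x) * y1 x)) ->
  y1 0 = 1 -> dy1 0 = 0 -> dy1 (L / 2) <> 0 ->
  exists (O : Rn n -> Prop) (psi dpsi : Rn n -> R -> R),
    is_open O /\ (forall mu, O mu -> P mu) /\ O mu0 /\ (forall k, Cj k O psi) /\
    (forall mu, O mu -> even_per_sol (g mu) L (psi mu) (dpsi mu)) /\ (forall x, psi mu0 x = phi x).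
Proof.
  intros HPo HP0 HL Hg Dg HF Y1 Y2 Y3 Y4 Y5.
  assert (Hg' := Cj_deriv P g g' HPo Hg Dg).
  assert (Cg : forall mu u, P mu -> jcont_at g mu u) by (intros; apply (Cj_jcont 0 P); auto).
  assert (Cg' : forall mu u, P mu -> jcont_at g' mu u) by (intros; apply (Cj_jcont 0 P); auto).
  assert (HF' := HF). destruct HF' as [F1 [F2 [F3 F4]]].
  set (l := L / 2) in *. assert (Hl : 0 < l) by (unfold l; lra).
  destruct (even_periodic_bounded L phi HL) as [K [HK HphiK]]; auto.
  { intros x; eapply dpl_cont, F1. }
  assert (HbdG : forall mu u r, P mu -> (forall x : R, Rabs (u x) <= r) -> exists M, forall x : R, Rabs (g' mu (u x)) <= M).
  { intros mu u r HP Hu. destruct (locally_bounded (g' mu) r) as [M [_ HM]].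
    - intros x. apply jcont_at_cont; auto.
    - exists M. auto. }
  destruct (HbdG mu0 phi K HP0 HphiK) as [M0 HM0].
  destruct (neumann_stable (fun x => g' mu0 (phi x)) y1 dy1 l M0) as [e0 [C [He0 [HC Hst]]]]; auto.
  destruct (jcont_unif g' mu0 (fun u => Cg' mu0 u HP0) K e0 He0) as [d1 [Hd1 Hd1']].
  (* Anything within [rho] of [phi], including mean value points between two solutions, then yields
     a value of [g'] within [e0] of the reference potential. *)
  set (rho := d1 / 2). assert (Hrho : 0 < rho) by (unfold rho; lra).
  destruct (even_per_sol_exists P g g' mu0 L phi dphi y1 dy1 HPo HP0 HL Cg Cg' Dg HF Y1 Y2 Y3 Y4 Y5 rho Hrho)
    as [s0 [Hs0 Hex]].
  set (s := Rmin s0 d1). assert (Hs : 0 < s) by now apply Rmin_pos.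
  set (O := fun mu : Rn n => exists r, r < s /\ forall i, Rabs (mu i - mu0 i) <= r).
  assert (HOo : is_open O) by apply open_ball_open.
  assert (HOn : forall mu, O mu -> near mu0 s mu).
  { intros mu [r [Hr H]] i. specialize (H i). lra. }
  assert (HO0 : O mu0).
  { exists (s / 2). split; [lra|]. intros i. rewrite Rminus_diag, Rabs_R0. lra. }
  assert (HOP : forall mu, O mu -> P mu).
  { intros mu H. apply Hex. apply HOn, near_min_l in H. auto. }
  assert (Hex' : forall mu, exists uu : (R -> R) * (R -> R), O mu ->
     even_per_sol (g mu) L (fst uu) (snd uu) /\ forall x, Rabs (fst uu x - phi x) <= rho).
  { intros mu. destruct (classic (O mu)) as [HU|HU].
    - apply HOn, near_min_l in HU. destruct (Hex mu HU) as [_ [u [du H]]]. now exists (u, du).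
    - exists (fun _ => 0, fun _ => 0). tauto. }
  pose (uu := fun mu => proj1_sig (constructive_indefinite_description _ (Hex' mu))).
  set (psi := fun mu => fst (uu mu)). set (dpsi := fun mu => snd (uu mu)).
  assert (Hpsi : forall mu, O mu -> even_per_sol (g mu) L (psi mu) (dpsi mu) /\
     forall x, Rabs (psi mu x - phi x) <= rho).
  { intros mu. unfold psi, dpsi, uu. destruct (constructive_indefinite_description _ _); auto. }
  clearbody psi dpsi. clear uu Hex' Hex.
  assert (Hq0 : forall mu x z, O mu -> Rabs (z - phi x) <= rho -> Rabs (g' mu z - g' mu0 (phi x)) <= e0).
  { intros mu x z HU Hz. left. apply Hd1'; auto.
    - apply HOn in HU. now apply near_min_r in HU.
    - unfold rho in Hz. lra. }
  (* The secant slope [g' mu (xi mu a b)] turns the difference of two nonlinear equations into an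
     exact linear equation. *)
  assert (Hxi : forall mu a b, exists z, O mu -> g mu b - g mu a = g' mu z * (b - a) /\ Rmin a b <= z <= Rmax a b).
  { intros mu a b. destruct (classic (O mu)) as [HU|HU].
    - destruct (mvt_any (g mu) (g' mu) a b) as [z Hz]; auto. now exists z.
    - exists 0. tauto. }
  pose (xi := fun mu a b => proj1_sig (constructive_indefinite_description _ (Hxi mu a b))).
  assert (Hxi' : forall mu a b, O mu -> g mu b - g mu a = g' mu (xi mu a b) * (b - a) /\
     Rmin a b <= xi mu a b <= Rmax a b).
  { intros mu a b. unfold xi. destruct (constructive_indefinite_description _ _); auto. }
  clearbody xi. clear Hxi.
  assert (Hdiff : forall mu nu u du v dv eta, O mu -> O nu ->
     even_per_sol (g mu) L u du -> even_per_sol (g nu) L v dv ->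
     (forall x, Rabs (u x - phi x) <= rho) -> (forall x, Rabs (v x - phi x) <= rho) -> 0 <= eta ->
     (forall x, 0 <= x <= l -> Rabs (g nu (u x) - g mu (u x)) <= eta) ->
     forall x, Rabs (v x - u x) <= C * eta /\ Rabs (dv x - du x) <= C * eta).
  { intros mu nu u du v dv eta Hmu Hnu [U1 [U2 [U3 U4]]] [V1 [V2 [V3 V4]]] Hu Hv Heta Hf x.
    destruct (even_deriv_half L u du U1 U3 U4) as [u0 ul]. destruct (even_deriv_half L v dv V1 V3 V4) as [v0 vl].
    fold l in ul, vl.
    pose proof (even_deriv u du U1 U4) as U5. pose proof (even_deriv v dv V1 V4) as V5.
    pose proof (periodic_deriv L u du U1 U3) as U6. pose proof (periodic_deriv L v dv V1 V3) as V6.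
    destruct (fold_even_periodic L x HL) as [x' [Hx' E]].
    rewrite (E u U3 U4), (E v V3 V4).
    assert (Ed : Rabs (dv x - du x) = Rabs (dv x' - du x')).
    { apply (E (fun x => Rabs (dv x - du x))).
      - intros t. now rewrite U6, V6.
      - intros t. rewrite U5, V5. replace (- dv t - - du t) with (- (dv t - du t)) by ring. apply Rabs_Ropp. }
    rewrite Ed.
    apply (Hst (fun x => g' nu (xi nu (u x) (v x))) (fun x => g nu (u x) - g mu (u x))
      (fun x => v x - u x) (fun x => dv x - du x) eta); auto.
    - intros t _. apply Hq0; auto. eapply between_dist; [apply Hxi'; auto| |]; auto.
    - intros t _. now apply dpl_minus.
    - intros t _. eapply dpl_eq; [apply dpl_minus; auto|].
      destruct (Hxi' nu (u t) (v t) Hnu) as [H _]. lra.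
    - lra.
    - lra. }
  assert (Hcont : forall mu, O mu -> luc (nbhd mu) psi (psi mu) /\ luc (nbhd mu) dpsi (dpsi mu)).
  { intros mu Hmu.
    assert (Hf : luc (nbhd mu) (fun nu x => g nu (psi mu x)) (fun x => g mu (psi mu x))).
    { apply (luc_comp (nbhd mu) g mu (fun nu => nu) (fun _ => psi mu)); auto using nbhd_near.
      - intros x. eapply dpl_cont, (proj1 (Hpsi mu Hmu)).
      - apply (luc_const (nbhd mu)). }
    assert (HH : forall eps, 0 < eps -> nbhd mu (fun nu => forall x,
       Rabs (psi nu x - psi mu x) < eps /\ Rabs (dpsi nu x - dpsi mu x) < eps)).
    { intros eps He. set (eta := eps / (2 * C)).
      assert (Heta : 0 < eta) by (apply Rdiv_lt_0_compat; lra).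
      assert (HCe : C * eta = eps / 2) by (unfold eta; field; lra).
      eapply filter_imp; [|apply (filter_and _ _ (open_nbhd O mu HOo Hmu) (Hf l eta Heta))].
      intros nu [Hnu Hn] x.
      destruct (Hpsi mu Hmu) as [A1 A2]. destruct (Hpsi nu Hnu) as [B1 B2].
      destruct (Hdiff mu nu (psi mu) (dpsi mu) (psi nu) (dpsi nu) eta Hmu Hnu A1 B1 A2 B2) with (x := x) as [E1 E2].
      - lra.
      - intros t Ht. left. apply Hn. rewrite Rabs_right; lra.
      - lra. }
    split; intros r eps He; (eapply filter_imp; [|apply (HH eps He)]); intros nu H x _; apply H. }
  (* The solutions were picked by choice, so the value at [mu0] is not [phi] by construction; the
     comparison with [eta = 0] gives uniqueness near [phi]. *)
  assert (Hpsi0 : forall x, psi mu0 x = phi x).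
  { intros x. destruct (Hpsi mu0 HO0) as [A1 A2].
    destruct (Hdiff mu0 mu0 phi dphi (psi mu0) (dpsi mu0) 0 HO0 HO0 HF A1) with (x := x) as [E _]; auto.
    - intros t. rewrite Rminus_diag, Rabs_R0. lra.
    - lra.
    - intros t _. rewrite Rminus_diag, Rabs_R0. lra.
    - rewrite Rmult_0_r in E. pose proof (Rabs_pos (psi mu0 x - phi x)).
      apply Rminus_diag_uniq. apply Rabs_eq_0. lra. }
  assert (Hqb : forall mu, O mu -> exists M, forall x, Rabs (g' mu (psi mu x)) <= M).
  { intros mu HU. apply (HbdG mu (psi mu) (K + rho)); auto. intros x.
    replace (psi mu x) with ((psi mu x - phi x) + phi x) by ring.
    eapply Rle_trans; [apply Rabs_triang|]. pose proof (proj2 (Hpsi mu HU) x). specialize (HphiK x). lra. }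
  assert (Hode : forall mu, O mu -> (forall x, dpl (psi mu) x (dpsi mu x)) /\
     (forall x, dpl (dpsi mu) x (g mu (psi mu x)))).
  { intros mu HU. destruct (proj1 (Hpsi mu HU)) as [A1 [A2 _]]; auto. }
  (* If both Neumann conditions held, the stability estimate without source would force
     [y 0 = 0]. *)
  assert (Hnd : forall mu, O mu -> forall y dy, (forall x, dpl y x (dy x)) ->
     (forall x, dpl dy x (g' mu (psi mu x) * y x)) -> y 0 = 1 -> dy 0 = 0 -> dy l <> 0).
  { intros mu HU y dy A1 A2 A3 A4 A5.
    destruct (Hst (fun x => g' mu (psi mu x)) (fun _ => 0) y dy 0) with (x := 0) as [E _]; auto; try lra.
    - intros x _. apply Hq0; auto. apply Hpsi; auto.
    - intros x _. rewrite Rabs_R0. lra.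
    - intros x _. eapply dpl_eq; [apply A2|ring].
    - rewrite A3, Rmult_0_r, Rabs_R1 in E. lra. }
  assert (Hder : forall mu i Dgi w dw, O mu ->
     (forall nu u, P nu -> dpl (fun t => g (upd nu i t) u) (nu i) (Dgi nu u)) ->
     (forall u, jcont_at Dgi mu u) ->
     (forall x, dpl w x (dw x)) -> (forall x, dpl dw x (g' mu (psi mu x) * w x + Dgi mu (psi mu x))) ->
     dw 0 = 0 -> dw l = 0 -> forall x,
     dpl (fun t => psi (upd mu i t) x) (mu i) (w x) /\ dpl (fun t => dpsi (upd mu i t) x) (mu i) (dw x)).
  { intros mu i Dgi w dw HU HDg CDg W1 W2 W3 W4.
    set (mh := fun h => upd mu i (mu i + h)).
    set (q := fun h x => g' (mh h) (xi (mh h) (psi mu x) (psi (mh h) x))).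
    set (r := fun h x => (g (mh h) (psi mu x) - g mu (psi mu x)) / h).
    set (wh := fun h x => (psi (mh h) x - psi mu x) / h).
    set (dwh := fun h x => (dpsi (mh h) x - dpsi mu x) / h).
    assert (HpO : punct0 (fun h => O (mh h))) by (apply open_punct; auto).
    assert (HpN : forall d, 0 < d -> punct0 (fun h => near mu d (mh h))) by (intros; now apply near_upd_plus).
    assert (Cpsi : forall x, continuity_pt (psi mu) x).
    { intros x. eapply dpl_cont, Hode; auto. }
    assert (Hluc_psi : luc punct0 (fun h => psi (mh h)) (psi mu)).
    { intros rr eps He. destruct (proj1 (Hcont mu HU) rr eps He) as [d [Hd Hd']].
      eapply filter_imp; [|apply (HpN d Hd)]. intros h Hh. auto. }
    assert (Hq : luc punct0 q (fun x => g' mu (psi mu x))).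
    { apply (luc_comp punct0 g' mu mh (fun h x => xi (mh h) (psi mu x) (psi (mh h) x)) (psi mu)); auto.
      apply (luc_between punct0 (fun h => psi (mh h))); auto.
      eapply filter_imp; [|apply HpO]. intros h Hh x. apply Hxi'; auto. }
    assert (Hr : luc punct0 r (fun x => Dgi mu (psi mu x))).
    { apply (luc_precomp punct0 (fun h u => (g (mh h) u - g mu u) / h) (Dgi mu) (psi mu)); auto.
      apply (diff_quot_luc P); auto. }
    assert (Hwh : punct0 (fun h => (forall x, dpl (wh h) x (dwh h x)) /\
       (forall x, dpl (dwh h) x (q h x * wh h x + r h x)))).
    { eapply filter_imp; [|apply (filter_and _ _ HpO punct0_nonzero)]. cbv beta. intros h [Hh Hh0].
      destruct (Hode mu HU) as [A1 A2]. destruct (Hode (mh h) Hh) as [B1 B2]. split; intros x.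
      - unfold wh, dwh, Rdiv. specialize (A1 x). specialize (B1 x). der. field; auto.
      - unfold wh, dwh, Rdiv. specialize (A2 x). specialize (B2 x). der.
        destruct (Hxi' (mh h) (psi mu x) (psi (mh h) x) Hh) as [E _]. unfold q, r.
        replace (g (mh h) (psi (mh h) x)) with (g (mh h) (psi mu x) + g' (mh h) (xi (mh h) (psi mu x) (psi (mh h) x)) * (psi (mh h) x - psi mu x)) by lra.
        field; auto. }
    assert (Hbd : punct0 (fun h => dwh h 0 = 0 /\ dwh h l = 0)).
    { eapply filter_imp; [|apply HpO]. intros h Hh. unfold dwh.
      destruct (proj1 (Hpsi mu HU)) as [A1 [_ [A3 A4]]]. destruct (proj1 (Hpsi (mh h) Hh)) as [B1 [_ [B3 B4]]].
      destruct (even_deriv_half L _ _ A1 A3 A4) as [a0 al]. destruct (even_deriv_half L _ _ B1 B3 B4) as [b0 bl].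
      fold l in al, bl. rewrite a0, al, b0, bl. unfold Rdiv. split; ring. }
    assert (Cw : forall x, continuity_pt w x) by (intros x; eapply dpl_cont, W1).
    assert (Cq0 : forall x, continuity_pt (fun x => g' mu (psi mu x)) x).
    { intros x. apply (continuity_pt_comp (psi mu) (g' mu)); auto. apply jcont_at_cont; auto. }
    assert (Hf : luc punct0 (fun h x => q h x * w x + r h x) (fun x => g' mu (psi mu x) * w x + Dgi mu (psi mu x))).
    { apply (luc_plus punct0); auto. apply (luc_mult punct0); auto. apply (luc_const punct0). }
    (* The initial value of the quotient is not prescribed, only its derivative at both ends. The
       Neumann estimate for [wh h - w] supplies the limit at 0, and the initial value problem then
       carries it to every [x]. *)
    assert (Hwh0 : tends punct0 (fun h => wh h 0) (w 0)).
    { intros eps He. set (eta := eps / (2 * C)).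
      assert (Heta : 0 < eta) by (apply Rdiv_lt_0_compat; lra).
      assert (HCe : C * eta = eps / 2) by (unfold eta; field; lra).
      eapply filter_imp; [|apply (filter_and _ _ (filter_and _ _ HpO Hwh) (filter_and _ _ Hbd (Hf l eta Heta)))].
      intros h [[Hh [D1 D2]] [[B1 B2] Hfh]].
      destruct (Hst (q h) (fun x => q h x * w x + r h x - (g' mu (psi mu x) * w x + Dgi mu (psi mu x)))
        (fun x => wh h x - w x) (fun x => dwh h x - dw x) eta) with (x := 0) as [E _]; try lra.
      - intros x _. unfold q. apply Hq0; auto. eapply between_dist; [apply Hxi'; auto| |]; apply Hpsi; auto.
      - intros x Hx. left. apply Hfh. rewrite Rabs_right; lra.
      - intros x _. now apply dpl_minus.
      - intros x _. eapply dpl_eq; [apply dpl_minus; auto|]. ring. }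
    destruct (linear_ivp_luc punct0 wh dwh q r w dw (fun x => g' mu (psi mu x)) (fun x => Dgi mu (psi mu x)))
      as [L1 L2]; auto.
    - intros eps He. eapply filter_imp; [|apply Hbd]. cbv beta. intros h [-> _]. rewrite W3, Rminus_diag, Rabs_R0. auto.
    - intros x. split; apply dpl_of_tends; rewrite upd_same;
        [exact (luc_tends punct0 _ _ x L1)|exact (luc_tends punct0 _ _ x L2)]. }
  exists O, psi, dpsi. repeat split; auto; try (apply Hpsi; auto).
  intros k. cut (Cj k O psi /\ Cj k O dpsi); [tauto|]. induction k as [|k [IH1 IH2]].
  - split; split; auto; intros mu x HU; apply luc_jcont; try apply Hcont; auto;
      intros t; eapply dpl_cont, Hode; auto.
  - apply (smooth_step k P O g g' psi dpsi l); auto.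
Qed.

(** * Dimensions of spans *)

Lemma fsum_ext k h h' : (forall i, (i < k)%nat -> h i = h' i) -> fsum k h = fsum k h'.
Proof. induction k; intros H; simpl; auto. rewrite IHk, H; auto. Qed.

Lemma fsum_zero k h : (forall i, (i < k)%nat -> h i = 0) -> fsum k h = 0.
Proof. induction k; intros H; simpl; auto. rewrite IHk, H; auto. ring. Qed.

Lemma fsum_plus k h h' : fsum k (fun i => h i + h' i) = fsum k h + fsum k h'.
Proof. induction k; simpl; [ring|rewrite IHk; ring]. Qed.

Lemma fsum_scal k a h : fsum k (fun i => a * h i) = a * fsum k h.
Proof. induction k; simpl; [ring|rewrite IHk; ring]. Qed.

Lemma fsum_exchange k m h : fsum k (fun i => fsum m (fun j => h i j)) = fsum m (fun j => fsum k (fun i => h i j)).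
Proof.
  induction k; simpl.
  - symmetry. now apply fsum_zero.
  - rewrite IHk. now rewrite fsum_plus.
Qed.

Lemma fsum_app a b h : fsum (a + b) h = fsum a h + fsum b (fun j => h (a + j)%nat).
Proof.
  induction b; simpl.
  - rewrite Nat.add_0_r. ring.
  - rewrite Nat.add_succ_r. simpl. rewrite IHb. ring.
Qed.

Lemma fsum_delta k j a : (j < k)%nat -> fsum k (fun i => (if Nat.eq_dec i j then 1 else 0) * a i) = a j.
Proof.
  induction k; intros Hj; [lia|]. simpl. destruct (Nat.eq_dec k j) as [->|hne].
  - rewrite fsum_zero; [ring|]. intros i Hi. destruct (Nat.eq_dec i j); [lia|ring].
  - rewrite IHk; [ring|lia].
Qed.

(** The increasing enumeration of the indices different from [p], used to delete the pivot row. *)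
Definition skip (p i : nat) : nat := if (i <? p)%nat then i else S i.

Lemma fsum_skip k p h : (p <= k)%nat -> fsum (S k) h = fsum k (fun i => h (skip p i)) + h p.
Proof.
  induction k; intros Hp.
  - assert (p = O) as -> by lia. reflexivity.
  - destruct (Nat.eq_dec p (S k)) as [->|hne].
    + change (fsum (S (S k)) h) with (fsum (S k) h + h (S k)). f_equal.
      apply fsum_ext. intros i Hi. unfold skip. destruct (Nat.ltb_spec i (S k)); auto. lia.
    + change (fsum (S (S k)) h) with (fsum (S k) h + h (S k)). rewrite IHk by lia. simpl.
      unfold skip at 3. destruct (Nat.ltb_spec k p); [lia|]. ring.
Qed.

(** Gaussian elimination on column [d]. A row [p] with nonzero entry there is subtracted from the
    others, leaving one row and one column fewer; if there is none, the first [S d] rows already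
    satisfy the condition on that column. *)
Lemma linear_dependence d (A : nat -> nat -> R) : exists c : nat -> R,
  (exists i, (i < S d)%nat /\ c i <> 0) /\ forall j, (j < d)%nat -> fsum (S d) (fun i => c i * A i j) = 0.
Proof.
  revert A. induction d; intros A.
  - exists (fun _ => 1). split; [exists O; split; [lia|lra]|]. intros; lia.
  - destruct (classic (exists p, (p < S (S d))%nat /\ A p d <> 0)) as [[p [Hp Hpd]]|Hall].
    + destruct (IHd (fun i j => A (skip p i) j - A (skip p i) d / A p d * A p j)) as [c' [[i0 [Hi0 Hc0]] Hc']].
      (* The coefficient of the pivot row is dictated by the equation for column [d]. *)
      set (t := - (fsum (S d) (fun i => c' i * A (skip p i) d) / A p d)).
      set (c := fun i => if Nat.eq_dec i p then t else if (i <? p)%nat then c' i else c' (pred i)).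
      assert (Hcs : forall i, c (skip p i) = c' i).
      { intros i. unfold c, skip. destruct (Nat.ltb_spec i p).
        - destruct (Nat.eq_dec i p); [lia|]. destruct (Nat.ltb_spec i p); auto; lia.
        - destruct (Nat.eq_dec (S i) p); [lia|]. destruct (Nat.ltb_spec (S i) p); auto; lia. }
      assert (Hcp : c p = t) by (unfold c; destruct (Nat.eq_dec p p); congruence).
      exists c. split.
      * exists (skip p i0). rewrite Hcs. split; auto. unfold skip. destruct (Nat.ltb_spec i0 p); lia.
      * intros j Hj. rewrite (fsum_skip (S d) p) by lia. rewrite Hcp.
        rewrite (fsum_ext (S d) _ (fun i => c' i * A (skip p i) j)) by (intros; now rewrite Hcs).
        destruct (Nat.eq_dec j d) as [->|hne].
        -- unfold t. field. auto.
        -- specialize (Hc' j ltac:(lia)).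
           rewrite (fsum_ext (S d) _ (fun i => c' i * A (skip p i) j + - (A p j / A p d) * (c' i * A (skip p i) d))) in Hc'
             by (intros; field; auto).
           rewrite fsum_plus, fsum_scal in Hc'. unfold t.
           replace (fsum (S d) (fun i => c' i * A (skip p i) j)) with
             (A p j / A p d * fsum (S d) (fun i => c' i * A (skip p i) d)) by lra.
           field. auto.
    + destruct (IHd A) as [c [[i0 [Hi0 Hc0]] Hc]].
      exists (fun i => if Nat.eq_dec i (S d) then 0 else c i). split.
      * exists i0. split; [lia|]. destruct (Nat.eq_dec i0 (S d)); [lia|auto].
      * intros j Hj. destruct (Nat.eq_dec j d) as [->|hne].
        -- apply fsum_zero. intros i Hi. replace (A i d) with 0; [ring|].
           apply NNPP. intros H. apply Hall. exists i. split; auto.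
        -- change (fsum (S (S d)) ?h) with (fsum (S d) h + h (S d)). cbv beta.
           destruct (Nat.eq_dec (S d) (S d)); [|congruence].
           rewrite (fsum_ext (S d) _ (fun i => c i * A i j)).
           ++ rewrite Hc; [ring|lia].
           ++ intros i Hi. destruct (Nat.eq_dec i (S d)); [lia|auto].
Qed.

Definition in_span (d : nat) (e : nat -> R -> R) (f : R -> R) : Prop :=
  exists c, forall x, f x = fsum d (fun i => c i * e i x).

Lemma in_span_basis d e j : (j < d)%nat -> in_span d e (e j).
Proof.
  intros Hj. exists (fun i => if Nat.eq_dec i j then 1 else 0). intros x.
  now rewrite (fsum_delta d j (fun i => e i x)).
Qed.

Lemma in_span_comb d e a b f g h : in_span d e f -> in_span d e g ->
  (forall x, h x = a * f x + b * g x) -> in_span d e h.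
Proof.
  intros [c Hc] [c' Hc'] Hh. exists (fun i => a * c i + b * c' i). intros x.
  rewrite (fsum_ext d _ (fun i => a * (c i * e i x) + b * (c' i * e i x))) by (intros; ring).
  now rewrite fsum_plus, !fsum_scal, <- Hc, <- Hc'.
Qed.

Lemma in_span_zero d e f : (forall x, f x = 0) -> in_span d e f.
Proof. intros H. exists (fun _ => 0). intros x. rewrite H, fsum_zero; auto. intros; ring. Qed.

(** For the upper bound, [S d] elements are expanded in the basis; their coefficient rows have only
    [d] entries and hence satisfy a nontrivial relation. *)
Lemma has_dim_of_basis (V : (R -> R) -> Prop) d e :
  (forall i, (i < d)%nat -> V (e i)) -> lin_indep d e -> (forall f, V f -> in_span d e f) -> has_dim V d.
Proof.
  intros He Hi Hs. split; [now exists e|]. intros fs Hfs Hind.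
  assert (HA : forall i, exists c : nat -> R, (i < S d)%nat -> forall x, fs i x = fsum d (fun j => c j * e j x)).
  { intros i. destruct (Nat.lt_ge_cases i (S d)) as [h|h].
    - destruct (Hs (fs i) (Hfs i h)) as [c Hc]. now exists c.
    - exists (fun _ => 0). lia. }
  pose (A := fun i => proj1_sig (constructive_indefinite_description _ (HA i))).
  assert (HA' : forall i, (i < S d)%nat -> forall x, fs i x = fsum d (fun j => A i j * e j x)).
  { intros i. unfold A. destruct (constructive_indefinite_description _ _); auto. }
  destruct (linear_dependence d A) as [c [[i0 [Hi0 Hc0]] Hc]].
  apply Hc0. apply Hind; auto. intros x.
  rewrite (fsum_ext (S d) _ (fun i => fsum d (fun j => c i * A i j * e j x))).
  - rewrite fsum_exchange. apply fsum_zero. intros j Hj.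
    rewrite (fsum_ext (S d) _ (fun i => e j x * (c i * A i j))) by (intros; ring).
    rewrite fsum_scal, Hc; auto. ring.
  - intros i Hi'. rewrite HA' by auto. rewrite <- fsum_scal. apply fsum_ext. intros; ring.
Qed.

Lemma dpl_fsum k (c : nat -> R) (f df : nat -> R -> R) x :
  (forall i, (i < k)%nat -> dpl (f i) x (df i x)) ->
  dpl (fun t => fsum k (fun i => c i * f i t)) x (fsum k (fun i => c i * df i x)).
Proof.
  intros H. induction k; simpl; [apply dpl_const|].
  apply dpl_plus; [apply IHk; auto|]. specialize (H k (le_n _)). der. ring.
Qed.

Lemma dpl_zero_fun f df : (forall x, f x = 0) -> (forall x, dpl f x (df x)) -> forall x, df x = 0.
Proof.
  intros H Hd x. apply (uniqueness_limite f x); auto. apply dpl_ext with (fun _ => 0); auto using dpl_const.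
Qed.

(** * Hill's equation with an even potential *)

Definition hill_sol (Q : R -> R) (lam : R) (y dy : R -> R) : Prop :=
  (forall x, dpl y x (dy x)) /\ (forall x, dpl dy x ((Q x - lam) * y x)).

Lemma eigen_eq_hill Q L lam f : eigen_eq Q L lam f <-> periodic L f /\ exists df, hill_sol Q lam f df.
Proof.
  split.
  - intros [Hp [f' [f'' [H1 [H2 H3]]]]]. split; auto. exists f'. split; auto.
    intros x. eapply dpl_eq; [apply H2|]. specialize (H3 x). lra.
  - intros [Hp [df [H1 H2]]]. split; auto. exists df, (fun x => (Q x - lam) * f x).
    repeat split; auto. intros x; ring.
Qed.

Lemma hill_zero Q M lam y dy x0 : (forall x, Rabs (Q x) <= M) -> hill_sol Q lam y dy ->
  y x0 = 0 -> dy x0 = 0 -> forall x, y x = 0 /\ dy x = 0.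
Proof.
  intros HM [H1 H2]. apply (energy_zero y dy (fun x => (Q x - lam) * y x) x0 (M + Rabs lam)); auto.
  - specialize (HM 0). pose proof (Rabs_pos (Q 0)). pose proof (Rabs_pos lam). lra.
  - intros x. rewrite Rabs_mult. apply Rmult_le_compat_r; [apply Rabs_pos|].
    eapply Rle_trans; [apply Rabs_triang|]. rewrite Rabs_Ropp. specialize (HM x). lra.
Qed.

Lemma hill_comb Q lam a b y dy z dz : hill_sol Q lam y dy -> hill_sol Q lam z dz ->
  hill_sol Q lam (fun x => a * y x + b * z x) (fun x => a * dy x + b * dz x).
Proof.
  intros [A1 A2] [B1 B2]. split; intros x.
  - specialize (A1 x). specialize (B1 x). der. ring.
  - specialize (A2 x). specialize (B2 x). der. ring.
Qed.

Lemma hill_reflect Q lam y dy c : (forall x, Q (c - x) = Q x) -> hill_sol Q lam y dy ->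
  hill_sol Q lam (fun x => y (c - x)) (fun x => - dy (c - x)).
Proof.
  intros HQ [A1 A2]. split; intros x.
  - now apply dpl_reflect.
  - eapply dpl_eq; [apply dpl_opp, dpl_reflect, A2|]. rewrite HQ. ring.
Qed.

(** The difference of [y] and its reflection is a solution with zero Cauchy data at [c]. *)
Lemma hill_symmetric Q M lam y dy c : (forall x, Rabs (Q x) <= M) -> (forall x, Q (2 * c - x) = Q x) ->
  hill_sol Q lam y dy -> dy c = 0 -> forall x, y (2 * c - x) = y x.
Proof.
  intros HM HQ Hy Hc x.
  pose proof (hill_comb Q lam 1 (-1) _ _ _ _ Hy (hill_reflect Q lam y dy (2 * c) HQ Hy)) as H.
  destruct (hill_zero Q M lam _ _ c HM H) with (x := x) as [E _].
  - replace (2 * c - c) with c by ring. ring.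
  - replace (2 * c - c) with c by ring. rewrite Hc. ring.
  - lra.
Qed.

Lemma hill_antisymmetric Q M lam y dy c : (forall x, Rabs (Q x) <= M) -> (forall x, Q (2 * c - x) = Q x) ->
  hill_sol Q lam y dy -> y c = 0 -> forall x, y (2 * c - x) = - y x.
Proof.
  intros HM HQ Hy Hc x.
  pose proof (hill_comb Q lam 1 1 _ _ _ _ Hy (hill_reflect Q lam y dy (2 * c) HQ Hy)) as H.
  destruct (hill_zero Q M lam _ _ c HM H) with (x := x) as [E _].
  - replace (2 * c - c) with c by ring. rewrite Hc. ring.
  - replace (2 * c - c) with c by ring. ring.
  - lra.
Qed.

Lemma even_reflect Q : even Q -> forall x, Q (2 * 0 - x) = Q x.
Proof. intros H x. replace (2 * 0 - x) with (- x) by ring. apply H. Qed.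

Lemma even_periodic_reflect L Q : even Q -> periodic L Q -> forall x, Q (2 * (L / 2) - x) = Q x.
Proof. intros H Hp x. replace (2 * (L / 2) - x) with (- x + L) by field. now rewrite Hp. Qed.

Lemma neumann_even Q M lam y dy : (forall x, Rabs (Q x) <= M) -> even Q ->
  hill_sol Q lam y dy -> dy 0 = 0 -> even y.
Proof.
  intros HM HQ Hy H0 x. rewrite <- (hill_symmetric Q M lam y dy 0 HM (even_reflect Q HQ) Hy H0 x). f_equal; ring.
Qed.

Lemma dirichlet_odd Q M lam y dy : (forall x, Rabs (Q x) <= M) -> even Q ->
  hill_sol Q lam y dy -> y 0 = 0 -> forall x, y (- x) = - y x.
Proof.
  intros HM HQ Hy H0 x. rewrite <- (hill_antisymmetric Q M lam y dy 0 HM (even_reflect Q HQ) Hy H0 x). f_equal; ring.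
Qed.

(** Symmetry about 0 and about [L / 2] composes to translation by [L]. *)
Lemma neumann_periodic Q M L lam y dy : (forall x, Rabs (Q x) <= M) -> even Q -> periodic L Q ->
  hill_sol Q lam y dy -> dy 0 = 0 -> dy (L / 2) = 0 -> periodic L y.
Proof.
  intros HM HQ HP Hy H0 Hl x. pose proof (neumann_even Q M lam y dy HM HQ Hy H0) as He.
  rewrite <- (hill_symmetric Q M lam y dy (L / 2) HM (even_periodic_reflect L Q HQ HP) Hy Hl (x + L)), <- (He x).
  f_equal; field.
Qed.

Lemma dirichlet_periodic Q M L lam y dy : (forall x, Rabs (Q x) <= M) -> even Q -> periodic L Q ->
  hill_sol Q lam y dy -> y 0 = 0 -> y (L / 2) = 0 -> periodic L y.
Proof.
  intros HM HQ HP Hy H0 Hl x. pose proof (dirichlet_odd Q M lam y dy HM HQ Hy H0) as He.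
  pose proof (hill_antisymmetric Q M lam y dy (L / 2) HM (even_periodic_reflect L Q HQ HP) Hy Hl (x + L)) as H.
  replace (2 * (L / 2) - (x + L)) with (- x) in H by field. rewrite He in H. lra.
Qed.

(** The terms in [y1] and [y2] are the even and the odd part of [f]. Each part is periodic by
    itself, since reflection preserves periodicity, and this forces its boundary condition at
    [L / 2]. *)
Lemma eigen_decomposition Q M L lam f df y1 dy1 y2 dy2 : (forall x, Rabs (Q x) <= M) -> even Q -> 
  hill_sol Q lam y1 dy1 -> y1 0 = 1 -> dy1 0 = 0 -> hill_sol Q lam y2 dy2 -> y2 0 = 0 -> dy2 0 = 1 ->
  periodic L f -> hill_sol Q lam f df ->
  (forall x, f x = f 0 * y1 x + df 0 * y2 x) /\ f 0 * dy1 (L / 2) = 0 /\ df 0 * y2 (L / 2) = 0.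
Proof.
  intros HM HQ H1 A1 A2 H2 B1 B2 HP Hf.
  assert (HE : forall x, f x = f 0 * y1 x + df 0 * y2 x).
  { pose proof (hill_comb Q lam 1 (-1) _ _ _ _ Hf (hill_comb Q lam (f 0) (df 0) _ _ _ _ H1 H2)) as H.
    intros x. destruct (hill_zero Q M lam _ _ 0 HM H) with (x := x) as [E _].
    - rewrite A1, B1. ring.
    - rewrite A2, B2. ring.
    - lra. }
  pose proof (neumann_even Q M lam y1 dy1 HM HQ H1 A2) as Ev.
  pose proof (dirichlet_odd Q M lam y2 dy2 HM HQ H2 B1) as Od.
  assert (HPm : forall x, f (- (x + L)) = f (- x)).
  { intros x. rewrite <- (HP (- (x + L))). f_equal; ring. }
  split; auto. split.
  - destruct (even_deriv_half L (fun x => f 0 * y1 x) (fun x => f 0 * dy1 x)) as [_ E]; auto.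
    + intros x. destruct H1 as [D1 _]. specialize (D1 x). der. ring.
    + intros x. pose proof (HPm x) as P1. rewrite (HE (- (x + L))), (HE (- x)), !Ev, !Od in P1.
      pose proof (HP x) as P2. rewrite (HE (x + L)), (HE x) in P2. lra.
    + intros x. now rewrite Ev.
  - apply (odd_periodic_half L (fun x => df 0 * y2 x)).
    + intros x. pose proof (HPm x) as P1. rewrite (HE (- (x + L))), (HE (- x)), !Ev, !Od in P1.
      pose proof (HP x) as P2. rewrite (HE (x + L)), (HE x) in P2. lra.
    + intros x. rewrite Od. ring.
Qed.

(* Applying [-d^2 + Q - lam k] kills the last term of a vanishing combination. *)
Lemma eigen_lin_indep Q k (lam : nat -> R) (f df : nat -> R -> R) :
  (forall i, (i < k)%nat -> hill_sol Q (lam i) (f i) (df i)) ->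
  (forall i, (i < k)%nat -> exists x, f i x <> 0) ->
  (forall i j, (i < j)%nat -> (j < k)%nat -> lam i <> lam j) -> lin_indep k f.
Proof.
  induction k; intros Hf Hn Hl c Hc; [intros; lia|].
  assert (H1 : forall x, fsum (S k) (fun i => c i * df i x) = 0).
  { apply (dpl_zero_fun _ _ Hc). intros x. apply dpl_fsum. intros i Hi. now apply Hf. }
  assert (H2 : forall x, fsum (S k) (fun i => c i * ((Q x - lam i) * f i x)) = 0).
  { apply (dpl_zero_fun _ (fun x => fsum (S k) (fun i => c i * ((Q x - lam i) * f i x))) H1). intros x.
    apply (dpl_fsum (S k) c df (fun i x => (Q x - lam i) * f i x)). intros i Hi. now apply Hf. }
  assert (IH : lin_indep k f) by (apply IHk; intros; first [apply Hf | apply Hn | apply Hl]; lia).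
  assert (Hk : forall i, (i < k)%nat -> c i = 0).
  { intros i Hi. assert (H3 : c i * (lam i - lam k) = 0).
    - apply (IH (fun i => c i * (lam i - lam k))); auto. intros x.
      specialize (Hc x). specialize (H2 x).
      assert (E : fsum (S k) (fun i => (Q x - lam k) * (c i * f i x) + -1 * (c i * ((Q x - lam i) * f i x))) = 0).
      { rewrite fsum_plus, !fsum_scal, Hc, H2. ring. }
      simpl in E. rewrite <- E.
      rewrite (fsum_ext k _ (fun i => (Q x - lam k) * (c i * f i x) + -1 * (c i * ((Q x - lam i) * f i x))))
        by (intros; ring). ring.
    - specialize (Hl i k Hi (le_n _)). apply Rmult_integral in H3. destruct H3; auto. lra. }
  intros i Hi. destruct (Nat.eq_dec i k) as [->|hne]; [|apply Hk; lia].
  destruct (Hn k (le_n _)) as [x Hx]. specialize (Hc x). simpl in Hc.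
  rewrite fsum_zero in Hc.
  - rewrite Rplus_0_l in Hc. apply Rmult_integral in Hc. tauto.
  - intros j Hj. rewrite Hk; auto. ring.
Qed.

(** A number lying in both lists is rightly counted twice, since its even and its odd eigenfunction
    are independent. *)
Lemma in_neg_has_dim Q M L (lN lD : list R) (Y1 dY1 Y2 dY2 : R -> R -> R) :
  (forall x, Rabs (Q x) <= M) -> even Q -> periodic L Q ->
  (forall lam, hill_sol Q lam (Y1 lam) (dY1 lam) /\ Y1 lam 0 = 1 /\ dY1 lam 0 = 0) ->
  (forall lam, hill_sol Q lam (Y2 lam) (dY2 lam) /\ Y2 lam 0 = 0 /\ dY2 lam 0 = 1) ->
  NoDup lN -> NoDup lD ->
  (forall lam, In lam lN <-> lam < 0 /\ dY1 lam (L / 2) = 0) ->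
  (forall lam, In lam lD <-> lam < 0 /\ Y2 lam (L / 2) = 0) ->
  has_dim (in_neg Q L) (length lN + length lD).
Proof.
  intros HM HQ HP H1 H2 ND1 ND2 HN HD.
  set (a := length lN). set (b := length lD).
  set (e := fun i => if (i <? a)%nat then Y1 (nth i lN 0) else Y2 (nth (i - a) lD 0)).
  assert (HeN : forall i, (i < a)%nat -> e i = Y1 (nth i lN 0)).
  { intros i Hi. unfold e. destruct (Nat.ltb_spec i a); auto; lia. }
  assert (HeD : forall j, e (a + j)%nat = Y2 (nth j lD 0)).
  { intros j. unfold e. destruct (Nat.ltb_spec (a + j) a); [lia|]. f_equal. f_equal. lia. }
  assert (HinN : forall i, (i < a)%nat -> In (nth i lN 0) lN) by (intros; now apply nth_In).
  assert (HinD : forall i, (i < b)%nat -> In (nth i lD 0) lD) by (intros; now apply nth_In).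
  apply has_dim_of_basis with e.
  - intros i Hi. exists 1%nat, (fun _ => 1).
    destruct (Nat.lt_ge_cases i a) as [h|h].
    + exists (fun _ => nth i lN 0), (fun _ => Y1 (nth i lN 0)). split.
      * intros _ _. pose proof (proj1 (HN _) (HinN i h)) as [E1 E2]. split; auto.
        destruct (H1 (nth i lN 0)) as [S1 [S2 S3]].
        apply eigen_eq_hill. split; [|eauto]. eapply neumann_periodic; eauto.
      * intros x. rewrite HeN by auto. simpl. ring.
    + replace i with (a + (i - a))%nat by lia. set (j := (i - a)%nat). assert (Hj : (j < b)%nat) by (unfold j; lia).
      exists (fun _ => nth j lD 0), (fun _ => Y2 (nth j lD 0)). split.
      * intros _ _. pose proof (proj1 (HD _) (HinD j Hj)) as [E1 E2]. split; auto.
        destruct (H2 (nth j lD 0)) as [S1 [S2 S3]].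
        apply eigen_eq_hill. split; [|eauto]. eapply dirichlet_periodic; eauto.
      * intros x. rewrite HeD. simpl. ring.
  - intros c Hc.
    assert (Hc' : forall x, fsum a (fun i => c i * Y1 (nth i lN 0) x) + fsum b (fun j => c (a + j)%nat * Y2 (nth j lD 0) x) = 0).
    { intros x. etransitivity; [|apply (Hc x)]. rewrite fsum_app. f_equal.
      - apply fsum_ext. intros i Hi. now rewrite HeN.
      - apply fsum_ext. intros j Hj. now rewrite HeD. }
    (* Evaluating the relation at [x] and at [- x] separates the even and the odd combination;
       within each, the eigenvalues are distinct. *)
    assert (Hm : forall x, fsum a (fun i => c i * Y1 (nth i lN 0) (- x)) = fsum a (fun i => c i * Y1 (nth i lN 0) x)).
    { intros x. apply fsum_ext. intros i Hi. f_equal. destruct (H1 (nth i lN 0)) as [S1 [S2 S3]].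
      apply (neumann_even Q M _ _ _ HM HQ S1 S3). }
    assert (Hm2 : forall x, fsum b (fun j => c (a + j)%nat * Y2 (nth j lD 0) (- x)) =
       -1 * fsum b (fun j => c (a + j)%nat * Y2 (nth j lD 0) x)).
    { intros x. rewrite <- fsum_scal. apply fsum_ext. intros j Hj. destruct (H2 (nth j lD 0)) as [S1 [S2 S3]].
      rewrite (dirichlet_odd Q M _ _ _ HM HQ S1 S2). ring. }
    assert (HcN : forall i, (i < a)%nat -> c i = 0).
    { apply (eigen_lin_indep Q a (fun i => nth i lN 0) (fun i => Y1 (nth i lN 0)) (fun i => dY1 (nth i lN 0))).
      - intros i _. apply H1.
      - intros i _. exists 0. destruct (H1 (nth i lN 0)) as [_ [-> _]]. lra.
      - intros i j Hij Hj E. apply (proj1 (NoDup_nth lN 0) ND1) in E; [lia| |]; fold a; lia.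
      - intros x. pose proof (Hc' x). pose proof (Hc' (- x)) as Hx. rewrite Hm, Hm2 in Hx. lra. }
    assert (HcD : forall j, (j < b)%nat -> c (a + j)%nat = 0).
    { apply (eigen_lin_indep Q b (fun i => nth i lD 0) (fun i => Y2 (nth i lD 0)) (fun i => dY2 (nth i lD 0))).
      - intros i _. apply H2.
      - intros i _. destruct (H2 (nth i lD 0)) as [S1 [S2 S3]].
        apply not_all_not_ex. intros Hall.
        assert (Hz : forall x, Y2 (nth i lD 0) x = 0) by (intros x; apply NNPP, Hall).
        pose proof (dpl_zero_fun _ _ Hz (proj1 S1) 0). lra.
      - intros i j Hij Hj E. apply (proj1 (NoDup_nth lD 0) ND2) in E; [lia| |]; fold b; lia.
      - intros x. pose proof (Hc' x). pose proof (Hc' (- x)) as Hx. rewrite Hm, Hm2 in Hx. lra. }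
    intros i Hi. destruct (Nat.lt_ge_cases i a) as [h|h]; auto.
    replace i with (a + (i - a))%nat by lia. apply HcD. lia.
  - intros f [k [c [lams [fs [Hfs Hf]]]]].
    assert (Hsp : forall i, (i < k)%nat -> in_span (a + b) e (fs i)).
    { intros i Hi. destruct (Hfs i Hi) as [Hneg Heig]. apply eigen_eq_hill in Heig.
      destruct Heig as [Hper [df Hs]].
      destruct (H1 (lams i)) as [S1 [S2 S3]]. destruct (H2 (lams i)) as [T1 [T2 T3]].
      destruct (eigen_decomposition Q M L (lams i) (fs i) df (Y1 (lams i)) (dY1 (lams i)) (Y2 (lams i)) (dY2 (lams i)))
        as [E1 [E2 E3]]; auto.
      apply (in_span_comb (a + b) e 1 1 (fun x => fs i 0 * Y1 (lams i) x) (fun x => df 0 * Y2 (lams i) x)).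
      - apply Rmult_integral in E2. destruct E2 as [E2|E2].
        + apply in_span_zero. intros x. rewrite E2. ring.
        + destruct (In_nth lN (lams i) 0) as [j [Hj Hj']]; [apply HN; auto|]. fold a in Hj.
          apply (in_span_comb (a + b) e (fs i 0) 0 (e j) (e j)); try (apply in_span_basis; lia).
          intros x. rewrite (HeN j Hj), Hj'. ring.
      - apply Rmult_integral in E3. destruct E3 as [E3|E3].
        + apply in_span_zero. intros x. rewrite E3. ring.
        + destruct (In_nth lD (lams i) 0) as [j [Hj Hj']]; [apply HD; auto|]. fold b in Hj.
          apply (in_span_comb (a + b) e (df 0) 0 (e (a + j)%nat) (e (a + j)%nat)); try (apply in_span_basis; lia).
          intros x. rewrite HeD, Hj'. ring.
      - intros x. rewrite E1. ring. }
    clear Hfs.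
    assert (HG : in_span (a + b) e (fun x => fsum k (fun i => c i * fs i x))).
    { clear Hf. induction k; [apply in_span_zero; auto|].
      apply (in_span_comb (a + b) e 1 (c k) (fun x => fsum k (fun i => c i * fs i x)) (fs k)); auto.
      intros x. simpl. ring. }
    destruct HG as [c' Hc']. exists c'. intros x. rewrite Hf. apply Hc'.
Qed.

(** Without a Neumann solution at 0 the even part of a kernel element vanishes, so the kernel is
    either spanned by the odd solution [y2] or trivial. *)
Lemma in_ker_has_dim Q M L y1 dy1 y2 dy2 :
  (forall x, Rabs (Q x) <= M) -> even Q -> periodic L Q ->
  hill_sol Q 0 y1 dy1 -> y1 0 = 1 -> dy1 0 = 0 -> hill_sol Q 0 y2 dy2 -> y2 0 = 0 -> dy2 0 = 1 ->
  dy1 (L / 2) <> 0 ->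
  (y2 (L / 2) = 0 -> has_dim (in_ker Q L) 1) /\ (y2 (L / 2) <> 0 -> has_dim (in_ker Q L) 0).
Proof.
  intros HM HQ HP H1 A1 A2 H2 B1 B2 Hn.
  assert (HK : forall f, in_ker Q L f -> exists c, (forall x, f x = c * y2 x) /\ c * y2 (L / 2) = 0).
  { intros f Hf. apply eigen_eq_hill in Hf. destruct Hf as [Hper [df Hs]].
    destruct (eigen_decomposition Q M L 0 f df y1 dy1 y2 dy2) as [E1 [E2 E3]]; auto.
    apply Rmult_integral in E2. destruct E2 as [E2|E2]; [|contradiction].
    exists (df 0). split; auto. intros x. rewrite E1, E2. ring. }
  split; intros Hd.
  - apply (has_dim_of_basis _ 1 (fun _ => y2)).
    + intros _ _. apply eigen_eq_hill. split; [|eauto]. eapply dirichlet_periodic; eauto.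
    + apply (eigen_lin_indep Q 1 (fun _ => 0) (fun _ => y2) (fun _ => dy2)); auto.
      * intros _ _. apply not_all_not_ex. intros Hall.
        assert (Hz : forall x, y2 x = 0) by (intros x; apply NNPP, Hall).
        pose proof (dpl_zero_fun _ _ Hz (proj1 H2) 0). lra.
      * intros i j Hij Hj. lia.
    + intros f Hf. destruct (HK f Hf) as [c [Hc _]]. exists (fun _ => c). intros x. simpl. rewrite Hc. ring.
  - apply (has_dim_of_basis _ 0 (fun _ => y2)).
    + intros; lia.
    + intros c _ i Hi. lia.
    + intros f Hf. destruct (HK f Hf) as [c [Hc E]]. apply Rmult_integral in E. destruct E as [->|E]; [|contradiction].
      apply in_span_zero. intros x. rewrite Hc. ring.
Qed.

(** * Stability of the number of zeros *)

Definition zeros_in (f : R -> R) (a b : R) (k : nat) : Prop :=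
  exists l : list R, NoDup l /\ length l = k /\ forall x, In x l <-> a <= x <= b /\ f x = 0.

Definition stable_zeros {n} (D : Rn n -> R -> R) (mu0 : Rn n) (a b : R) : Prop :=
  exists k, nbhd mu0 (fun mu => zeros_in (D mu) a b k).

Lemma zeros_in_none f a b : (forall x, a <= x <= b -> f x <> 0) -> zeros_in f a b 0.
Proof.
  intros H. exists nil. split; [constructor|]. split; auto. intros x. split; [intros []|].
  intros [Hx H0]. exact (H x Hx H0).
Qed.

(** A common endpoint that is not a zero keeps the two lists disjoint. *)
Lemma zeros_in_app f a b c k m : a <= b <= c -> f b <> 0 -> zeros_in f a b k -> zeros_in f b c m ->
  zeros_in f a c (k + m).
Proof.
  intros Hab Hb [l [N1 [L1 I1]]] [l' [N2 [L2 I2]]]. exists (l ++ l').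
  split; [|split].
  - apply NoDup_app; auto. intros x Hx Hx'. apply I1 in Hx. apply I2 in Hx'.
    apply Hb. replace b with x by lra. tauto.
  - rewrite length_app. lia.
  - intros x. rewrite in_app_iff, I1, I2. split.
    + intros [[? ?]|[? ?]]; split; auto; lra.
    + intros [? ?]. destruct (Rle_dec x b); [left|right]; split; auto; lra.
Qed.

Lemma strict_incr_of_deriv f df a b : (forall x, a <= x <= b -> dpl f x (df x)) ->
  (forall x, a <= x <= b -> 0 < df x) -> forall x y, a <= x -> x < y -> y <= b -> f x < f y.
Proof.
  intros Hd Hp x y Hx Hxy Hy. destruct (MVT_cor2 f df x y Hxy) as [c [Hc1 Hc2]].
  - intros; apply Hd; lra.
  - specialize (Hp c ltac:(lra)). nra.
Qed.

Lemma zeros_in_incr f df a b : a < b -> (forall x, dpl f x (df x)) -> (forall x, a <= x <= b -> 0 < df x) ->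
  f a < 0 -> 0 < f b -> zeros_in f a b 1.
Proof.
  intros Hab Hd Hp Ha Hb.
  pose proof (strict_incr_of_deriv f df a b (fun x _ => Hd x) Hp) as Hi.
  assert (Hc : continuity f) by (intros x; eapply dpl_cont, Hd).
  destruct (IVT f a b Hc Hab Ha Hb) as [z [Hz Hz0]].
  exists (z :: nil). split; [repeat constructor; intros []|]. split; auto.
  intros x. split.
  - intros [<-|[]]. auto.
  - intros [Hx Hx0]. left. destruct (Rtotal_order z x) as [h|[h|h]]; auto; exfalso.
    + specialize (Hi z x ltac:(lra) h ltac:(lra)). lra.
    + specialize (Hi x z ltac:(lra) h ltac:(lra)). lra.
Qed.

Lemma jcont_at_sign {n} (D : Rn n -> R -> R) mu0 x : jcont_at D mu0 x ->
  (0 < D mu0 x -> exists d, 0 < d /\ forall mu y, near mu0 d mu -> Rabs (y - x) < d -> 0 < D mu y) /\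
  (D mu0 x < 0 -> exists d, 0 < d /\ forall mu y, near mu0 d mu -> Rabs (y - x) < d -> D mu y < 0).
Proof.
  intros H. split; intros Hs.
  - destruct (H _ Hs) as [d [Hd H1]]. exists d. split; auto. intros mu y Hmu Hy.
    specialize (H1 mu y Hmu Hy). apply Rabs_def2 in H1. lra.
  - destruct (H (- D mu0 x) ltac:(lra)) as [d [Hd H1]]. exists d. split; auto. intros mu y Hmu Hy.
    specialize (H1 mu y Hmu Hy). apply Rabs_def2 in H1. lra.
Qed.

Lemma jcont_nbhd_pos {n} (D : Rn n -> R -> R) mu0 x : jcont_at D mu0 x -> 0 < D mu0 x ->
  nbhd mu0 (fun mu => 0 < D mu x).
Proof.
  intros H Hs. destruct (proj1 (jcont_at_sign D mu0 x H) Hs) as [d [Hd H1]]. exists d. split; auto.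
  intros mu Hmu. apply H1; auto. rewrite Rminus_diag, Rabs_R0. auto.
Qed.

Lemma jcont_nbhd_neg {n} (D : Rn n -> R -> R) mu0 x : jcont_at D mu0 x -> D mu0 x < 0 ->
  nbhd mu0 (fun mu => D mu x < 0).
Proof.
  intros H Hs. destruct (proj2 (jcont_at_sign D mu0 x H) Hs) as [d [Hd H1]]. exists d. split; auto.
  intros mu Hmu. apply H1; auto. rewrite Rminus_diag, Rabs_R0. auto.
Qed.

Lemma jcont_nbhd_nonzero {n} (D : Rn n -> R -> R) mu0 x : jcont_at D mu0 x -> D mu0 x <> 0 ->
  nbhd mu0 (fun mu => D mu x <> 0).
Proof.
  intros H Hs. destruct (Rtotal_order (D mu0 x) 0) as [h|[h|h]]; [|contradiction|].
  - eapply filter_imp; [|apply (jcont_nbhd_neg D mu0 x H h)]. cbv beta. intros; lra.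
  - eapply filter_imp; [|apply (jcont_nbhd_pos D mu0 x H h)]. cbv beta. intros; lra.
Qed.

(** For an increasing function the endpoint signs decide between no zero and one, and nonzero
    endpoint values keep their signs for nearby parameters. *)
Lemma stable_zeros_incr {n} (D dD : Rn n -> R -> R) (mu0 : Rn n) a b : a < b ->
  (forall x, jcont_at D mu0 x) -> nbhd mu0 (fun mu => forall x, dpl (D mu) x (dD mu x)) ->
  nbhd mu0 (fun mu => forall x, a <= x <= b -> 0 < dD mu x) ->
  D mu0 a <> 0 -> D mu0 b <> 0 -> stable_zeros D mu0 a b.
Proof.
  intros Hab HD Hd Hp Ha Hb.
  destruct (Rtotal_order (D mu0 a) 0) as [ha|[ha|ha]]; [|contradiction|].
  - destruct (Rtotal_order (D mu0 b) 0) as [hb|[hb|hb]]; [|contradiction|].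
    + exists O. eapply filter_imp; [|apply (filter_and _ _ (filter_and _ _ Hd Hp) (jcont_nbhd_neg D mu0 b (HD b) hb))].
      intros mu [[A B] C]. apply zeros_in_none. intros x Hx.
      destruct (Req_dec x b) as [->|hne]; [lra|].
      pose proof (strict_incr_of_deriv (D mu) (dD mu) a b (fun x _ => A x) B x b). lra.
    + exists 1%nat. eapply filter_imp; [|apply (filter_and _ _ (filter_and _ _ Hd Hp)
        (filter_and _ _ (jcont_nbhd_neg D mu0 a (HD a) ha) (jcont_nbhd_pos D mu0 b (HD b) hb)))].
      intros mu [[A B] [C E]]. now apply (zeros_in_incr (D mu) (dD mu)).
  - exists O. eapply filter_imp; [|apply (filter_and _ _ (filter_and _ _ Hd Hp) (jcont_nbhd_pos D mu0 a (HD a) ha))].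
    intros mu [[A B] C]. apply zeros_in_none. intros x Hx.
    destruct (Req_dec x a) as [->|hne]; [lra|].
    pose proof (strict_incr_of_deriv (D mu) (dD mu) a b (fun x _ => A x) B a x). lra.
Qed.

Lemma jcont_at_opp {n} (D : Rn n -> R -> R) mu x : jcont_at D mu x -> jcont_at (fun m y => - D m y) mu x.
Proof.
  intros H. apply (jcont_at_comp1 D Ropp); auto. apply (dpl_cont _ _ (-1)). apply dpl_opp, dpl_id.
Qed.

Lemma stable_zeros_decr {n} (D dD : Rn n -> R -> R) (mu0 : Rn n) a b : a < b ->
  (forall x, jcont_at D mu0 x) -> nbhd mu0 (fun mu => forall x, dpl (D mu) x (dD mu x)) ->
  nbhd mu0 (fun mu => forall x, a <= x <= b -> dD mu x < 0) ->
  D mu0 a <> 0 -> D mu0 b <> 0 -> stable_zeros D mu0 a b.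
Proof.
  intros Hab HD Hd Hp Ha Hb.
  destruct (stable_zeros_incr (fun m y => - D m y) (fun m y => - dD m y) mu0 a b) as [k Hk]; auto.
  - intros x. now apply jcont_at_opp.
  - eapply filter_imp; [|apply Hd]. intros mu A x. now apply dpl_opp.
  - eapply filter_imp; [|apply Hp]. cbv beta. intros mu A x Hx. specialize (A x Hx). lra.
  - lra.
  - lra.
  - exists k. eapply filter_imp; [|apply Hk]. intros mu [l [N1 [L1 I1]]]. exists l. repeat split; auto.
    + apply I1 in H. lra.
    + apply I1 in H. lra.
    + apply I1 in H. lra.
    + intros [Hx H0]. apply I1. rewrite H0. split; auto. ring.
Qed.

(* Near every point either [D] or its derivative keeps its sign uniformly in the parameter; a Lebesgue
   number [d] for these intervals lets one cut [a, b] at nonzeros of [D mu0] into such pieces. *)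
Lemma stable_zeros_simple {n} (D dD : Rn n -> R -> R) (mu0 : Rn n) a b : a < b ->
  (forall x, jcont_at D mu0 x) -> (forall x, jcont_at dD mu0 x) ->
  nbhd mu0 (fun mu => forall x, dpl (D mu) x (dD mu x)) ->
  (forall x, D mu0 x = 0 -> dD mu0 x <> 0) ->
  D mu0 a <> 0 -> D mu0 b <> 0 -> stable_zeros D mu0 a b.
Proof.
  intros Hab HD HdD Hder Hs Ha Hb.
  assert (Hder0 : forall x, dpl (D mu0) x (dD mu0 x)).
  { destruct Hder as [d [Hd H]]. apply H. now apply near_refl. }
  set (good := fun (d x r : R) =>
    (forall mu y, near mu0 d mu -> Rabs (y - x) < r -> D mu y <> 0) \/
    (forall mu y, near mu0 d mu -> Rabs (y - x) < r -> 0 < dD mu y) \/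
    (forall mu y, near mu0 d mu -> Rabs (y - x) < r -> dD mu y < 0)).
  assert (Hloc : forall x, exists d : posreal, good d x (d + d)).
  { intros x.
    assert (H : exists d, 0 < d /\ good d x d).
    { destruct (Rtotal_order (D mu0 x) 0) as [h|[h|h]].
      - destruct (proj2 (jcont_at_sign D mu0 x (HD x)) h) as [d [Hd H1]]. exists d. split; auto.
        left. intros mu y A B. specialize (H1 mu y A B). lra.
      - specialize (Hs x h). destruct (Rtotal_order (dD mu0 x) 0) as [h'|[h'|h']]; [|contradiction|].
        + destruct (proj2 (jcont_at_sign dD mu0 x (HdD x)) h') as [d [Hd H1]]. exists d. split; auto.
          right; right; auto.
        + destruct (proj1 (jcont_at_sign dD mu0 x (HdD x)) h') as [d [Hd H1]]. exists d. split; auto.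
          right; left; auto.
      - destruct (proj1 (jcont_at_sign D mu0 x (HD x)) h) as [d [Hd H1]]. exists d. split; auto.
        left. intros mu y A B. specialize (H1 mu y A B). lra. }
    destruct H as [d [Hd H]]. assert (Hd2 : 0 < d / 2) by lra. exists (mkposreal _ Hd2). simpl.
    replace (d / 2 + d / 2) with d by field.
    destruct H as [H|[H|H]]; [left|right; left|right; right]; intros mu y A B; apply H; auto;
      (eapply near_mono; [|exact A]; lra). }
  pose (dl := fun x => proj1_sig (constructive_indefinite_description _ (Hloc x))).
  assert (Hdl : forall x, good (dl x) x (dl x + dl x)).
  { intros x. unfold dl. destruct (constructive_indefinite_description _ _); auto. }
  destruct (compactness_value_1d a b dl) as [d Hd].
  assert (Hgood : forall x, a <= x <= b -> good d x d).
  { intros x Hx. apply NNPP. intros Hn. apply (Hd x Hx). intros [t [Ht [Hxt Hdt]]]. apply Hn.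
    assert (Hy : forall y, Rabs (y - x) < d -> Rabs (y - t) < dl t + dl t).
    { intros y Hy. replace (y - t) with ((y - x) + (x - t)) by ring.
      eapply Rle_lt_trans; [apply Rabs_triang|]. lra. }
    destruct (Hdl t) as [H|[H|H]]; [left|right; left|right; right]; intros mu y A B; apply H; auto;
      (eapply near_mono; [|exact A]; lra). }
  clear dl Hdl Hd Hloc. assert (d_pos := cond_pos d).
  assert (Hstep : forall c c', a <= c -> c < c' -> c' <= b -> c' < c + d -> D mu0 c <> 0 -> D mu0 c' <> 0 ->
     stable_zeros D mu0 c c').
  { intros c c' H1 H2 H3 H4 H5 H6.
    assert (Hin : forall y, c <= y <= c' -> Rabs (y - c) < d) by (intros y Hy; rewrite Rabs_right; lra).
    destruct (Hgood c ltac:(lra)) as [H|[H|H]].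
    - exists O. exists d. split; auto. intros mu Hmu. apply zeros_in_none. intros x Hx. apply H; auto.
    - apply (stable_zeros_incr D dD); auto. exists d. split; auto.
    - apply (stable_zeros_decr D dD); auto. exists d. split; auto. }
  assert (Hjoin : forall c c', a <= c -> c < c' -> c' <= b -> c' < c + d -> D mu0 c <> 0 -> D mu0 c' <> 0 ->
     stable_zeros D mu0 a c -> stable_zeros D mu0 a c').
  { intros c c' H1 H2 H3 H4 H5 H6 [k Hk]. destruct (Hstep c c' H1 H2 H3 H4 H5 H6) as [m Hm].
    exists (k + m)%nat.
    eapply filter_imp; [|apply (filter_and _ _ (jcont_nbhd_nonzero D mu0 c (HD c) H5) (filter_and _ _ Hk Hm))].
    intros mu [A [B C]]. apply (zeros_in_app (D mu) a c c'); auto. lra. }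
  (* The cut point advances by at least [d / 4] per step, so [m] steps bring it within [d / 2] of
     [b]; each piece, the last included, is shorter than [d]. *)
  assert (Hind : forall m c, a <= c < b -> D mu0 c <> 0 -> stable_zeros D mu0 a c ->
     b - c < INR m * (d / 4) + d / 2 -> stable_zeros D mu0 a b).
  { induction m; intros c Hc Hc0 HG Hm.
    - simpl in Hm. apply (Hjoin c b); auto; lra.
    - rewrite S_INR in Hm. destruct (Rlt_le_dec (b - c) (d / 2)) as [h|h].
      + apply (Hjoin c b); auto; lra.
      (* Of the two candidates at distance [d / 4] and [d / 3] at least one is not a zero, because
         on this piece [D mu0] either has no zero or is strictly monotone. *)
      + assert (Hc' : exists c', c + d / 4 <= c' < c + d / 2 /\ D mu0 c' <> 0).
        { destruct (Req_dec (D mu0 (c + d / 4)) 0) as [z1|z1]; [|exists (c + d / 4); split; auto; lra].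
          exists (c + d / 3). split; [lra|]. intros z2.
          destruct (MVT_cor2 (D mu0) (dD mu0) (c + d / 4) (c + d / 3)) as [t [Ht1 Ht2]]; auto; [lra|].
          rewrite z1, z2 in Ht1.
          assert (Ht : Rabs (t - c) < d) by (rewrite Rabs_right; lra).
          assert (Hz : Rabs (c + d / 4 - c) < d) by (rewrite Rabs_right; lra).
          pose proof (near_refl mu0 d d_pos) as Hn.
          destruct (Hgood c ltac:(lra)) as [H|[H|H]].
          - exact (H mu0 _ Hn Hz z1).
          - specialize (H mu0 t Hn Ht). assert (0 < dD mu0 t * (c + d / 3 - (c + d / 4))) by (apply Rmult_lt_0_compat; lra). lra.
          - specialize (H mu0 t Hn Ht). assert (0 < - dD mu0 t * (c + d / 3 - (c + d / 4))) by (apply Rmult_lt_0_compat; lra). lra. }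
        destruct Hc' as [c' [Hc1 Hc2]].
        apply (IHm c'); auto; try lra. apply (Hjoin c c'); auto; lra. }
  destruct (INR_unbounded ((b - a) / (d / 4))) as [m Hm].
  apply (Hind m a); auto; try lra.
  - exists O. eapply filter_imp; [|apply (jcont_nbhd_nonzero D mu0 a (HD a) Ha)].
    intros mu A. apply zeros_in_none. intros x Hx. now replace x with a by lra.
  - apply (Rmult_lt_compat_r (d / 4)) in Hm; [|lra].
    unfold Rdiv at 1 in Hm. rewrite Rmult_assoc, Rinv_l in Hm; lra.
Qed.

(** The half-line is cut down to a compact interval whose ends are not zeros. The critical end is 0:
    a zero that stays there for all nearby [mu] is simple, hence isolated uniformly in [mu], and the
    right end can be moved slightly to its left. *)
Lemma stable_negative_zeros {n} (D dD : Rn n -> R -> R) (mu0 : Rn n) M : 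
  (forall x, jcont_at D mu0 x) -> (forall x, jcont_at dD mu0 x) ->
  nbhd mu0 (fun mu => forall x, dpl (D mu) x (dD mu x)) ->
  (forall x, D mu0 x = 0 -> dD mu0 x <> 0) ->
  nbhd mu0 (fun mu => forall x, x <= - M -> D mu x <> 0) ->
  (D mu0 0 <> 0 \/ nbhd mu0 (fun mu => D mu 0 = 0)) ->
  exists k, nbhd mu0 (fun mu => exists l, NoDup l /\ length l = k /\ forall x, In x l <-> x < 0 /\ D mu x = 0).
Proof.
  intros HD HdD Hder Hs HM H0.
  assert (Hb : exists b, - 1 <= b <= 0 /\ D mu0 b <> 0 /\ nbhd mu0 (fun mu => forall x, b <= x < 0 -> D mu x <> 0) /\
     (b = 0 -> D mu0 0 <> 0)).
  { destruct H0 as [H0|H0].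
    - exists 0. repeat split; auto; try lra. exists 1. split; [lra|]. intros mu _ x Hx. lra.
    - assert (Hz : D mu0 0 = 0). { destruct H0 as [d [Hd H]]. apply H. now apply near_refl. }
      assert (Hr : exists r, 0 < r /\ forall mu x, near mu0 r mu -> Rabs (x - 0) < r -> dD mu x <> 0).
      { specialize (Hs 0 Hz). destruct (Rtotal_order (dD mu0 0) 0) as [h|[h|h]]; [|contradiction|].
        - destruct (proj2 (jcont_at_sign dD mu0 0 (HdD 0)) h) as [d [Hd H1]]. exists d. split; auto.
          intros mu y A B. specialize (H1 mu y A B). lra.
        - destruct (proj1 (jcont_at_sign dD mu0 0 (HdD 0)) h) as [d [Hd H1]]. exists d. split; auto.
          intros mu y A B. specialize (H1 mu y A B). lra. }
      destruct Hr as [r [Hr Hr']]. set (b := - (Rmin 1 r / 2)).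
      assert (Hm : 0 < Rmin 1 r) by (apply Rmin_pos; lra).
      assert (Hm1 : Rmin 1 r <= 1) by apply Rmin_l. assert (Hm2 : Rmin 1 r <= r) by apply Rmin_r.
      assert (Hno : nbhd mu0 (fun mu => forall x, b <= x < 0 -> D mu x <> 0)).
      { eapply filter_imp; [|apply (filter_and _ _ (filter_and _ _ Hder H0) (nbhd_near mu0 r Hr))].
        intros mu [[A B] C] x Hx E. destruct (MVT_cor2 (D mu) (dD mu) x 0) as [t [Ht1 Ht2]]; auto; [lra|].
        rewrite B, E in Ht1. unfold b in Hx.
        assert (dD mu t <> 0). { apply Hr'; auto. rewrite Rminus_0_r, Rabs_left; lra. }
        assert (dD mu t * (0 - x) <> 0) by (apply Rmult_integral_contrapositive_currified; lra). lra. }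
      exists b. repeat split; auto; try (unfold b; lra).
      destruct Hno as [d [Hd H]]. apply H; [now apply near_refl|]. unfold b; lra. }
  destruct Hb as [b [Hb1 [Hb2 [Hb3 Hb4]]]].
  (* This puts [a] below [- M] and also below -1, hence to the left of [b], whatever the sign of
     [M]. *)
  set (a := - (Rabs M + 2)). assert (HaM : a <= - M) by (unfold a; pose proof (Rle_abs M); lra).
  assert (Hab : a < b) by (unfold a; pose proof (Rabs_pos M); lra).
  destruct (stable_zeros_simple D dD mu0 a b) as [k Hk]; auto.
  { destruct HM as [d [Hd H]]. apply H; [now apply near_refl|auto]. }
  exists k.
  assert (Hb5 : nbhd mu0 (fun mu => b = 0 -> D mu 0 <> 0)).
  { destruct (Req_dec b 0) as [e|hne].
    - eapply filter_imp; [|apply (jcont_nbhd_nonzero D mu0 0 (HD 0) (Hb4 e))]. auto.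
    - exists 1. split; [lra|]. tauto. }
  eapply filter_imp; [|apply (filter_and _ _ (filter_and _ _ HM Hk) (filter_and _ _ Hb3 Hb5))].
  intros mu [[A [l [N1 [L1 I1]]]] [B C]]. exists l. repeat split; auto.
  - apply I1 in H. destruct (Req_dec b 0) as [e|hne]; [|lra].
    destruct (Req_dec x 0) as [->|]; [|lra]. exfalso. now apply C.
  - now apply I1 in H.
  - intros [Hx Hz]. apply I1. split; auto. split.
    + apply Rnot_lt_le. intros h. apply (A x); auto. lra.
    + apply Rnot_lt_le. intros h. apply (B x); auto. lra.
Qed.

(** * Inertia of a continuous family of even potentials *)

Lemma dpl_local_zero f x a d : 0 < d -> (forall t, Rabs (t - x) < d -> f t = 0) -> dpl f x a -> a = 0.
Proof.
  intros Hd H Hf. apply (uniqueness_limite f x); auto.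
  intros eps He. exists (mkposreal d Hd). simpl. intros h Hh Hhd.
  rewrite !H.
  - unfold Rdiv. rewrite Rminus_diag, Rmult_0_l, Rminus_diag, Rabs_R0. auto.
  - rewrite Rminus_diag, Rabs_R0. auto.
  - now replace (x + h - x) with h by ring.
Qed.

(* [y' z - y z'] has derivative [y^2]: this is why the eigenvalues are simple zeros. *)
Lemma simple_zero Q M lam y dy z dz l : 0 < l -> (forall x, Rabs (Q x) <= M) -> hill_sol Q lam y dy ->
  (forall x, dpl z x (dz x)) -> (forall x, dpl dz x ((Q x - lam) * z x + - y x)) -> z 0 = 0 -> dz 0 = 0 ->
  (y 0 <> 0 \/ dy 0 <> 0) -> dy l * z l - y l * dz l <> 0.
Proof.
  intros Hl HM [Y1 Y2] Z1 Z2 Z3 Z4 Hnt Hw.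
  set (W := fun x => dy x * z x - y x * dz x).
  assert (HW : forall x, dpl W x (y x * y x)).
  { intros x. unfold W. specialize (Y1 x). specialize (Y2 x). specialize (Z1 x). specialize (Z2 x). der. ring. }
  (* [W] is nondecreasing and vanishes at both ends, at 0 by the data of [z] and at [l] by the
     assumed equality. Its derivative then vanishes inside, so [y] would be trivial. *)
  assert (HW0 : forall x, 0 <= x <= l -> W x = 0).
  { intros x Hx. assert (W 0 = 0) by (unfold W; rewrite Z3, Z4; ring).
    assert (W 0 <= W x) by (apply (incr_of_deriv_ge0 W (fun x => y x * y x)); auto; [lra|intros; nra]).
    assert (W x <= W l) by (apply (incr_of_deriv_ge0 W (fun x => y x * y x)); auto; [lra|intros; nra]).
    unfold W in *. lra. }
  assert (Hy : forall x, 0 < x < l -> y x = 0).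
  { intros x Hx. assert (E : y x * y x = 0).
    { apply (dpl_local_zero W x _ (Rmin x (l - x))); auto.
      - apply Rmin_pos; lra.
      - intros t Ht. apply HW0. pose proof (Rmin_l x (l - x)). pose proof (Rmin_r x (l - x)).
        apply Rabs_def2 in Ht. lra. }
    apply Rmult_integral in E. tauto. }
  assert (Hdy : dy (l / 2) = 0).
  { apply (dpl_local_zero y (l / 2) _ (l / 2)); auto; [lra|]. intros t Ht. apply Hy.
    apply Rabs_def2 in Ht. lra. }
  destruct (hill_zero Q M lam y dy (l / 2) HM (conj Y1 Y2)) with (x := 0) as [E1 E2]; auto.
  - apply Hy. lra.
  - tauto.
Qed.

(** Where [Q - lam >= 1], the product [y * dy] has derivative at least [dy^2 + y^2 > 0]. Positivity
    at [l] excludes the Neumann and the Dirichlet condition at once. *)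
Lemma no_very_negative_eigenvalue Q M lam y dy l : 0 < l -> (forall x, Rabs (Q x) <= M) ->
  lam <= - (M + 1) -> hill_sol Q lam y dy -> y 0 * dy 0 = 0 -> (y 0 <> 0 \/ dy 0 <> 0) -> 0 < y l * dy l.
Proof.
  intros Hl HM Hlam Hy H0 Hnt. rewrite <- H0.
  apply (strict_incr_of_deriv (fun x => y x * dy x) (fun x => dy x * dy x + (Q x - lam) * (y x * y x)) 0 l); try lra.
  - intros x _. destruct Hy as [Y1 Y2]. specialize (Y1 x). specialize (Y2 x). der. ring.
  - intros x _. specialize (HM x) as HMx. apply Rabs_le_between in HMx.
    assert (0 <= dy x * dy x) by nra. assert (0 <= y x * y x) by nra.
    assert (y x * y x <= (Q x - lam) * (y x * y x)) by (assert (0 <= (Q x - lam - 1) * (y x * y x)) by (apply Rmult_le_pos; lra); lra).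
    destruct (Req_dec (y x) 0) as [e1|e1]; [destruct (Req_dec (dy x) 0) as [e2|e2]|].
    + destruct (hill_zero Q M lam y dy x HM Hy e1 e2 0). tauto.
    + assert (0 < dy x * dy x) by nra. lra.
    + assert (0 < y x * y x) by nra. lra.
Qed.

Definition nbhd2 {n} (mu : Rn n) (lam : R) (A : Rn n * R -> Prop) : Prop :=
  exists d, 0 < d /\ forall nu y, near mu d nu -> Rabs (y - lam) < d -> A (nu, y).

Global Instance nbhd2_filter {n} (mu : Rn n) lam : Filter (nbhd2 mu lam).
Proof.
  constructor.
  - exists 1. split; [lra|auto].
  - intros A B [d [Hd HA]] [e [He HB]]. exists (Rmin d e). split; [now apply Rmin_pos|].
    intros nu y Hnu Hy. split.
    + apply HA; [eapply near_min_l; eauto|]. eapply Rlt_le_trans; [apply Hy|apply Rmin_l].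
    + apply HB; [eapply near_min_r; eauto|]. eapply Rlt_le_trans; [apply Hy|apply Rmin_r].
  - intros A B HAB [d [Hd HA]]. exists d; auto.
Qed.

Lemma hill_family_exists {n} (O : Rn n -> Prop) (Q : Rn n -> R -> R) al be :
  (forall mu x, O mu -> jcont_at Q mu x) -> (forall mu, O mu -> exists M, forall x, Rabs (Q mu x) <= M) ->
  exists Y dY : Rn n -> R -> R -> R, forall mu lam, O mu ->
    hill_sol (Q mu) lam (Y mu lam) (dY mu lam) /\ Y mu lam 0 = al /\ dY mu lam 0 = be.
Proof.
  intros HC HB.
  assert (H : forall mu lam, exists zz : (R -> R) * (R -> R), O mu ->
     hill_sol (Q mu) lam (fst zz) (snd zz) /\ fst zz 0 = al /\ snd zz 0 = be).
  { intros mu lam. destruct (classic (O mu)) as [HU|HU].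
    - destruct (HB mu HU) as [M HM].
      destruct (linear_homogeneous_exists (fun x => Q mu x - lam) (M + Rabs lam) al be) as [y [dy [A1 [A2 [A3 A4]]]]].
      + intros x. apply (continuity_pt_minus (Q mu) (fun _ => lam)); [|apply cont_const].
        apply jcont_at_cont; auto.
      + intros x. eapply Rle_trans; [apply Rabs_triang|]. rewrite Rabs_Ropp. specialize (HM x). lra.
      + exists (y, dy). simpl. unfold hill_sol. auto.
    - exists (fun _ => 0, fun _ => 0). tauto. }
  exists (fun mu lam => fst (proj1_sig (constructive_indefinite_description _ (H mu lam)))),
    (fun mu lam => snd (proj1_sig (constructive_indefinite_description _ (H mu lam)))).
  intros mu lam. destruct (constructive_indefinite_description _ _); auto.
Qed.

(** [Z] is the derivative of [Y] in [lam], found by differentiating the equation formally: the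
    source is [- Y] and the data vanish since those of [Y] do not depend on [lam]. *)
Lemma hill_family_smooth {n} (O : Rn n -> Prop) (Q : Rn n -> R -> R) al be (Y dY : Rn n -> R -> R -> R) :
  is_open O ->
  (forall mu x, O mu -> jcont_at Q mu x) -> (forall mu, O mu -> exists M, forall x, Rabs (Q mu x) <= M) ->
  (forall mu lam, O mu -> hill_sol (Q mu) lam (Y mu lam) (dY mu lam) /\ Y mu lam 0 = al /\ dY mu lam 0 = be) ->
  exists Z dZ : Rn n -> R -> R -> R, forall mu lam, O mu ->
    (forall x, dpl (Z mu lam) x (dZ mu lam x)) /\
    (forall x, dpl (dZ mu lam) x ((Q mu x - lam) * Z mu lam x + - Y mu lam x)) /\
    Z mu lam 0 = 0 /\ dZ mu lam 0 = 0 /\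
    forall x, dpl (fun s => Y mu s x) lam (Z mu lam x) /\ dpl (fun s => dY mu s x) lam (dZ mu lam x) /\
      jcont_at (fun m s => Y m s x) mu lam /\ jcont_at (fun m s => dY m s x) mu lam /\
      jcont_at (fun m s => Z m s x) mu lam /\ jcont_at (fun m s => dZ m s x) mu lam.
Proof.
  intros HO HC HB HY.
  assert (CY : forall mu lam x, O mu -> continuity_pt (Y mu lam) x).
  { intros mu lam x HU. eapply dpl_cont, (proj1 (HY mu lam HU)). }
  assert (Cq : forall mu lam x, O mu -> continuity_pt (fun x => Q mu x - lam) x).
  { intros mu lam x HU. apply (continuity_pt_minus (Q mu) (fun _ => lam)); [|apply cont_const].
    apply jcont_at_cont; auto. }
  assert (H : forall mu lam, exists zz : (R -> R) * (R -> R), O mu ->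
     (forall x, dpl (fst zz) x (snd zz x)) /\
     (forall x, dpl (snd zz) x ((Q mu x - lam) * fst zz x + - Y mu lam x)) /\ fst zz 0 = 0 /\ snd zz 0 = 0).
  { intros mu lam. destruct (classic (O mu)) as [HU|HU].
    - destruct (HB mu HU) as [M HM].
      destruct (linear_exists (fun x => Q mu x - lam) (fun x => - Y mu lam x) (M + Rabs lam) 0 0) as [y [dy Hy]]; auto.
      + intros x. eapply Rle_trans; [apply Rabs_triang|]. rewrite Rabs_Ropp. specialize (HM x). lra.
      + intros x. apply (continuity_pt_opp (Y mu lam)); auto.
      + now exists (y, dy).
    - exists (fun _ => 0, fun _ => 0). tauto. }
  pose (zz := fun mu lam => proj1_sig (constructive_indefinite_description _ (H mu lam))).
  exists (fun mu lam => fst (zz mu lam)), (fun mu lam => snd (zz mu lam)).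
  assert (HZ : forall mu lam, O mu ->
     (forall x, dpl (fst (zz mu lam)) x (snd (zz mu lam) x)) /\
     (forall x, dpl (snd (zz mu lam)) x ((Q mu x - lam) * fst (zz mu lam) x + - Y mu lam x)) /\
     fst (zz mu lam) 0 = 0 /\ snd (zz mu lam) 0 = 0).
  { intros mu lam. unfold zz. destruct (constructive_indefinite_description _ _); auto. }
  clearbody zz. clear H.
  intros mu lam HU. destruct (HZ mu lam HU) as [Z1 [Z2 [Z3 Z4]]]. destruct (HY mu lam HU) as [[Y1 Y2] [Y3 Y4]].
  split; [exact Z1|]. split; [exact Z2|]. split; [exact Z3|]. split; [exact Z4|].
  assert (HO2 : nbhd2 mu lam (fun t => O (fst t))).
  { destruct (HO mu HU) as [d [Hd Hd']]. exists d. split; auto. }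
  assert (Hq2 : luc (nbhd2 mu lam) (fun t x => Q (fst t) x - snd t) (fun x => Q mu x - lam)).
  { apply (luc_plus (nbhd2 mu lam) (fun t x => Q (fst t) x) (fun t _ => - snd t) (fun x => Q mu x) (fun _ => - lam)).
    - apply (luc_comp (nbhd2 mu lam) Q mu fst (fun _ x => x) (fun x => x)); auto using cont_id.
      + intros d Hd. exists d. split; auto.
      + apply (luc_const (nbhd2 mu lam)).
    - apply (tends_luc (nbhd2 mu lam)). intros eps He. exists eps. split; auto. simpl. intros _ y _ Hy.
      replace (- y - - lam) with (- (y - lam)) by ring. now rewrite Rabs_Ropp. }
  assert (Htc : forall (a : Rn n * R -> R) c, (forall t, O (fst t) -> a t = c) -> tends (nbhd2 mu lam) a c).
  { intros a c Ha eps He. eapply filter_imp; [|apply HO2]. cbv beta. intros t Ht. rewrite Ha; auto.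
    rewrite Rminus_diag, Rabs_R0. auto. }
  destruct (linear_ivp_luc (nbhd2 mu lam) (fun t => Y (fst t) (snd t)) (fun t => dY (fst t) (snd t))
    (fun t x => Q (fst t) x - snd t) (fun _ _ => 0) (Y mu lam) (dY mu lam) (fun x => Q mu x - lam) (fun _ => 0))
    as [LY LdY]; auto.
  { eapply filter_imp; [|apply HO2]. cbv beta. intros t Ht. destruct (HY (fst t) (snd t) Ht) as [[A1 A2] _].
    split; auto. intros x. eapply dpl_eq; [apply A2|ring]. }
  { intros x. eapply dpl_eq; [apply Y2|ring]. }
  { apply (luc_const (nbhd2 mu lam)). }
  { rewrite Y3. apply Htc. intros t Ht. now apply HY. }
  { rewrite Y4. apply Htc. intros t Ht. now apply HY. }
  destruct (linear_ivp_luc (nbhd2 mu lam) (fun t => fst (zz (fst t) (snd t))) (fun t => snd (zz (fst t) (snd t)))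
    (fun t x => Q (fst t) x - snd t) (fun t x => - Y (fst t) (snd t) x) (fst (zz mu lam)) (snd (zz mu lam))
    (fun x => Q mu x - lam) (fun x => - Y mu lam x)) as [LZ LdZ]; auto.
  { eapply filter_imp; [|apply HO2]. cbv beta. intros t Ht. destruct (HZ (fst t) (snd t) Ht) as [A1 [A2 _]]. auto. }
  { intros r eps He. eapply filter_imp; [|apply (LY r eps He)]. cbv beta. intros t Ht x Hx. specialize (Ht x Hx).
    replace (- Y (fst t) (snd t) x - - Y mu lam x) with (- (Y (fst t) (snd t) x - Y mu lam x)) by ring.
    now rewrite Rabs_Ropp. }
  { rewrite Z3. apply Htc. intros t Ht. now apply HZ. }
  { rewrite Z4. apply Htc. intros t Ht. now apply HZ. }
  (* With the coefficient taken at [lam + h], the quotient has source exactly [- Y mu lam], so only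
     the coefficient has to converge. *)
  destruct (linear_ivp_luc punct0 (fun h x => (Y mu (lam + h) x - Y mu lam x) / h)
    (fun h x => (dY mu (lam + h) x - dY mu lam x) / h) (fun h x => Q mu x - (lam + h)) (fun _ x => - Y mu lam x)
    (fst (zz mu lam)) (snd (zz mu lam)) (fun x => Q mu x - lam) (fun x => - Y mu lam x)) as [LD LdD]; auto.
  { eapply filter_imp; [|apply punct0_nonzero]. cbv beta. intros h Hh.
    destruct (HY mu (lam + h) HU) as [[A1 A2] _]. split; intros x; unfold Rdiv.
    - specialize (A1 x). specialize (Y1 x). der. field; auto.
    - specialize (A2 x). specialize (Y2 x). der. field; auto. }
  { intros r eps He. exists eps. split; auto. intros h _ Hh x _.
    replace (Q mu x - (lam + h) - (Q mu x - lam)) with (- h) by ring. now rewrite Rabs_Ropp. }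
  { apply (luc_const punct0). }
  { intros eps He. exists 1. split; [lra|]. intros h Hh _. rewrite Z3, Y3.
    destruct (HY mu (lam + h) HU) as [_ [-> _]]. unfold Rdiv.
    rewrite Rminus_diag, Rmult_0_l, Rminus_diag, Rabs_R0. auto. }
  { intros eps He. exists 1. split; [lra|]. intros h Hh _. rewrite Z4, Y4.
    destruct (HY mu (lam + h) HU) as [_ [_ ->]]. unfold Rdiv.
    rewrite Rminus_diag, Rmult_0_l, Rminus_diag, Rabs_R0. auto. }
  assert (HJ : forall (f : Rn n * R -> R -> R) (f0 : R -> R) x, luc (nbhd2 mu lam) f f0 -> f (mu, lam) x = f0 x ->
    jcont_at (fun m s => f (m, s) x) mu lam).
  { intros f f0 x Hf Hf0 eps He. destruct (luc_tends (nbhd2 mu lam) f f0 x Hf eps He) as [d [Hd Hd']].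
    exists d. split; auto. intros nu y Hnu Hy. rewrite Hf0. exact (Hd' nu y Hnu Hy). }
  intros x. split; [|split; [|split; [|split; [|split]]]].
  - apply dpl_of_tends. exact (luc_tends punct0 _ _ x LD).
  - apply dpl_of_tends. exact (luc_tends punct0 _ _ x LdD).
  - apply (HJ _ _ x LY); auto.
  - apply (HJ _ _ x LdY); auto.
  - apply (HJ _ _ x LZ); auto.
  - apply (HJ _ _ x LdZ); auto.
Qed.

(** Detached from the nonlinear equation: the hypotheses say that at [lam = 0] the Neumann function
    is nonzero, and that the Dirichlet function is either nonzero at [mu0] or zero throughout a
    neighbourhood. *)
Lemma even_potentials_stable_inertia {n} (O : Rn n -> Prop) (Q : Rn n -> R -> R) mu0 L :
  is_open O -> O mu0 -> 0 < L -> (forall mu x, O mu -> jcont_at Q mu x) ->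
  (forall mu, O mu -> even (Q mu) /\ periodic L (Q mu)) ->
  (forall y dy, hill_sol (Q mu0) 0 y dy -> y 0 = 1 -> dy 0 = 0 -> dy (L / 2) <> 0) ->
  (forall y dy, hill_sol (Q mu0) 0 y dy -> y 0 = 0 -> dy 0 = 1 -> y (L / 2) <> 0) \/
  nbhd mu0 (fun mu => forall y dy, hill_sol (Q mu) 0 y dy -> y 0 = 0 -> dy 0 = 1 -> y (L / 2) = 0) ->
  exists k z, nbhd mu0 (fun mu => inertia (Q mu) L k z).
Proof.
  intros HO HO0 HL HC Hsym HN HD.
  set (l := L / 2) in *. assert (Hl : 0 < l) by (unfold l; lra).
  assert (HB : forall mu, O mu -> exists M, forall x, Rabs (Q mu x) <= M).
  { intros mu HU. destruct (Hsym mu HU) as [A1 A2].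
    destruct (even_periodic_bounded L (Q mu) HL) as [K [_ HK]]; eauto.
    intros x. apply jcont_at_cont; auto. }
  (* Locally uniform convergence controls the potentials only on [[0, l]]; folding makes the bound
     global, and it is the uniform lower bound for the eigenvalues that is needed below. *)
  assert (HBu : exists M, nbhd mu0 (fun mu => forall x, Rabs (Q mu x) <= M)).
  { destruct (HB mu0 HO0) as [M HM]. exists (M + 1).
    pose proof (jcont_luc Q mu0 (fun x => HC mu0 x HO0) l 1 Rlt_0_1) as Hu.
    eapply filter_imp; [|apply (filter_and _ _ (open_nbhd O mu0 HO HO0) Hu)].
    cbv beta. intros mu [HU Hmu] x. destruct (Hsym mu HU) as [A1 A2].
    destruct (fold_even_periodic L x HL) as [x' [Hx' E]]. rewrite (E _ A2 A1).
    assert (Hx : Rabs x' <= l) by (rewrite Rabs_right; unfold l; lra).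
    specialize (Hmu x' Hx). specialize (HM x').
    replace (Q mu x') with ((Q mu x' - Q mu0 x') + Q mu0 x') by ring.
    eapply Rle_trans; [apply Rabs_triang|]. lra. }
  destruct HBu as [M HM].
  assert (HOn := open_nbhd O mu0 HO HO0).
  destruct (hill_family_exists O Q 1 0 HC HB) as [Y1 [dY1 HY1]].
  destruct (hill_family_exists O Q 0 1 HC HB) as [Y2 [dY2 HY2]].
  destruct (hill_family_smooth O Q 1 0 Y1 dY1 HO HC HB HY1) as [Z1 [dZ1 HZ1]].
  destruct (hill_family_smooth O Q 0 1 Y2 dY2 HO HC HB HY2) as [Z2 [dZ2 HZ2]].
  destruct (HB mu0 HO0) as [M0 HM0].
  assert (HN0 : dY1 mu0 0 l <> 0).
  { destruct (HY1 mu0 0 HO0) as [A1 [A2 A3]]. exact (HN _ _ A1 A2 A3). }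
  assert (HD0 : Y2 mu0 0 l <> 0 \/ nbhd mu0 (fun mu => Y2 mu 0 l = 0)).
  { destruct HD as [HD|HD]; [left|right].
    - destruct (HY2 mu0 0 HO0) as [A1 [A2 A3]]. exact (HD _ _ A1 A2 A3).
    - eapply filter_imp; [|apply (filter_and _ _ HOn HD)]. cbv beta. intros mu [HU H].
      destruct (HY2 mu 0 HU) as [A1 [A2 A3]]. exact (H _ _ A1 A2 A3). }
  destruct (stable_negative_zeros (fun mu lam => dY1 mu lam l) (fun mu lam => dZ1 mu lam l) mu0 (M + 1)) as [k1 Hk1].
  { intros lam. apply (HZ1 mu0 lam HO0). }
  { intros lam. apply (HZ1 mu0 lam HO0). }
  { eapply filter_imp; [|apply HOn]. intros mu HU lam. apply (HZ1 mu lam HU). }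
  { intros lam Hz. destruct (HY1 mu0 lam HO0) as [A1 [A2 A3]]. destruct (HZ1 mu0 lam HO0) as [B1 [B2 [B3 [B4 _]]]].
    intros Hdz. apply (simple_zero (Q mu0) M0 lam (Y1 mu0 lam) (dY1 mu0 lam) (Z1 mu0 lam) (dZ1 mu0 lam) l); auto.
    - left. rewrite A2. lra.
    - rewrite Hz, Hdz. ring. }
  { eapply filter_imp; [|apply (filter_and _ _ HOn HM)]. cbv beta. intros mu [HU HMu] lam Hlam Hz.
    destruct (HY1 mu lam HU) as [A1 [A2 A3]].
    assert (0 < Y1 mu lam l * dY1 mu lam l); [|rewrite Hz in *; lra].
    apply (no_very_negative_eigenvalue (Q mu) M lam); auto.
    - rewrite A3. ring.
    - left. rewrite A2. lra. }
  { now left. }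
  destruct (stable_negative_zeros (fun mu lam => Y2 mu lam l) (fun mu lam => Z2 mu lam l) mu0 (M + 1)) as [k2 Hk2]; auto.
  { intros lam. apply (HZ2 mu0 lam HO0). }
  { intros lam. apply (HZ2 mu0 lam HO0). }
  { eapply filter_imp; [|apply HOn]. intros mu HU lam. apply (HZ2 mu lam HU). }
  { intros lam Hz. destruct (HY2 mu0 lam HO0) as [A1 [A2 A3]]. destruct (HZ2 mu0 lam HO0) as [B1 [B2 [B3 [B4 _]]]].
    intros Hdz. apply (simple_zero (Q mu0) M0 lam (Y2 mu0 lam) (dY2 mu0 lam) (Z2 mu0 lam) (dZ2 mu0 lam) l); auto.
    - right. rewrite A3. lra.
    - rewrite Hz, Hdz. ring. }
  { eapply filter_imp; [|apply (filter_and _ _ HOn HM)]. cbv beta. intros mu [HU HMu] lam Hlam Hz.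
    destruct (HY2 mu lam HU) as [A1 [A2 A3]].
    assert (0 < Y2 mu lam l * dY2 mu lam l); [|rewrite Hz in *; lra].
    apply (no_very_negative_eigenvalue (Q mu) M lam); auto.
    - rewrite A2. ring.
    - right. rewrite A3. lra. }
  assert (HNn : nbhd mu0 (fun mu => dY1 mu 0 l <> 0)).
  { apply (jcont_nbhd_nonzero (fun mu lam => dY1 mu lam l) mu0 0); auto. apply (HZ1 mu0 0 HO0). }
  assert (Hker : exists z, nbhd mu0 (fun mu => has_dim (in_ker (Q mu) L) z)).
  { assert (Hk : forall mu, O mu -> dY1 mu 0 l <> 0 ->
       (Y2 mu 0 l = 0 -> has_dim (in_ker (Q mu) L) 1) /\ (Y2 mu 0 l <> 0 -> has_dim (in_ker (Q mu) L) 0)).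
    { intros mu HU Hn. destruct (HB mu HU) as [Mu HMu]. destruct (Hsym mu HU) as [E1 E2].
      destruct (HY1 mu 0 HU) as [A1 [A2 A3]]. destruct (HY2 mu 0 HU) as [B1 [B2 B3]].
      apply (in_ker_has_dim (Q mu) Mu L (Y1 mu 0) (dY1 mu 0) (Y2 mu 0) (dY2 mu 0)); auto. }
    destruct HD0 as [HD0|HD0].
    - exists 0%nat.
      assert (Hnz : nbhd mu0 (fun mu => Y2 mu 0 l <> 0)).
      { apply (jcont_nbhd_nonzero (fun mu lam => Y2 mu lam l) mu0 0); auto. apply (HZ2 mu0 0 HO0). }
      eapply filter_imp; [|apply (filter_and _ _ (filter_and _ _ HOn HNn) Hnz)].
      cbv beta. intros mu [[HU H1] H2]. now apply Hk.
    - exists 1%nat. eapply filter_imp; [|apply (filter_and _ _ (filter_and _ _ HOn HNn) HD0)].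
      cbv beta. intros mu [[HU H1] H2]. now apply Hk. }
  destruct Hker as [z Hz]. exists (k1 + k2)%nat, z.
  eapply filter_imp; [|apply (filter_and _ _ (filter_and _ _ HOn Hz) (filter_and _ _ Hk1 Hk2))].
  cbv beta. intros mu [[HU Hker] [[lN [N1 [N2 N3]]] [lD [D1 [D2 D3]]]]]. split; auto.
  rewrite <- N2, <- D2. destruct (HB mu HU) as [Mu HMu]. destruct (Hsym mu HU) as [E1 E2].
  apply (in_neg_has_dim (Q mu) Mu L lN lD (Y1 mu) (dY1 mu) (Y2 mu) (dY2 mu)); auto.
Qed.

(** * Constancy of the inertia along the branch *)

Lemma Cj_sub {n} k (U V : Rn n -> Prop) F : (forall mu, V mu -> U mu) -> Cj k U F -> Cj k V F.
Proof.
  intros HVU. revert F. induction k; intros F [H1 H2]; split; auto.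
  destruct H2 as [DF [DX [A [B [C D]]]]]. exists DF, DX. repeat split; auto.
Qed.

Lemma is_open_and {n} (U V : Rn n -> Prop) : is_open U -> is_open V -> is_open (fun mu => U mu /\ V mu).
Proof.
  intros HU HV mu [H1 H2]. destruct (HU mu H1) as [d [Hd A]]. destruct (HV mu H2) as [e [He B]].
  exists (Rmin d e). split; [now apply Rmin_pos|]. intros nu Hnu. change (near mu (Rmin d e) nu) in Hnu. split.
  - apply A. exact (near_min_l _ _ _ _ Hnu).
  - apply B. exact (near_min_r _ _ _ _ Hnu).
Qed.

(** Translation invariance of the autonomous equation: the derivative of a solution solves the
    linearised equation. *)
Lemma hill_sol_derivative (g g' u du : R -> R) : (forall v, dpl g v (g' v)) ->
  (forall x, dpl u x (du x)) -> (forall x, dpl du x (g (u x))) ->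
  hill_sol (fun x => g' (u x)) 0 du (fun x => g (u x)).
Proof.
  intros Hg Hu Hdu. split; auto. intros x. eapply dpl_eq; [apply (dpl_comp u g); auto|]. ring.
Qed.

Theorem theorem3p5 (n : nat) (P : Rn n -> Prop) (g g' : Rn n -> R -> R)
  (mu0 : Rn n) (L0 : R) (phi dphi ddphi : R -> R) :
  is_open P ->
  smooth_on_prod P g ->
  (forall mu u, P mu -> derivable_pt_lim (g mu) u (g' mu u)) ->
  P mu0 ->
  0 < L0 ->
  (forall x, derivable_pt_lim phi x (dphi x)) ->
  (forall x, derivable_pt_lim dphi x (ddphi x)) ->
  (forall x, - ddphi x + g mu0 (phi x) = 0) ->
  periodic L0 phi ->
  even phi ->
  (forall f, in_ker (fun x => g' mu0 (phi x)) L0 f <->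
             exists c, forall x, f x = c * dphi x) ->
  exists (O : Rn n -> Prop) (psi dpsi ddpsi : Rn n -> R -> R),
    is_open O /\ (forall mu, O mu -> P mu) /\ O mu0 /\
    smooth_on_prod O psi /\
    (forall mu x, O mu -> derivable_pt_lim (psi mu) x (dpsi mu x)) /\
    (forall mu x, O mu -> derivable_pt_lim (dpsi mu) x (ddpsi mu x)) /\
    (forall mu x, O mu -> - ddpsi mu x + g mu (psi mu x) = 0) /\
    (forall mu, O mu -> periodic L0 (psi mu) /\ even (psi mu)) /\
    (forall x, psi mu0 x = phi x) /\
    (forall mu, O mu ->
       same_inertia (fun x => g' mu (psi mu x)) (fun x => g' mu0 (phi x)) L0).
Proof.
  intros HPo Hsm Dg HP0 HL F1 F2' Hode F3 F4 Hker.
  assert (F2 : forall x, dpl dphi x (g mu0 (phi x))).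
  { intros x. eapply dpl_eq; [apply F2'|]. specialize (Hode x). lra. }
  assert (Hg : forall k, Cj k P g) by (intros k; apply Ck_Cj, Hsm).
  assert (Hg' := Cj_deriv P g g' HPo Hg Dg).
  assert (CQ0 : forall x, continuity_pt (fun x => g' mu0 (phi x)) x).
  { intros x. apply (continuity_pt_comp phi (g' mu0)); [eapply dpl_cont, F1|]. apply (Cj_cont 0 P); auto. }
  assert (EQ0 : even (fun x => g' mu0 (phi x))) by (intros x; now rewrite F4).
  assert (PQ0 : periodic L0 (fun x => g' mu0 (phi x))) by (intros x; now rewrite F3).
  destruct (even_periodic_bounded L0 _ HL CQ0 PQ0 EQ0) as [M0 [_ HM0]].
  destruct (even_deriv_half L0 phi dphi F1 F3 F4) as [dphi0 dphil].
  (* A solution with both Neumann conditions would be periodic, hence in the kernel, hence a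
     multiple of [dphi], which vanishes at 0 whereas [y 0 = 1]. *)
  assert (HN : forall y dy, hill_sol (fun x => g' mu0 (phi x)) 0 y dy -> y 0 = 1 -> dy 0 = 0 -> dy (L0 / 2) <> 0).
  { intros y dy Hy A1 A2 A3.
    destruct (proj1 (Hker y)) as [c Hc].
    - apply eigen_eq_hill. split; [|eauto]. apply (neumann_periodic _ M0 L0 0 y dy HM0 EQ0 PQ0 Hy); auto.
    - specialize (Hc 0). rewrite dphi0, A1 in Hc. lra. }
  destruct (linear_homogeneous_exists _ M0 1 0 CQ0 HM0) as [y1 [dy1 [Y1 [Y2 [Y3 Y4]]]]].
  assert (Y5 : dy1 (L0 / 2) <> 0).
  { apply (HN y1 dy1); auto. split; auto. intros x. eapply dpl_eq; [apply Y2|ring]. }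
  destruct (smooth_family P g g' mu0 L0 phi dphi y1 dy1) as [O [psi [dpsi [HO [HOP [HO0 [Hpsi [Hsol Hpsi0]]]]]]]]; auto.
  { repeat split; auto. }
  assert (Epsi : psi mu0 = phi) by (apply functional_extensionality; auto).
  assert (HQc : Cj 0 O (fun mu x => g' mu (psi mu x))) by (apply (Cj_comp 0 P O g' psi); auto).
  destruct (even_potentials_stable_inertia O (fun mu x => g' mu (psi mu x)) mu0 L0) as [k [z [d [Hd Hin]]]]; auto.
  - intros mu x HU. apply (Cj_jcont 0 O); auto.
  - intros mu HU. destruct (Hsol mu HU) as [_ [_ [A3 A4]]]. split; intros x; [now rewrite A4|now rewrite A3].
  - rewrite Epsi. exact HN.
  - (* a zero of [dphi'] at [0] forces [dphi] to vanish identically, i.e. [phi] constant *)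
    destruct (Req_dec (g mu0 (phi 0)) 0) as [e|hne].
    (* With [dphi] identically 0 the kernel is trivial, so a periodic [y] would vanish, against
       [dy 0 = 1]. *)
    + left. rewrite Epsi. intros y dy Hy A1 A2 A3.
      destruct (proj1 (Hker y)) as [c Hc].
      * apply eigen_eq_hill. split; [|eauto]. apply (dirichlet_periodic _ M0 L0 0 y dy HM0 EQ0 PQ0 Hy); auto.
      * assert (Hz : forall x, y x = 0).
        { intros x. rewrite Hc.
          destruct (hill_zero (fun x => g' mu0 (phi x)) M0 0 dphi (fun x => g mu0 (phi x)) 0 HM0) with (x := x) as [-> _];
            auto; [|ring]. apply hill_sol_derivative; auto. }
        pose proof (dpl_zero_fun _ _ Hz (proj1 Hy) 0). lra.
    + right.
      assert (Hnz : nbhd mu0 (fun mu => g mu (psi mu 0) <> 0)).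
      { apply (jcont_nbhd_nonzero (fun mu x => g mu (psi mu x)) mu0 0).
        - apply (Cj_jcont 0 O); auto. apply (Cj_comp 0 P O g psi); auto.
        - now rewrite Epsi. }
      eapply filter_imp; [|apply (filter_and _ _ (open_nbhd O mu0 HO HO0) Hnz)].
      cbv beta. intros mu [HU Hn] y dy Hy A1 A2. destruct (Hsol mu HU) as [S1 [S2 [S3 S4]]].
      destruct (even_deriv_half L0 (psi mu) (dpsi mu) S1 S3 S4) as [s0 sl].
      pose proof (hill_sol_derivative (g mu) (g' mu) (psi mu) (dpsi mu) ltac:(auto) S1 S2) as Hd.
      destruct (even_periodic_bounded L0 (fun x => g' mu (psi mu x)) HL) as [M [_ HM]].
      * apply (Cj_cont 0 O (fun mu x => g' mu (psi mu x))); auto.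
      * intros x; now rewrite S3.
      * intros x; now rewrite S4.
      (* [dpsi mu] and [g mu (psi mu 0)] times [y] have the same Cauchy data at 0 and therefore
         coincide; the first vanishes at [L0 / 2] and the factor is not 0. *)
      * pose proof (hill_comb _ 0 1 (- g mu (psi mu 0)) _ _ _ _ Hd Hy) as Hw.
        destruct (hill_zero _ M 0 _ _ 0 HM Hw) with (x := L0 / 2) as [E _].
        -- rewrite s0, A1. ring.
        -- rewrite A2. ring.
        -- rewrite sl in E. apply (Rmult_eq_reg_l (g mu (psi mu 0))); auto. lra.
  (* The ball restricts the branch to parameters where the inertia is known to be the pair [k], [z];
     its centre [mu0] has the same pair, which gives the comparison. *)
  - set (B := fun mu : Rn n => exists r, r < d /\ forall i, Rabs (mu i - mu0 i) <= r).
    assert (HB : forall mu, B mu -> near mu0 d mu) by (intros mu [r [Hr H]] i; specialize (H i); lra).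
    exists (fun mu => O mu /\ B mu), psi, dpsi, (fun mu x => g mu (psi mu x)).
    split; [apply is_open_and; auto; apply open_ball_open|].
    split; [intros mu [HU _]; auto|].
    split.
    { split; auto. exists (d / 2). split; [lra|]. intros i. rewrite Rminus_diag, Rabs_R0. lra. }
    split; [intros m; apply (Cj_Ck m (fun mu => O mu /\ B mu)), (Cj_sub m O); auto; tauto|].
    split; [intros mu x [HU _]; now apply Hsol|].
    split; [intros mu x [HU _]; now apply Hsol|].
    split; [intros; ring|].
    split; [intros mu [HU _]; destruct (Hsol mu HU) as [_ [_ [A3 A4]]]; auto|].
    split; [auto|].
    intros mu [_ HBm]. exists k, z. split; [apply Hin; auto|].
    pose proof (Hin mu0 (near_refl mu0 d Hd)) as H0. cbv beta in H0. now rewrite Epsi in H0.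
Qed.
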